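(* Let $1\le p<\infty$ and let $w=\{w_n\}_{n=0}^\infty$ be a sequence of complex numbers with $w_0=0$. The following assertions hold. (i) Let $\phi(z)=1-|\Re(z)|$. Suppose there exist constants $C_4>0$ and $-\infty<v<\frac1p$ such that $$\sum_{n\ge1}|w_n|(n+1)^{3/p}r^n\le\frac{C_4}{(1-r)^v},\qquad 0<r<1.$$ Then $M_w$ induces a bounded operator on $A^p_\phi$. (ii) Let $\phi(z)=|g(z)|^\gamma$, where $0<\gamma<1$ and $g$ is a univalent analytic function on $\mathbb{D}$ with strictly positive real part. Suppose there exist constants $C_5>0$ and $k\in\mathbb{R}$ such that $$\sum_{n\ge1}\inf_{0<R<1}\left(\frac{\int_0^{2\pi}|g(Re^{i\theta})|^{-\gamma/p}\,d\theta}{R^n(1-R)^{2/p}}\right)|w_n|\,r^n\le\frac{C_5}{(1-r)^k}\quad\text{for all }0<r<1,$$ and $$\int_0^1\int_0^{2\pi}\frac{r\,|g(re^{i\theta})|^\gamma}{(1-r)^{pk}}\,d\theta\,dr<\infty.$$ Then $M_w$ defines a bounded operator on $A^p_\phi$.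
   Context: $\mathbb{D}$ is the open unit disc in $\mathbb{C}$ and $dA=\frac1\pi dx\,dy$. For a strictly positive integrable function (weight) $\phi$ on $\mathbb{D}$, $A^p_\phi$ is the space of analytic $f$ on $\mathbb{D}$ with $\|f\|^p_{A^p_\phi}=\int_{\mathbb{D}}|f|^p\phi\,dA<\infty$. $M_w$ is the coefficient multiplier $M_w\big(\sum_{n\ge0}\lambda_nz^n\big)=\sum_{n\ge0}w_n\lambda_nz^n$, with the convention $w_0=0$. *)

(* Defs.v *)
From HB Require Import structures.
From mathcomp Require Import all_boot all_order all_algebra.
From mathcomp Require Import all_classical all_reals all_analysis.
From mathcomp Require Export complex.

Set Implicit Arguments.
Unset Strict Implicit.
Unset Printing Implicit Defensive.

Import Order.TTheory GRing.Theory Num.Theory.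
Import numFieldNormedType.Exports.
Local Open Scope classical_set_scope.
Local Open Scope ring_scope.
Local Open Scope complex_scope.

(* [`|z|] lives in R[i]; [cabs z] is the same modulus as an element of R. *)
Definition cabs (R : realType) (z : R[i]) : R := complex.Re `|z|.

Definition disc (R : realType) (c : R[i]) (r : R) : set R[i] :=
  [set z | cabs (z - c) < r].

Definition unit_disc (R : realType) : set R[i] := disc 0 1.

Definition circle_point (R : realType) (r t : R) : R[i] :=
  (r * cos t) +i* (r * sin t).

Definition power_series_on (R : realType) (c : R[i]) (r : R) (a : nat -> R[i])
    (f : R[i] -> R[i]) : Prop :=
  forall z, z \in disc c r ->
    cabs (\sum_(0 <= k < n) a k * (z - c) ^+ k - f z) @[n --> \oo] --> (0 : R).

(* Functions on the unit disc are total functions on R[i] whose values outside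
   the disc are irrelevant. *)
Definition analytic_on_disc (R : realType) (f : R[i] -> R[i]) : Prop :=
  forall c, c \in @unit_disc R ->
    exists (r : R) (a : nat -> R[i]), 0 < r /\ power_series_on c r a f.

Definition univalent (R : realType) (g : R[i] -> R[i]) : Prop :=
  analytic_on_disc g /\ {in @unit_disc R &, injective g}.

(* Integration against dA = dx dy / pi over the unit disc, identifying (x, y)
   with x + i y. *)
Definition area_integral (R : realType) (F : R[i] -> \bar R) : \bar R :=
  ((pi^-1)%:E *
    \int[lebesgue_measure \x lebesgue_measure]_(xy in
        [set xy : R * R | xy.1 +i* xy.2 \in @unit_disc R])
      F (xy.1 +i* xy.2))%E.

Definition bergman_norm (R : realType) (p : R) (phi : R[i] -> R)
    (f : R[i] -> R[i]) : \bar R :=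
  (area_integral (fun z => (cabs (f z) `^ p * phi z)%:E) `^ p^-1)%E.

Definition bergman (R : realType) (p : R) (phi : R[i] -> R) :
    set (R[i] -> R[i]) :=
  [set f | analytic_on_disc f /\
    (area_integral (fun z => (cabs (f z) `^ p * phi z)%:E) < +oo)%E].

(* [F] is M_w f on the unit disc. *)
Definition is_multiplier (R : realType) (w : nat -> R[i])
    (f F : R[i] -> R[i]) : Prop :=
  exists lam : nat -> R[i],
    power_series_on 0 1 lam f /\ power_series_on 0 1 (fun n => w n * lam n) F.

Definition bounded_operator (R : realType) (p : R) (phi : R[i] -> R)
    (T : (R[i] -> R[i]) -> (R[i] -> R[i])) : Prop :=
  [/\ forall f, f \in bergman p phi -> T f \in bergman p phi,
      forall (a : R[i]) f h, f \in bergman p phi -> h \in bergman p phi ->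
        {in @unit_disc R, forall z,
          T (fun u => a * f u + h u) z = a * T f z + T h z}
    & exists C : R, forall f, f \in bergman p phi ->
        (bergman_norm p phi (T f) <= C%:E * bergman_norm p phi f)%E].

Definition multiplier_bounded (R : realType) (w : nat -> R[i]) (p : R)
    (phi : R[i] -> R) : Prop :=
  exists T : (R[i] -> R[i]) -> (R[i] -> R[i]),
    bounded_operator p phi T /\
    forall f, f \in bergman p phi -> is_multiplier w f (T f).

(* Main.v *)
(* Both parts combine a bound of the Taylor coefficients of f by its norm with
   integration of the resulting bound of |M_w f|. Since |f|^p is subharmonic,
   |f c|^p is at most the mean of |f|^p over a disc of radius comparable to
   1 - |c|; on that disc the weight is bounded below by a multiple of 1 - |c|
   in (i), and by a multiple of its value at c in (ii), by Harnack's inequality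
   for g. Cauchy's estimates turn this pointwise bound into
   |lam_n| <= b_n ||f||, the hypotheses say that sum b_n |w_n| |z|^n is at most
   M |z| with M r = C (1 - r)^(-v), and M |z| has finite norm by polar
   coordinates.

   An analytic function is given by local power series only, so its expansion on
   the whole disc has to be established. Averages over the N-th roots of unity
   replace Cauchy's integral formula: with nodes zeta_j on a circle |zeta| = s
   enclosing z, a weighted average of f (z + lam (zeta_j - z)) is nearly constant
   in lam in [0, 1], because its radial increments are proportional to increments
   along the circle, whose sum telescopes to 0. At lam = 0 it is f z and at
   lam = 1 it is a polynomial in z, so f is a limit of polynomials with
   controlled coefficients. *)

(* Every circle integral below is expanded in a series converging beyond the circle, whereas
   analyticity only supplies series of unknown radius; hence no mean value is available before the
   expansion on the whole disc. The node argument uses only a second-order bound on increments,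
   uniform on a closed disc by compactness. Its limits are taken in a fixed order: the step in lam
   tends to 0 with N fixed, leaving an error of order |w - 1|, where w is the N-th root; only then
   does N grow.

   Subharmonicity of |f|^p comes from the case p = 1 and the tangent inequality of t^p at |f c|.
   Harnack's inequality comes from Caratheodory's bound on the coefficients of a function with
   nonnegative real part.

   The exponents are explained by the sub-mean disc: its area gives (1 - |c|)^(-2/p), and in (i) the
   weight contributes one more power, hence 3/p. There the Cauchy circle has radius n/(n+1), which
   costs a factor (1 + 1/n)^n <= e. In (ii) its radius stays free, and the infimum over it is the
   one in the hypothesis. *)
Require Import Defs.
From HB Require Import structures.
From mathcomp Require Import all_boot all_order all_algebra.
From mathcomp Require Import all_classical all_reals all_analysis.
From mathcomp Require Import measurable_realfun complex ring lra.

Set Implicit Arguments.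
Unset Strict Implicit.
Unset Printing Implicit Defensive.

Import Order.TTheory GRing.Theory Num.Theory.
Import numFieldNormedType.Exports.
Local Open Scope classical_set_scope.
Local Open Scope ring_scope.

(** * Complex numbers and limits of complex sequences *)

Section Modulus.
Context {R : realType}.
Implicit Types (z w : R[i]) (x y : R).

Lemma cabsE z : cabs z = Num.sqrt (complex.Re z ^+ 2 + complex.Im z ^+ 2).
Proof. by case: z. Qed.

Lemma normc_cabs z : `|z| = (cabs z)%:C%C.
Proof. by case: z. Qed.

Lemma cabs_ge0 z : 0 <= cabs z.
Proof. by rewrite cabsE sqrtr_ge0. Qed.

Lemma cabs0 : cabs (0 : R[i]) = 0.
Proof. by rewrite /cabs normr0. Qed.

Lemma cabs1 : cabs (1 : R[i]) = 1.
Proof. by rewrite /cabs normr1. Qed.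

Lemma cabsM z w : cabs (z * w) = cabs z * cabs w.
Proof. by rewrite /cabs normrM !normc_cabs /= !mul0r subr0. Qed.

Lemma cabsN z : cabs (- z) = cabs z.
Proof. by rewrite /cabs normrN. Qed.

Lemma cabsB z w : cabs (z - w) = cabs (w - z).
Proof. by rewrite -cabsN opprB. Qed.

Lemma cabsD z w : cabs (z + w) <= cabs z + cabs w.
Proof. by rewrite -lecR rmorphD /= -!normc_cabs ler_normD. Qed.

Lemma cabs_eq0 z : (cabs z == 0) = (z == 0).
Proof. by rewrite -(normr_eq0 z) normc_cabs eq_complex /= eqxx andbT. Qed.

Lemma cabs_gt0 z : (0 < cabs z) = (z != 0).
Proof. by rewrite lt_def cabs_eq0 cabs_ge0 andbT. Qed.

Lemma cabsV z : cabs z^-1 = (cabs z)^-1.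
Proof.
have [->|z0] := eqVneq z 0; first by rewrite invr0 cabs0 invr0.
have c0 : cabs z != 0 by rewrite cabs_eq0.
by apply: (mulfI c0); rewrite -cabsM !mulfV// cabs1.
Qed.

Lemma cabsX z n : cabs (z ^+ n) = cabs z ^+ n.
Proof. by elim: n => [|n IH]; rewrite ?expr0 ?cabs1// !exprS cabsM IH. Qed.

Lemma cabsR x : cabs (x%:C%C) = `|x|.
Proof. by rewrite cabsE /= expr0n /= addr0 sqrtr_sqr. Qed.

Lemma natrC n : (n%:R : R[i]) = (n%:R : R)%:C%C.
Proof. by rewrite rmorph_nat. Qed.

Lemma cabs_sum n (F : 'I_n -> R[i]) :
  cabs (\sum_(i < n) F i) <= \sum_(i < n) cabs (F i).
Proof.
elim/big_ind2 : _ => [|z x w y zx wy|//]; first by rewrite cabs0.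
by apply: le_trans (cabsD _ _) _; apply: lerD.
Qed.

Lemma cabs_dist_add z w (v : R[i]) : cabs (z - w) <= cabs (z - v) + cabs (v - w).
Proof. by rewrite -[z - w](subrKA v) cabsD. Qed.

Lemma normRe_le_cabs z : `|complex.Re z| <= cabs z.
Proof. by rewrite cabsE -sqrtr_sqr ler_wsqrtr// lerDl sqr_ge0. Qed.

Lemma normIm_le_cabs z : `|complex.Im z| <= cabs z.
Proof. by rewrite cabsE -sqrtr_sqr ler_wsqrtr// lerDr sqr_ge0. Qed.

Lemma Re_le_cabs z : complex.Re z <= cabs z.
Proof. exact: le_trans (ler_norm _) (normRe_le_cabs _). Qed.

Lemma cabs_le_ReIm z : cabs z <= `|complex.Re z| + `|complex.Im z|.
Proof.
rewrite cabsE -[leRHS]ger0_norm ?addr_ge0// -sqrtr_sqr ler_wsqrtr//.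
by rewrite sqrrD !real_normK ?num_real// lerD2r lerDl mulrn_wge0// mulr_ge0.
Qed.

Lemma cReD z w : complex.Re (z + w) = complex.Re z + complex.Re w.
Proof. by case: z; case: w. Qed.
Lemma cImD z w : complex.Im (z + w) = complex.Im z + complex.Im w.
Proof. by case: z; case: w. Qed.
Lemma cReB z w : complex.Re (z - w) = complex.Re z - complex.Re w.
Proof. by case: z; case: w. Qed.
Lemma cImB z w : complex.Im (z - w) = complex.Im z - complex.Im w.
Proof. by case: z; case: w. Qed.
Lemma cReM z w : complex.Re (z * w) =
  complex.Re z * complex.Re w - complex.Im z * complex.Im w.
Proof. by case: z; case: w. Qed.
Lemma cImM z w : complex.Im (z * w) =
  complex.Re z * complex.Im w + complex.Im z * complex.Re w.
Proof. by case: z; case: w. Qed.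
Lemma cRe_sum n (F : nat -> R[i]) :
  complex.Re (\sum_(0 <= i < n) F i) = \sum_(0 <= i < n) complex.Re (F i).
Proof. by elim/big_rec2 : _ => // i x y _ <-; rewrite cReD. Qed.
Lemma cIm_sum n (F : nat -> R[i]) :
  complex.Im (\sum_(0 <= i < n) F i) = \sum_(0 <= i < n) complex.Im (F i).
Proof. by elim/big_rec2 : _ => // i x y _ <-; rewrite cImD. Qed.

Lemma complex_ext z w : complex.Re z = complex.Re w ->
  complex.Im z = complex.Im w -> z = w.
Proof. by case: z w => a b [c d] /= -> ->. Qed.

(** Only real functions are integrated below; multiplying by a suitable phase turns a modulus into a
    real part. *)
Lemma cabs_phase z : exists u, cabs u = 1 /\ u * z = (cabs z)%:C%C.
Proof.
have [->|z0] := eqVneq z 0; first by exists 1; rewrite cabs1 mulr0 cabs0.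
exists ((cabs z)%:C%C / z); rewrite divfK//; split => //.
by rewrite cabsM cabsV cabsR ger0_norm ?cabs_ge0// divff// cabs_eq0.
Qed.

Definition cexp x : R[i] := (cos x +i* sin x)%C.

Lemma cexpD x y : cexp (x + y) = cexp x * cexp y.
Proof. by rewrite /cexp cosD sinD; apply: complex_ext => //=; ring. Qed.

Lemma cexp0 : cexp 0 = 1.
Proof. by rewrite /cexp cos0 sin0. Qed.

Lemma cexpX x n : cexp x ^+ n = cexp (n%:R * x).
Proof.
by elim: n => [|n IH]; rewrite ?mul0r ?cexp0// exprS IH -cexpD mulrS mulrDl mul1r.
Qed.

Lemma cexpN x : cexp (- x) * cexp x = 1.
Proof. by rewrite -cexpD addNr cexp0. Qed.

Lemma cabs_cexp x : cabs (cexp x) = 1.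
Proof. by rewrite cabsE /= cos2Dsin2 sqrtr1. Qed.

Lemma cexp_neq0 x : cexp x != 0.
Proof. by rewrite -cabs_eq0 cabs_cexp oner_eq0. Qed.

Lemma cexp2pi : cexp (2 * pi) = 1.
Proof.
by rewrite /cexp mulr_natl -[pi *+ 2]add0r cosD2pi sinD2pi cos0 sin0.
Qed.

Lemma cexp_period (m : int) : cexp (m%:~R * (2 * pi)) = 1.
Proof.
case: m => n; first by rewrite -cexpX cexp2pi expr1n.
have h : cexp (n.+1%:R * (2 * pi) : R) = 1 by rewrite -cexpX cexp2pi expr1n.
by rewrite NegzE mulrNz mulNr; have := cexpN (n.+1%:R * (2 * pi)); rewrite h mulr1.
Qed.

Lemma circle_pointE x y : circle_point x y = x%:C%C * cexp y.
Proof. by apply: complex_ext => /=; ring. Qed.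

End Modulus.

Section Limits.
Context {R : realType}.
Implicit Types (u v : nat -> R[i]) (l m : R[i]).

(** Phrased through a real sequence so that it is, up to conversion, the convergence used in
    [power_series_on]. *)
Definition ccvg u l := cabs (u n - l) @[n --> \oo] --> (0 : R).

Lemma ccvgP u l : ccvg u l <->
  forall e : R, 0 < e -> \forall n \near \oo, cabs (u n - l) < e.
Proof.
split=> [/cvgrPdist_lt h e /h|h].
  by apply: filterS => n; rewrite sub0r normrN ger0_norm ?cabs_ge0.
apply/cvgrPdist_lt => e /h; apply: filterS => n.
by rewrite sub0r normrN ger0_norm ?cabs_ge0.
Qed.

Lemma ccvg_le u l (B : R) : ccvg u l ->
  (\forall n \near \oo, cabs (u n) <= B) -> cabs l <= B.
Proof.
move=> /ccvgP h hB; apply/ler_addgt0Pr => e e0.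
have [n [hn hBn]] : exists n, cabs (u n - l) < e /\ cabs (u n) <= B.
  have /(_ _)/filter_ex := filterI (h e e0) hB; case=> n [? ?].
  by exists n.
rewrite -[l](subrK (u n)) addrC; apply: le_trans (cabsD _ _) _.
by rewrite lerD// cabsB ltW.
Qed.

Lemma ccvgD u v l m : ccvg u l -> ccvg v m -> ccvg (fun n => u n + v n) (l + m).
Proof.
move=> /ccvgP hu /ccvgP hv; apply/ccvgP => e e0.
have e20 : 0 < e / 2 by rewrite divr_gt0.
near=> n; rewrite opprD addrACA; apply: le_lt_trans (cabsD _ _) _.
by rewrite (splitr e) ltrD//; near: n; [exact: hu|exact: hv].
Unshelve. all: by end_near. Qed.

Lemma ccvgMl u l (b : R[i]) : ccvg u l -> ccvg (fun n => b * u n) (b * l).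
Proof.
move=> h; rewrite /ccvg.
under eq_fun do rewrite -mulrBr cabsM.
by rewrite -(mulr0 (cabs b)); apply: cvgMr.
Qed.

Lemma ccvgN u l : ccvg u l -> ccvg (fun n => - u n) (- l).
Proof.
move=> h; rewrite /ccvg.
by under eq_fun do rewrite -opprD cabsN.
Qed.

Lemma ccvgB u v l m : ccvg u l -> ccvg v m -> ccvg (fun n => u n - v n) (l - m).
Proof. by move=> hu /ccvgN; exact: ccvgD. Qed.

Lemma ccvg_Re u l : ccvg u l -> complex.Re (u n) @[n --> \oo] --> complex.Re l.
Proof.
move=> /ccvgP h; apply/cvgrPdist_lt => e /h; apply: filterS => n.
by apply: le_lt_trans; rewrite -cReB cabsB normRe_le_cabs.
Qed.

Lemma ccvg_Im u l : ccvg u l -> complex.Im (u n) @[n --> \oo] --> complex.Im l.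
Proof.
move=> /ccvgP h; apply/cvgrPdist_lt => e /h; apply: filterS => n.
by apply: le_lt_trans; rewrite -cImB cabsB normIm_le_cabs.
Qed.

Lemma ccvg_ReIm u (a b : R) : complex.Re (u n) @[n --> \oo] --> a ->
  complex.Im (u n) @[n --> \oo] --> b -> ccvg u (a +i* b)%C.
Proof.
move=> /cvgrPdist_lt ha /cvgrPdist_lt hb; apply/ccvgP => e e0.
have e20 : 0 < e / 2 by rewrite divr_gt0.
near=> n; apply: le_lt_trans (cabs_le_ReIm _) _.
rewrite cReB cImB/= (splitr e) ltrD// distrC; near: n; [exact: ha|exact: hb].
Unshelve. all: by end_near. Qed.

Lemma ccvg_unique u l m : ccvg u l -> ccvg u m -> l = m.
Proof.
move=> h1 h2; apply: complex_ext.
  by apply: cvg_unique (ccvg_Re h1) (ccvg_Re h2); exact: Rhausdorff.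
by apply: cvg_unique (ccvg_Im h1) (ccvg_Im h2); exact: Rhausdorff.
Qed.

Lemma ccvg_cabs u l : ccvg u l -> cabs (u n) @[n --> \oo] --> cabs l.
Proof.
move=> /ccvgP h; apply/cvgrPdist_lt => e /h; apply: filterS => n.
apply: le_lt_trans; rewrite ler_norml lerBlDr lerBrDr.
apply/andP; split.
  rewrite addrC lerBlDr; apply: le_trans (cabsD _ _).
  by rewrite addrC subrK.
by rewrite cabsB; apply: le_trans (cabsD _ _); rewrite subrK.
Qed.

(** Real and imaginary parts are dominated by the modulus, so each is an absolutely convergent real
    series. *)
Lemma ccvg_abs_series (b : nat -> R[i]) (B : R) :
  (forall n, \sum_(0 <= k < n) cabs (b k) <= B) ->
  exists2 l, ccvg (fun n => \sum_(0 <= k < n) b k) l & cabs l <= B.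
Proof.
move=> hB.
have real_case (t : nat -> R) : (forall k, `|t k| <= cabs (b k)) ->
    exists a : R, (\sum_(0 <= k < n) t k) @[n --> \oo] --> a.
  move=> ht; exists (limn (series t)).
  apply: (@normed_cvg _ R); apply: nondecreasing_is_cvgn.
    by apply: nondecreasing_series => k _ _; rewrite /= normr_ge0.
  exists B => _ [n _ <-]; apply: le_trans (hB n).
  by apply: ler_sum => k _; exact: ht.
have [x hx] := real_case _ (fun k => normRe_le_cabs (b k)).
have [y hy] := real_case _ (fun k => normIm_le_cabs (b k)).
have h : ccvg (fun n => \sum_(0 <= k < n) b k) (x +i* y)%C.
  apply: ccvg_ReIm.
    by under eq_fun do rewrite cRe_sum.
  by under eq_fun do rewrite cIm_sum.
exists (x +i* y)%C => //.
apply: (ccvg_le h); apply: nearW => n; apply: le_trans (hB n).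
by rewrite !big_mkord cabs_sum.
Qed.

End Limits.

(** * Power series *)

Section PowerSeries.
Context {R : realType}.
Implicit Types (c z : R[i]) (r rho s : R) (a : nat -> R[i]) (f F : R[i] -> R[i]).

Lemma in_disc c r z : (z \in disc c r) = (cabs (z - c) < r).
Proof. by apply/idP/idP; rewrite inE. Qed.

Lemma in_unit_disc z : (z \in @unit_disc R) = (cabs z < 1).
Proof. by rewrite in_disc subr0. Qed.

Lemma geometric_sum_le (q : R) n : 0 <= q -> q < 1 ->
  \sum_(0 <= k < n) q ^+ k <= (1 - q)^-1.
Proof.
move=> q0 q1; have q1' : 0 < 1 - q by rewrite subr_gt0.
rewrite -[leRHS]mul1r ler_pdivlMr//.
have -> : (\sum_(0 <= k < n) q ^+ k) * (1 - q) = 1 - q ^+ n.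
  elim: n => [|n IH]; first by rewrite big_nil mul0r expr0 subrr.
  by rewrite big_nat_recr//= mulrDl IH exprS; ring.
by rewrite gerBl exprn_ge0.
Qed.

(** The series converges at [c + rho], so its partial sums stay within some M of the value there; a
    term is the difference of two partial sums, hence at most 2 M. *)
Lemma ps_coef_bound c r a f rho : power_series_on c r a f -> 0 < rho < r ->
  exists2 M, 0 < M & forall k, cabs (a k) <= M / rho ^+ k.
Proof.
move=> hf /andP[rho0 rhor].
have rd : c + rho%:C%C \in disc c r.
  by rewrite in_disc addrAC subrr add0r cabsR gtr0_norm.
have /cvg_seq_bounded/pinfty_ex_gt0[M M0 /= hM] := cvgP _ (hf _ rd).
exists (2 * M) => [|k]; first by rewrite mulr_gt0.
pose S n := \sum_(0 <= k < n) a k * (c + rho%:C%C - c) ^+ k.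
have bS n : cabs (S n - f (c + rho%:C%C)) <= M.
  by have := hM n I; rewrite ger0_norm ?cabs_ge0.
rewrite ler_pdivlMr ?exprn_gt0//.
have -> : cabs (a k) * rho ^+ k = cabs (S k.+1 - S k).
  rewrite /S big_nat_recr//= addrAC subrr add0r cabsM cabsX.
  by rewrite addrAC subrr add0r cabsR gtr0_norm.
rewrite -[_ - _](subrKA (f (c + rho%:C%C))); apply: le_trans (cabsD _ _) _.
by rewrite mulr_natl mulr2n lerD// cabsB.
Qed.

Lemma geometric_majorant_sum a (M rho s : R) n : 0 < rho -> 0 <= s < rho ->
  (forall k, cabs (a k) <= M / rho ^+ k) ->
  \sum_(0 <= k < n) cabs (a k) * s ^+ k <= M / (1 - s / rho).
Proof.
move=> rho0 /andP[s0 srho] ha.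
have M0 : 0 <= M by have := ha 0; rewrite expr0 divr1; apply: le_trans; exact: cabs_ge0.
apply: (@le_trans _ _ (M * \sum_(0 <= k < n) (s / rho) ^+ k)).
  rewrite mulr_sumr; apply: ler_sum => k _.
  by rewrite expr_div_n [s ^+ k / _]mulrC mulrA ler_wpM2r ?exprn_ge0.
rewrite ler_wpM2l//; apply: geometric_sum_le.
  by rewrite divr_ge0// ltW.
by rewrite ltr_pdivrMr// mul1r.
Qed.

Lemma ps_sum_exists c r a :
  (forall s, 0 <= s < r -> exists M, forall n, \sum_(0 <= k < n) cabs (a k) * s ^+ k <= M) ->
  exists F, power_series_on c r a F.
Proof.
move=> ha.
have /choice[F hF] : forall z, exists l, z \in disc c r ->
    ccvg (fun n => \sum_(0 <= k < n) a k * (z - c) ^+ k) l.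
  move=> z; have [|zd] := boolP (z \in disc c r); last by exists 0.
  rewrite in_disc => zr; have [|M hM] := ha (cabs (z - c)); first by rewrite cabs_ge0.
  have [|l hl _] := @ccvg_abs_series _ (fun k => a k * (z - c) ^+ k) M.
    by move=> n; apply: le_trans (hM n); apply: ler_sum => k _; rewrite cabsM cabsX.
  by exists l.
by exists F => z; exact: hF.
Qed.

Lemma ps_ccvg c r a f z : power_series_on c r a f -> cabs (z - c) < r ->
  ccvg (fun n => \sum_(0 <= k < n) a k * (z - c) ^+ k) (f z).
Proof. by move=> hf zr; apply: hf; rewrite in_disc. Qed.

Lemma ps_at_center c r a f : 0 < r -> power_series_on c r a f -> f c = a 0.
Proof.
move=> r0 hf; have := @ps_ccvg _ _ _ _ c hf.
rewrite subrr cabs0 => /(_ r0) /ccvg_unique; apply.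
apply/ccvgP => e e0; exists 1%N => // -[//|n] _ /=.
rewrite big_nat_recl//= expr0 mulr1 big1 ?addr0 ?subrr ?cabs0// => k _.
by rewrite exprS mul0r mulr0.
Qed.

End PowerSeries.

(** * Integrals over circles *)

Section CircleIntegrals.
Context {R : realType}.
Implicit Types (c z u b : R[i]) (r rho : R) (a : nat -> R[i]) (f : R[i] -> R[i]).
Local Notation mu := (@lebesgue_measure R).
Local Notation I2pi := (`[0%R, (2 * pi)%R]%classic : set R).

Lemma twopi_gt0 : 0 < 2 * pi :> R.
Proof. by rewrite mulr_gt0// pi_gt0. Qed.

Lemma continuous_Re_cexp b (m : R) : continuous (fun t => complex.Re (b * cexp (m * t))).
Proof.
rewrite (_ : (fun t => _) =
    fun t => complex.Re b * cos (m * t) - complex.Im b * sin (m * t)); last first.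
  by apply/funext => t; rewrite cReM.
move=> t.
have hm : (fun t => m * t) @ t --> m * t by apply: cvgMr; exact: cvg_id.
apply: cvgB; apply: cvgMr.
  by apply: (cvg_comp _ _ hm); exact: continuous_cos.
by apply: (cvg_comp _ _ hm); exact: continuous_sin.
Qed.

Lemma integrable_circle_continuous (h : R -> R) :
  continuous h -> mu.-integrable I2pi (EFin \o h).
Proof.
move=> ch; apply: continuous_compact_integrable; first exact: segment_compact.
exact: continuous_subspaceT.
Qed.

Lemma Rintegral_cexp b (m : int) :
  \int[mu]_(t in I2pi) complex.Re (b * cexp (m%:~R * t)) =
  if m == 0 then 2 * pi * complex.Re b else 0.
Proof.
have [->|m0] := eqVneq m 0.
  under eq_Rintegral do rewrite mul0r cexp0 mulr1.
  rewrite Rintegral_cst//= lebesgue_measure_itv/= lte_fin twopi_gt0.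
  by rewrite -EFinB/= subr0 mulrC.
have m0' : m%:~R != 0 :> R by rewrite intr_eq0.
(* The real part of b e^(imt) / (im), an antiderivative that is 2 pi periodic. *)
pose F (t : R) : R := (complex.Re b * sin (m%:~R * t) + complex.Im b * cos (m%:~R * t)) / m%:~R.
have dF (t : R) : is_derive t (1 : R) F (complex.Re (b * cexp (m%:~R * t))).
  rewrite /F; apply: is_derive_eq; rewrite cReM/= /GRing.scale/=.
  by field.
have cF : continuous F.
  by move=> t; apply/differentiable_continuous/derivable1_diffP; case: (dF t).
rewrite /Rintegral (@continuous_FTC2 _ _ F) ?twopi_gt0//.
- rewrite -EFinB/= /F mulr0.
  have [-> ->] : cexp (m%:~R * (2 * pi)) = (1 +i* 0)%C :> R[i] := cexp_period m.
  by rewrite cos0 sin0 subrr.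
- by apply: continuous_subspaceT; exact: continuous_Re_cexp.
- split => [t _| |]; first by case: (dF t).
    by apply: cvg_at_right_filter; exact: cF.
  by apply: cvg_at_left_filter; exact: cF.
- by move=> t _; rewrite derive1E; exact: (@derive_val _ _ _ _ _ _ _ (dF t)).
Qed.

Lemma sum_eq_int_near (nu : int) (X : nat -> R) : \forall n \near \oo,
  \sum_(0 <= k < n) (if k%:Z - nu == 0 then X k else 0) =
  if nu is Posz m then X m else 0.
Proof.
case: nu => m.
  exists m.+1 => // n /= mn.
  rewrite big_mkord (bigD1 (Ordinal mn))//= subrr eqxx big1 ?addr0// => k km.
  by rewrite subr_eq0 eqz_nat (negbTE (_ : nat_of_ord k != m)).
apply: nearW => n; rewrite big1// => k _.
by rewrite NegzE opprK gt_eqF// -PoszD addnS.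
Qed.

(* Coefficients with negative index vanish; integrating against them is what
   links [Re f] to the coefficients of [f]. *)
Lemma circle_coef c r a f rho u (nu : int) :
  power_series_on c r a f -> 0 < rho < r ->
  let h (t : R) := complex.Re (u * cexp (- nu%:~R * t) * f (c + circle_point rho t)) in
  mu.-integrable I2pi (EFin \o h) /\
  \int[mu]_(t in I2pi) h t =
    if nu is Posz n then 2 * pi * complex.Re (u * a n * (rho ^+ n)%:C%C) else 0.
Proof.
move=> hf /andP[rho0 rhor] h.
(* At a radius strictly larger than [rho] the coefficients are O(s^-k), so the partial sums are
   bounded uniformly on the circle of radius [rho]; this is the majorant [B] for dominated
   convergence. *)
pose s := (rho + r) / 2.
have [rhos sr] : rho < s /\ s < r by rewrite /s; split; lra.
have s0 : 0 < s by rewrite (lt_trans rho0).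
have [M M0 hM] : exists2 M, 0 < M & forall k, cabs (a k) <= M / s ^+ k.
  by apply: (ps_coef_bound hf); rewrite s0.
pose term k t := complex.Re (u * a k * (rho ^+ k)%:C%C * cexp ((k%:Z - nu)%:~R * t)).
pose g n t := \sum_(0 <= k < n) term k t.
have gE n t : g n t = complex.Re (u * cexp (- nu%:~R * t) *
    \sum_(0 <= k < n) a k * (circle_point rho t) ^+ k).
  rewrite mulr_sumr cRe_sum; apply: eq_bigr => k _; congr complex.Re.
  rewrite circle_pointE exprMn -rmorphXn/= cexpX rmorphB/= mulrBl.
  by rewrite addrC mulNr [cexp (_ + _)]cexpD; ring.
have cterm k : continuous (term k) by exact: continuous_Re_cexp.
have iterm k : mu.-integrable I2pi (EFin \o term k).
  exact: integrable_circle_continuous.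
have ig n : mu.-integrable I2pi (EFin \o g n) /\
    \int[mu]_(t in I2pi) g n t = \sum_(0 <= k < n)
      if k%:Z - nu == 0 then 2 * pi * complex.Re (u * a k * (rho ^+ k)%:C%C) else 0.
  elim: n => [|n [IHi IH]].
    rewrite big_nil /g; under eq_Rintegral do rewrite big_nil.
    split; last by rewrite Rintegral_cst// mul0r.
    rewrite (_ : EFin \o _ = cst 0)%E; first exact: integrable0.
    by apply/funext => t /=; rewrite big_nil.
  have gS : g n.+1 = (fun t => g n t + term n t).
    by apply/funext => t; rewrite /g big_nat_recr.
  rewrite gS big_nat_recr//=; split.
    by rewrite (_ : EFin \o _ = (EFin \o g n) \+ (EFin \o term n))%E//; exact: integrableD.
  by rewrite RintegralD// IH Rintegral_cexp.
pose B := cabs u * (M / (1 - rho / s)).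
have gB n t : `|g n t| <= B.
  rewrite gE; apply: le_trans (normRe_le_cabs _) _.
  rewrite !cabsM cabs_cexp mulr1 ler_wpM2l ?cabs_ge0//.
  apply: le_trans (geometric_majorant_sum n s0 _ hM); last by rewrite ltW.
  rewrite !big_mkord; apply: le_trans (cabs_sum _) _.
  apply: ler_sum => k _; rewrite cabsM cabsX circle_pointE cabsM cabsR cabs_cexp.
  by rewrite mulr1 gtr0_norm.
have gh t : g n t @[n --> \oo] --> h t.
  under eq_fun do rewrite gE.
  apply: ccvg_Re; apply: ccvgMl.
  have := @ps_ccvg _ c r a f (c + circle_point rho t) hf.
  by rewrite addrAC subrr add0r; apply; rewrite circle_pointE cabsM cabsR cabs_cexp mulr1 gtr0_norm.
have mg n := measurable_int mu (ig n).1.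
have mh : measurable_fun I2pi (EFin \o h : _ -> \bar R).
  apply: (emeasurable_fun_cvg (fun n => EFin \o g n)) => // t _.
  by apply: cvg_EFin; [exact: nearW|exact: gh].
have [|||ih _ hh] := @dominated_convergence _ _ _ mu I2pi (measurable_itv _)
    (fun n => EFin \o g n) (EFin \o h) (EFin \o cst B) mg mh.
- by apply: aeW => t _; apply: cvg_EFin; [exact: nearW|exact: gh].
- apply: integrable_circle_continuous => t; exact: cvg_cst.
- by apply: aeW => t n _ /=; rewrite lee_fin gB.
split => //.
have fh : (\int[mu]_(t in I2pi) (EFin \o h) t)%E = (\int[mu]_(t in I2pi) h t)%:E.
  by rewrite /Rintegral fineK//; apply: integrable_fin_num.
rewrite fh in hh.
have hR : \int[mu]_(t in I2pi) g n t @[n --> \oo] --> \int[mu]_(t in I2pi) h t.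
  exact: fine_cvg hh.
apply: (cvg_unique _ hR) => //.
apply: cvg_near_cst.
apply: filterS (sum_eq_int_near nu (fun k => 2 * pi * complex.Re (u * a k * (rho ^+ k)%:C%C))).
by move=> n <-; exact: (ig n).2.
Qed.

End CircleIntegrals.

Section CircleEstimates.
Context {R : realType}.
Implicit Types (c z u : R[i]) (r rho : R) (a b : nat -> R[i]) (f : R[i] -> R[i]).
Local Notation mu := (@lebesgue_measure R).
Local Notation I2pi := (`[0%R, (2 * pi)%R]%classic : set R).

Lemma measurable_cabs d (T : measurableType d) (D : set T) (F : T -> R[i]) :
  measurable_fun D (fun x => complex.Re (F x)) ->
  measurable_fun D (fun x => complex.Im (F x)) ->
  measurable_fun D (fun x => cabs (F x)).
Proof.
move=> mRe mIm; rewrite (_ : (fun x => cabs (F x)) = (fun x =>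
    (complex.Re (F x) ^+ 2 + complex.Im (F x) ^+ 2) `^ 2^-1)); last first.
  by apply/funext => x; rewrite powR12_sqrt ?cabsE// addr_ge0// sqr_ge0.
apply: (@measurableT_comp _ _ _ _ _ _ (@powR R ^~ 2^-1)); first exact: measurable_powR.
by apply: measurable_funD; exact: measurable_funX.
Qed.

Lemma cabs_circle_point rho (t : R) : 0 < rho -> cabs (circle_point rho t) = rho.
Proof. by move=> rho0; rewrite circle_pointE cabsM cabsR cabs_cexp mulr1 gtr0_norm. Qed.

Lemma circle_Re_integrable c r a f rho u : power_series_on c r a f -> 0 < rho < r ->
  mu.-integrable I2pi (EFin \o (fun t : R => complex.Re (u * f (c + circle_point rho t)))).
Proof.
move=> hf hrho; have [+ _] := circle_coef u 0 hf hrho.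
rewrite (_ : (fun t : R => _) = (fun t : R => complex.Re (u * f (c + circle_point rho t)))) //.
by apply/funext => t; rewrite oppr0 mul0r cexp0 mulr1.
Qed.

(** Dominated by |Re f| + |Im f|, and Im f is the real part of -i f, so [circle_Re_integrable]
    covers both terms. *)
Lemma circle_cabs_integrable c r a f rho : power_series_on c r a f -> 0 < rho < r ->
  mu.-integrable I2pi (EFin \o (fun t : R => cabs (f (c + circle_point rho t)))).
Proof.
move=> hf hrho.
have iRe := circle_Re_integrable 1 hf hrho.
have iIm := circle_Re_integrable (- 'i)%C hf hrho.
have EIm z : complex.Re (- 'i%C * z) = complex.Im z.
  by rewrite cReM/= oppr0 mul0r sub0r mulN1r opprK.
pose hr (t : R) := complex.Re (1 * f (c + circle_point rho t)).
pose hi (t : R) := complex.Re (- 'i%C * f (c + circle_point rho t)).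
have iD : mu.-integrable I2pi ((abse \o (EFin \o hr)) \+ (abse \o (EFin \o hi)))%E.
  by apply: integrableD => //; exact: integrable_abse.
apply: le_integrable iD => //.
- apply/measurable_EFinP; apply: measurable_cabs.
    have -> : (fun t => complex.Re (f (c + circle_point rho t))) = hr.
      by apply/funext => t; rewrite /hr mul1r.
    by apply/measurable_EFinP; exact: measurable_int iRe.
  have -> : (fun t => complex.Im (f (c + circle_point rho t))) = hi.
    by apply/funext => t; rewrite /hi EIm.
  by apply/measurable_EFinP; exact: measurable_int iIm.
- move=> t _ /=; rewrite lee_fin ger0_norm ?cabs_ge0// [leRHS]ger0_norm ?addr_ge0//.
  by rewrite /hr /hi EIm mul1r cabs_le_ReIm.
Qed.

(** With [u] the phase of the coefficient, the real integral of [circle_coef] equals the left side,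
    and its integrand is at most |f|. *)
Lemma coef_le_circle_mean c r a f rho n : power_series_on c r a f -> 0 < rho < r ->
  2 * pi * cabs (a n) * rho ^+ n <=
    \int[mu]_(t in I2pi) cabs (f (c + circle_point rho t)).
Proof.
move=> hf hrho; have [u [u1 ua]] := cabs_phase (a n).
have [ih hE] := circle_coef u n hf hrho.
have -> : 2 * pi * cabs (a n) * rho ^+ n = 2 * pi * complex.Re (u * a n * (rho ^+ n)%:C%C).
  by rewrite ua /= mulr0 subr0 mulrA.
rewrite -hE; apply: le_Rintegral => //; first exact: circle_cabs_integrable hf hrho.
move=> t _; apply: le_trans (Re_le_cabs _) _.
by rewrite !cabsM u1 cabs_cexp !mul1r.
Qed.

Lemma cauchy_estimate c r a f rho M n : power_series_on c r a f -> 0 < rho < r ->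
  (forall z, cabs (z - c) = rho -> cabs (f z) <= M) -> cabs (a n) * rho ^+ n <= M.
Proof.
move=> hf /[dup] hrho /andP[rho0 _] hM.
rewrite -(ler_pM2l (@twopi_gt0 R)) mulrA.
apply: le_trans (coef_le_circle_mean n hf hrho) _.
apply: (@le_trans _ _ (\int[mu]_(t in I2pi) M)).
  apply: le_Rintegral => //; first exact: circle_cabs_integrable hf hrho.
    by apply: integrable_circle_continuous => t; exact: cvg_cst.
  by move=> t _; apply: hM; rewrite addrAC subrr add0r cabs_circle_point.
rewrite Rintegral_cst//= lebesgue_measure_itv/= lte_fin twopi_gt0.
by rewrite -EFinB/= subr0 mulrC.
Qed.

(** On a circle inside both discs the two coefficients have the same integral representation; the
    phases 1 and -i recover real and imaginary parts. *)
Lemma ps_unique c r1 r2 a b f n : 0 < r1 -> 0 < r2 ->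
  power_series_on c r1 a f -> power_series_on c r2 b f -> a n = b n.
Proof.
move=> r10 r20 ha hb; pose rho := Num.min r1 r2 / 2.
have m0 : 0 < Num.min r1 r2 by rewrite lt_min r10.
have rho0 : 0 < rho by rewrite divr_gt0.
have rhom : rho < Num.min r1 r2 by rewrite ltr_pdivrMr// ltr_pMr// ltr1n.
have h1 : 0 < rho < r1 by rewrite rho0 (lt_le_trans rhom)// ge_min lexx.
have h2 : 0 < rho < r2 by rewrite rho0 (lt_le_trans rhom)// ge_min lexx orbT.
have rn0 : rho ^+ n != 0 by rewrite expf_neq0// gt_eqF.
have key u : complex.Re (u * a n) = complex.Re (u * b n).
  have [_ hE] := circle_coef u n ha h1; have [_ hE'] := circle_coef u n hb h2.
  have := hE'; rewrite hE => /(mulfI (lt0r_neq0 (@twopi_gt0 R))).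
  by rewrite ![complex.Re (_ * (_)%:C%C)]cReM/= !mulr0 !subr0 => /(mulIf rn0).
apply: complex_ext; first by have := key 1; rewrite !mul1r.
have := key (- 'i%C); rewrite !cReM/= oppr0 !mul0r !sub0r !mulN1r !opprK //.
Qed.

(* With [v = u e^{-int}], [Re (v f) + Re (conj v f) = 2 Re v Re f], and the
   second term integrates to a coefficient of negative index. *)
Lemma caratheodory_coef c r a f rho n : power_series_on c r a f -> 0 < rho < r ->
  (forall z, cabs (z - c) = rho -> 0 <= complex.Re (f z)) -> (0 < n)%N ->
  cabs (a n) * rho ^+ n <= 2 * complex.Re (a 0%N).
Proof.
move=> hf /[dup] hrho /andP[rho0 _] f0; case: n => // n _.
have [u [u1 ua]] := cabs_phase (a n.+1).
have [i1 e1] := circle_coef u n.+1 hf hrho.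
(* [Negz n] is the index -(n+1), so this integral is 0 and may be added freely. *)
have [i2 e2] := circle_coef (u^*)%C (Negz n) hf hrho.
have [i3 /= e3] := circle_coef 1 0 hf hrho.
rewrite -(ler_pM2l (@twopi_gt0 R)).
have -> : 2 * pi * (cabs (a n.+1) * rho ^+ n.+1) =
    2 * pi * complex.Re (u * a n.+1 * (rho ^+ n.+1)%:C%C) + 0.
  by rewrite ua /= mulr0 subr0 addr0.
rewrite -e1 -[X in _ + X]e2 -RintegralD//.
have -> : 2 * pi * (2 * complex.Re (a 0%N)) =
    2 * (2 * pi * complex.Re (1 * a 0%N * (rho ^+ 0)%:C%C)).
  by rewrite mul1r expr0 mulr1; ring.
rewrite -e3 -RintegralZl//.
apply: le_Rintegral => //=.
- exact: (integrableD _ i1 i2).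
- by apply: (integrableZl _ _ i3).
move=> t _; rewrite oppr0 mul0r cexp0 !mul1r.
set w := f _; have w0 : 0 <= complex.Re w.
  by apply: f0; rewrite addrAC subrr add0r cabs_circle_point.
pose v := u * cexp (- n.+1%:R * t).
have -> : (u^*)%C * cexp (- (Negz n)%:~R * t) = (v^*)%C.
  rewrite NegzE mulrNz opprK /v mulNr; case: (u) => x y.
  by apply: complex_ext; rewrite /cexp/= cosN sinN; ring.
have vle : complex.Re v <= 1.
  by apply: le_trans (Re_le_cabs _) _; rewrite cabsM u1 cabs_cexp mulr1.
rewrite -/v; clearbody v; rewrite !cReM; have -> : complex.Re (v^*)%C = complex.Re v by case: (v).
have -> : complex.Im (v^*)%C = - complex.Im v by case: (v).
have := ler_wpM2r w0 vle; rewrite mul1r; lra.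
Qed.

End CircleEstimates.

(** * Taylor expansion on discs *)

Section LocalDifferentiability.
Context {R : realType}.
Implicit Types (c z u h l p : R[i]) (r rho K : R) (a : nat -> R[i]) (f : R[i] -> R[i]).

(* A quantitative form of complex differentiability of [f] near [p] that does
   not mention the derivative: the difference quotients with increments [h] and
   [l] differ by at most [K |h - l|]. *)
Definition quotient_lipschitz f K p := forall h l,
  cabs h <= K^-1 -> cabs l <= K^-1 ->
  cabs (f (p + h)) <= K /\
  cabs ((f (p + h) - f p) * l - (f (p + l) - f p) * h)
    <= K * (cabs h * cabs l * cabs (h - l)).

(** A single [K] controls the neighbourhood, the admissible increments, the size of [f] and the
    second-order bound. The property is therefore monotone in [K], which is what the compactness
    argument needs. *)
Definition locally_quotient_lipschitz f z :=
  exists2 K, 0 < K & forall p, cabs (p - z) < K^-1 -> quotient_lipschitz f K p.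

Lemma quotient_lipschitz_le f K K' p : 0 < K -> K <= K' ->
  quotient_lipschitz f K p -> quotient_lipschitz f K' p.
Proof.
move=> K0 KK' hf h l hh hl.
have KV : K'^-1 <= K^-1 by rewrite lef_pV2// ?posrE// (lt_le_trans K0).
have [h1 h2] := hf h l (le_trans hh KV) (le_trans hl KV).
split; first exact: le_trans KK'.
by apply: le_trans h2 _; rewrite ler_wpM2r// !mulr_ge0 ?cabs_ge0.
Qed.

(** The usual factor k s^(k-1) is replaced by (s+e)^k / e: enlarging the radius by [e] absorbs the
    k, and the bound passes through the induction unchanged. *)
Lemma pow_quotient_bound u h (s e : R) k : 0 < e -> cabs u <= s -> cabs (u + h) <= s ->
  cabs ((u + h) ^+ k - u ^+ k) <= cabs h * ((s + e) ^+ k / e).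
Proof.
move=> e0 us uhs; have s0 : 0 <= s := le_trans (cabs_ge0 _) us.
elim: k => [|k IH]; first by rewrite !expr0 subrr cabs0 mulr_ge0 ?cabs_ge0// divr_ge0 ?ltW.
have -> : (u + h) ^+ k.+1 - u ^+ k.+1 = (u + h) * ((u + h) ^+ k - u ^+ k) + h * u ^+ k.
  by rewrite !exprS; ring.
apply: le_trans (cabsD _ _) _; rewrite !cabsM cabsX.
have h1 : cabs (u + h) * cabs ((u + h) ^+ k - u ^+ k) <= s * (cabs h * ((s + e) ^+ k / e)).
  by apply: ler_pM; rewrite ?cabs_ge0.
have h2 : cabs h * cabs u ^+ k <= cabs h * (s + e) ^+ k.
  rewrite ler_wpM2l ?cabs_ge0// lerXn2r ?nnegrE ?cabs_ge0 ?addr_ge0// ?ltW//.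
  by rewrite (le_lt_trans us)// ltrDl.
have -> : cabs h * ((s + e) ^+ k.+1 / e) =
    s * (cabs h * ((s + e) ^+ k / e)) + cabs h * (s + e) ^+ k.
  by rewrite exprS; field; rewrite gt_eqF.
exact: lerD.
Qed.

(** Second-order analogue: the quadratic factor in k is absorbed at the cost of a second division by
    [e]. *)
Lemma pow_quotient_lipschitz u h l (s e : R) k : 0 < e ->
  cabs u <= s -> cabs (u + h) <= s -> cabs (u + l) <= s ->
  cabs (((u + h) ^+ k - u ^+ k) * l - ((u + l) ^+ k - u ^+ k) * h) <=
  cabs h * cabs l * cabs (h - l) * ((s + e) ^+ k / e ^+ 2).
Proof.
move=> e0 us uhs uls; have s0 : 0 <= s := le_trans (cabs_ge0 _) us.
elim: k => [|k IH].
  rewrite !expr0 !subrr !mul0r subrr cabs0 !mulr_ge0 ?cabs_ge0// ?divr_ge0//.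
  by rewrite invr_ge0 exprn_ge0 ?ltW.
have -> : ((u + h) ^+ k.+1 - u ^+ k.+1) * l - ((u + l) ^+ k.+1 - u ^+ k.+1) * h =
   (u + h) * (((u + h) ^+ k - u ^+ k) * l - ((u + l) ^+ k - u ^+ k) * h) +
   (h - l) * h * ((u + l) ^+ k - u ^+ k).
  by rewrite !exprS; ring.
apply: le_trans (cabsD _ _) _; rewrite [cabs (_ * _)]cabsM [X in _ + X]cabsM [cabs (_ * h)]cabsM.
set D := cabs h * cabs l * cabs (h - l) in IH *.
have h1 : cabs (u + h) * cabs (((u + h) ^+ k - u ^+ k) * l - ((u + l) ^+ k - u ^+ k) * h)
    <= s * (D * ((s + e) ^+ k / e ^+ 2)).
  by apply: ler_pM; rewrite ?cabs_ge0.
have h2 : cabs (h - l) * cabs h * cabs ((u + l) ^+ k - u ^+ k) <= D * ((s + e) ^+ k / e).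
  have -> : D * ((s + e) ^+ k / e) = cabs (h - l) * cabs h * (cabs l * ((s + e) ^+ k / e)).
    by rewrite /D; ring.
  by rewrite ler_wpM2l ?mulr_ge0 ?cabs_ge0//; exact: pow_quotient_bound.
have -> : D * ((s + e) ^+ k.+1 / e ^+ 2) =
    s * (D * ((s + e) ^+ k / e ^+ 2)) + D * ((s + e) ^+ k / e).
  by rewrite exprS; field; rewrite gt_eqF.
exact: lerD.
Qed.

Lemma ps_locally_quotient_lipschitz c r a f z : power_series_on c r a f ->
  cabs (z - c) < r -> locally_quotient_lipschitz f z.
Proof.
move=> hf zr; set d := cabs (z - c) in zr *.
have d0 : 0 <= d by exact: cabs_ge0.
(* Five equal gaps between |z - c| and r. The first two locate [p] and [p + h], the third is the
   room used by the power bounds, the fourth reaches the radius [rho] of the coefficient bound, and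
   the last keeps [rho] below [r]. *)
pose e := (r - d) / 5; have e0 : 0 < e by rewrite divr_gt0 ?subr_gt0.
have hr : d + 5 * e = r by rewrite /e; field.
pose s := d + 2 * e; pose t := s + e; pose rho := t + e.
have s0 : 0 <= s by rewrite /s; lra.
have t0 : 0 <= t by rewrite /t; lra.
have trho : t < rho by rewrite /rho; lra.
have rho0 : 0 < rho by lra.
have [M M0 hM] : exists2 M, 0 < M & forall k, cabs (a k) <= M / rho ^+ k.
  by apply: (ps_coef_bound hf); rewrite rho0 /= /rho /t /s; lra.
pose M1 := M / (1 - t / rho).
have q1 : 0 < 1 - t / rho by rewrite subr_gt0 ltr_pdivrMr// mul1r.
have M10 : 0 < M1 by rewrite divr_gt0.
have hS n : \sum_(0 <= k < n) cabs (a k) * t ^+ k <= M1.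
  by apply: geometric_majorant_sum => //; rewrite t0.
(* The summands serve in turn for K^-1 <= e, for the size of [f], and for the second-order bound. *)
pose K := e^-1 + M1 + M1 / e ^+ 2.
have e2 : 0 < M1 / e ^+ 2 by rewrite divr_gt0// exprn_gt0.
have eV : 0 < e^-1 by rewrite invr_gt0.
have K0 : 0 < K by rewrite /K; lra.
have KVe : K^-1 <= e by rewrite -[e]invrK lef_pV2// ?posrE// /K; lra.
exists K => // p pz.
have pce : cabs (p - c) <= d + e.
  by apply: le_trans (cabs_dist_add _ _ z) _; rewrite addrC lerD2l; lra.
have pcs : cabs (p - c) <= s by rewrite /s; lra.
have bound h : cabs h <= K^-1 -> cabs (p - c + h) <= s.
  by move=> hh; apply: le_trans (cabsD _ _) _; rewrite /s; lra.
have sr : s < r by rewrite /s; lra.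
move=> h l hh hl.
have cv h' : cabs h' <= K^-1 ->
    ccvg (fun n => \sum_(0 <= k < n) a k * (p - c + h') ^+ k) (f (p + h')).
  move=> hh'; rewrite [p - c + h']addrAC; apply: (ps_ccvg hf).
  by rewrite -addrAC (le_lt_trans (bound _ hh')).
have cv0 : ccvg (fun n => \sum_(0 <= k < n) a k * (p - c) ^+ k) (f p).
  by apply: (ps_ccvg hf); rewrite (le_lt_trans pcs).
split.
  apply: (ccvg_le (cv _ hh)); apply: nearW => n.
  rewrite big_mkord; apply: le_trans (cabs_sum _) _.
  apply: (@le_trans _ _ M1); last by rewrite /K; lra.
  apply: le_trans (hS n); rewrite big_mkord; apply: ler_sum => k _.
  rewrite cabsM cabsX ler_wpM2l ?cabs_ge0// lerXn2r ?nnegrE ?cabs_ge0//.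
  by apply: le_trans (bound _ hh) _; rewrite /t; lra.
set E := fun k => ((p - c + h) ^+ k - (p - c) ^+ k) * l - ((p - c + l) ^+ k - (p - c) ^+ k) * h.
have cT : ccvg (fun n => \sum_(0 <= k < n) a k * E k)
    ((f (p + h) - f p) * l - (f (p + l) - f p) * h).
  have := ccvgB (ccvgMl l (ccvgB (cv _ hh) cv0)) (ccvgMl h (ccvgB (cv _ hl) cv0)).
  rewrite ![l * (_ - _)]mulrC ![h * (_ - _)]mulrC; congr (ccvg _ _).
  apply/funext => n; elim: n => [|n IH]; first by rewrite !big_nil; ring.
  by rewrite !big_nat_recr//= -IH /E; ring.
apply: (ccvg_le cT); apply: nearW => n.
rewrite big_mkord; apply: le_trans (cabs_sum _) _.
set D := cabs h * cabs l * cabs (h - l).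
have D0 : 0 <= D by rewrite !mulr_ge0 ?cabs_ge0.
apply: (@le_trans _ _ (M1 / e ^+ 2 * D)); last first.
  by rewrite ler_wpM2r// /K; lra.
have -> : M1 / e ^+ 2 * D = D / e ^+ 2 * M1 by ring.
apply: (@le_trans _ _ ((D / e ^+ 2) * \sum_(0 <= k < n) cabs (a k) * t ^+ k)); last first.
  by rewrite ler_wpM2l// divr_ge0// exprn_ge0 ?ltW.
rewrite big_mkord mulr_sumr; apply: ler_sum => k _.
rewrite cabsM [leRHS]mulrCA ler_wpM2l ?cabs_ge0//.
rewrite mulrAC -mulrA /E.
by apply: pow_quotient_lipschitz => //; exact: bound.
Qed.

Lemma analytic_locally_quotient_lipschitz f z : analytic_on_disc f ->
  z \in @unit_disc R -> locally_quotient_lipschitz f z.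
Proof.
move=> hf /hf[r [a [r0 ha]]].
by apply: (ps_locally_quotient_lipschitz ha); rewrite subrr cabs0.
Qed.

End LocalDifferentiability.

Section UniformQuotient.
Context {R : realType}.
Implicit Types (f : R[i] -> R[i]) (K s : R) (z : R[i]).

(** Compactness of the square [-s, s]^2, with the constant as a parameter tending to +oo. The
    implication inside [P] makes the corners of the square harmless. *)
Lemma uniform_quotient_lipschitz f s :
  (forall z, cabs z <= s -> locally_quotient_lipschitz f z) ->
  exists2 K, 0 < K & forall p, cabs p <= s -> quotient_lipschitz f K p.
Proof.
move=> hf.
pose A : set (R * R) := `[- s, s]%classic `*` `[- s, s]%classic.
have cA : compact A by apply: compact_setX; exact: segment_compact.
pose P (K : R) (x : R * R) := cabs (x.1 +i* x.2)%C <= s -> quotient_lipschitz f K (x.1 +i* x.2)%C.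
have cdist (x y : R * R) (e : R) : ball x e y -> cabs ((y.1 +i* y.2) - (x.1 +i* x.2))%C < e + e.
  move=> [/= h1 h2]; apply: le_lt_trans (cabs_le_ReIm _) _ => /=.
  by rewrite distrC [X in _ + X]distrC ltrD.
have hP : \forall K \near +oo, A `<=` P K.
  have /compact_near_coveringP := cA; apply => x Ax.
  have [xs|xs] := leP (cabs (x.1 +i* x.2)%C) s; last first.
    (* Points this close to [x] still lie outside the closed disc, so [P] holds vacuously near
       [x]. *)
    pose e := (cabs (x.1 +i* x.2)%C - s) / 2.
    have e0 : 0 < e by rewrite divr_gt0// subr_gt0.
    exists (ball x e, setT) => /=; first by split; [exact: nbhsx_ballx|exact: filterT].
    move=> [y K] [/= /cdist yx _] ys; exfalso.
    have := cabs_dist_add (x.1 +i* x.2)%C 0 (y.1 +i* y.2)%C.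
    by rewrite !subr0 cabsB; move: yx ys; rewrite /e; lra.
  have [K0 K00 hK] := hf _ xs.
  have e0 : 0 < K0^-1 / 2 by rewrite divr_gt0// invr_gt0.
  exists (ball x (K0^-1 / 2), [set K | K0 <= K]) => /=.
    by split; [exact: nbhsx_ballx|apply: nbhs_pinfty_ge; exact: num_real].
  move=> [y K] [/= /cdist yx KK] _; apply: (quotient_lipschitz_le K00 KK).
  by apply: hK; rewrite [ltRHS]splitr.
have [K [K0 hK]] : exists K, 0 < K /\ A `<=` P K.
  have h : \forall K \near +oo, 0 < K /\ A `<=` P K.
    by apply: filterI => //; apply: nbhs_pinfty_gt; exact: num_real.
  by have [K] := filter_ex h; exists K.
exists K => // p ps; case: p ps => x y ps.
apply: (hK (x, y)) => //; split; rewrite /= in_itv/= -ler_norml.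
  exact: le_trans (normRe_le_cabs (x +i* y)%C) ps.
exact: le_trans (normIm_le_cabs (x +i* y)%C) ps.
Qed.

Lemma quotient_lipschitz_bound f K p : 0 < K -> quotient_lipschitz f K p -> cabs (f p) <= K.
Proof.
move=> K0 /(_ 0 0); rewrite !cabs0 addr0 invr_ge0.
by move=> /(_ (ltW K0) (ltW K0)) [].
Qed.

(** Compare [h] with the longest admissible real increment l = K^-1 and divide by l. The part 2 K^2
    comes from |f (p + l) - f p| <= 2 K, the part 2 from |h - l| <= 2 / K. *)
Lemma quotient_lipschitz_lipschitz f K p h : 0 < K -> quotient_lipschitz f K p ->
  cabs h <= K^-1 -> cabs (f (p + h) - f p) <= (2 * K ^+ 2 + 2) * cabs h.
Proof.
move=> K0 hp hh; pose l : R[i] := (K^-1)%:C%C.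
have KV0 : 0 < K^-1 by rewrite invr_gt0.
have cl : cabs l = K^-1 by rewrite cabsR gtr0_norm.
have l1 : cabs l <= K^-1 by rewrite cl.
have [_] := hp h l hh l1; rewrite cl => hq.
have [hb _] := hp l l l1 l1.
have hp0 := quotient_lipschitz_bound K0 hp.
rewrite -(ler_pM2r KV0) -{1}cl -cabsM.
rewrite -[_ * l](subrK ((f (p + l) - f p) * h)); apply: le_trans (cabsD _ _) _.
have hl1 : cabs (f (p + l) - f p) <= 2 * K.
  by apply: le_trans (cabsD _ _) _; rewrite cabsN mulr_natl mulr2n lerD.
have hl2 : cabs (h - l) <= 2 * K^-1.
  by apply: le_trans (cabsD _ _) _; rewrite cabsN cl mulr_natl mulr2n lerD2r.
have h2 : cabs ((f (p + l) - f p) * h) <= 2 * K * cabs h.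
  by rewrite cabsM ler_wpM2r ?cabs_ge0.
have h1 : K * (cabs h * K^-1 * cabs (h - l)) <= 2 * K^-1 * cabs h.
  rewrite (_ : _ * _ = cabs (h - l) * cabs h); last by field; rewrite gt_eqF.
  by rewrite ler_wpM2r ?cabs_ge0.
have -> : (2 * K ^+ 2 + 2) * cabs h / K = 2 * K^-1 * cabs h + 2 * K * cabs h.
  by field; rewrite gt_eqF.
by rewrite lerD// (le_trans hq).
Qed.

End UniformQuotient.

(** * Roots of unity and discrete Cauchy averages *)

Section RootsOfUnity.
Context {R : realType}.

Definition uroot N : R[i] := cexp (2 * pi / N%:R).

Lemma urootX N : (0 < N)%N -> uroot N ^+ N = 1.
Proof.
move=> N0; rewrite /uroot cexpX mulrC divfK ?cexp2pi//.
by rewrite pnatr_eq0 -lt0n.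
Qed.

Lemma cabs_uroot N : cabs (uroot N) = 1.
Proof. exact: cabs_cexp. Qed.

(** The real part is cos (2x) = 1 - 2 (sin x)^2 with x = pi n / N strictly between 0 and pi. *)
Lemma uroot_neq1 N n : (0 < n < N)%N -> uroot N ^+ n != 1.
Proof.
move=> /andP[n0 nN]; rewrite /uroot cexpX; set t := _ * _.
have N0 : 0 < N%:R :> R by rewrite ltr0n (leq_trans _ nN).
pose x : R := pi * (n%:R / N%:R).
have x0 : 0 < x by apply: mulr_gt0; [exact: pi_gt0|apply: divr_gt0 => //; rewrite ltr0n].
have xpi : x < pi by rewrite gtr_pMr ?pi_gt0// ltr_pdivrMr// mul1r ltr_nat.
apply/eqP => /(congr1 (@complex.Re R)) /=.
have -> : t = x *+ 2 by rewrite /t /x -mulr_natr; field; rewrite gt_eqF.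
rewrite cos_mulr2n -mulr_natr => h3.
have s0 : 0 < sin x ^+ 2 by rewrite exprn_gt0// sin_gt0_pi// x0.
have := cos2Dsin2 x; lra.
Qed.

Lemma sum_powers_root (x : R[i]) N : x ^+ N = 1 -> x != 1 -> \sum_(0 <= j < N) x ^+ j = 0.
Proof.
move=> xN x1; have x10 : x - 1 != 0 by rewrite subr_eq0.
apply: (mulfI x10); rewrite mulr0.
suff -> : (x - 1) * (\sum_(0 <= j < N) x ^+ j) = x ^+ N - 1 by rewrite xN subrr.
elim: N {xN} => [|n IH]; first by rewrite big_nil mulr0 expr0 subrr.
by rewrite big_nat_recr//= mulrDr IH exprS; ring.
Qed.

Lemma cvg_uroot : cabs (uroot N - 1) @[N --> \oo] --> (0 : R).
Proof.
have h : (2 * pi / N%:R : R) @[N --> \oo] --> (0 : R).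
  rewrite -(mulr0 (2 * pi)); apply: cvgMr.
  by rewrite -(cvg_shiftS (fun n => n%:R^-1 : R)); exact: cvg_harmonic.
have := @ccvg_ReIm R uroot 1 0; apply.
  rewrite -cos0; apply: (cvg_comp _ _ h); exact: continuous_cos.
rewrite -sin0; apply: (cvg_comp _ _ h); exact: continuous_sin.
Qed.

End RootsOfUnity.

Section NodeAverages.
Context {R : realType}.
Variables (f : R[i] -> R[i]) (K s : R).
Hypotheses (K0 : 0 < K) (s0 : 0 < s).
Hypothesis hf : forall p, cabs p <= s -> quotient_lipschitz f K p.
Implicit Types (z : R[i]) (N n j : nat).

Definition node N j : R[i] := s%:C%C * uroot N ^+ j.

Lemma cabs_node N j : cabs (node N j) = s.
Proof. by rewrite cabsM cabsX cabs_uroot expr1n mulr1 cabsR gtr0_norm. Qed.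

Lemma node_neq0 N j : node N j != 0.
Proof. by rewrite -cabs_eq0 cabs_node gt_eqF. Qed.

(* Discrete analogue of the Cauchy integral for the Taylor coefficients. *)
Definition node_coef N n : R[i] :=
  if (n < N)%N then (\sum_(0 <= j < N) f (node N j) * (node N j)^-1 ^+ n) / N%:R else 0.

Definition node_poly N z := \sum_(0 <= n < N) node_coef N n * z ^+ n.

Lemma node_coef_bound N n : cabs (node_coef N n) <= K / s ^+ n.
Proof.
rewrite /node_coef; case: ifPn => [nN|_]; last first.
  by rewrite cabs0 divr_ge0 ?exprn_ge0 ?ltW.
have N0 : 0 < N%:R :> R by rewrite ltr0n (leq_ltn_trans _ nN).
rewrite cabsM cabsV natrC cabsR gtr0_norm// ler_pdivrMr//.
rewrite big_mkord; apply: le_trans (cabs_sum _) _.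
apply: (@le_trans _ _ (\sum_(j < N) (K / s ^+ n))); last first.
  by rewrite sumr_const card_ord mulr_natr.
apply: ler_sum => j _; rewrite cabsM cabsX cabsV cabs_node exprVn.
apply: ler_wpM2r; first by rewrite invr_ge0 exprn_ge0 ?ltW.
by apply: (quotient_lipschitz_bound K0); apply: hf; rewrite cabs_node.
Qed.

Section FixedPoint.
Variables (z : R[i]) (sg : R) (N : nat).
Hypotheses (zsg : cabs z <= sg) (sgs : sg < s) (N2 : (1 < N)%N).

Let sg0 : 0 <= sg. Proof. exact: le_trans (cabs_ge0 z) zsg. Qed.
Let N0 : 0 < N%:R :> R. Proof. by rewrite ltr0n (ltn_trans _ N2). Qed.
Let NC0 : N%:R != 0 :> R[i].
Proof. by rewrite pnatr_eq0 -lt0n (ltn_trans _ N2). Qed.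
Let w1 := cabs (uroot N - 1 : R[i]).
Let w10 : 0 < w1.
Proof. by rewrite cabs_gt0 subr_eq0; have := @uroot_neq1 R N 1 N2; rewrite expr1. Qed.

(** Bounds the modulus of the weights [wt] uniformly in the node and in [N]. *)
Definition kernel_bound := (1 - sg / s)^-1.
Let kp := kernel_bound.

Lemma kernel_bound_gt0 : 0 < kernel_bound.
Proof. by rewrite invr_gt0 subr_gt0 ltr_pdivrMr// mul1r. Qed.

(** The Cauchy kernel zeta / (zeta - z) with its geometric series cut off after [N] terms; the
    cut-off makes the average at the nodes a polynomial in z. *)
Let wt j := \sum_(0 <= n < N) (z / node N j) ^+ n.

Let cabs_wt j : cabs (wt j) <= kp.
Proof.
rewrite /wt big_mkord; apply: le_trans (cabs_sum _) _.
apply: le_trans (_ : \sum_(n < N) (sg / s) ^+ n <= kp).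
  apply: ler_sum => n _; rewrite cabsX cabsM cabsV cabs_node.
  have sV : 0 <= s^-1 by rewrite invr_ge0 ltW.
  by rewrite lerXn2r ?nnegrE ?mulr_ge0 ?cabs_ge0// ler_wpM2r.
have := @geometric_sum_le R (sg / s) N; rewrite big_mkord; apply.
  by rewrite divr_ge0// ltW.
by rewrite ltr_pdivrMr// mul1r.
Qed.

Let q : R[i] := 1 - (z / s%:C%C) ^+ N.

(** The truncation error [q] does not depend on the node, because all nodes have the same N-th
    power. In [G_step] it can thus be taken out of the telescoping sum. *)
Let wt_node j : wt j * (node N j - z) = node N j * q.
Proof.
have sC : s%:C%C != 0 :> R[i] by rewrite -cabs_eq0 cabsR normr_eq0 gt_eqF.
have -> : q = 1 - (z / node N j) ^+ N.
  have wN : (uroot N ^+ j) ^+ N = 1 :> R[i].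
    by rewrite -exprM mulnC exprM urootX ?(ltn_trans _ N2)// expr1n.
  by rewrite /q /node invfM mulrA [in RHS]exprMn exprVn wN invr1 mulr1.
have -> : node N j - z = node N j * (1 - z / node N j).
  by rewrite mulrBr mulr1 mulrC divfK// node_neq0.
rewrite mulrCA; congr (_ * _).
rewrite /wt; move: (z / node N j) => x.
elim: (N) => [|n IH]; first by rewrite big_nil mul0r expr0 subrr.
by rewrite big_nat_recr//= mulrDl IH exprS; ring.
Qed.

Let pt (lam : R) j := z + lam%:C%C * (node N j - z).
(** N times the weighted average of f over the nodes contracted towards z by the factor lam. *)
Let G lam := \sum_(0 <= j < N) f (pt lam j) * wt j.

Let nodeN j : node N (j + N) = node N j.
Proof. by rewrite /node exprD urootX ?mulr1// (ltn_trans _ N2). Qed.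

Let cabs_pt lam j : 0 <= lam <= 1 -> cabs (pt lam j) <= s.
Proof.
move=> /andP[l0 l1].
have -> : pt lam j = (1 - lam)%:C%C * z + lam%:C%C * node N j.
  by rewrite /pt rmorphB rmorph1; ring.
apply: le_trans (cabsD _ _) _; rewrite cabsM [cabs (lam%:C%C * _)]cabsM.
rewrite !cabsR cabs_node !ger0_norm ?subr_ge0//.
rewrite [leRHS](_ : _ = (1 - lam) * s + lam * s); last by ring.
by rewrite lerD2r ler_wpM2l ?subr_ge0// (le_trans zsg)// ltW.
Qed.

Let G1 : G 1 = node_poly N z * N%:R.
Proof.
rewrite /G /node_poly /pt.
under eq_bigr do rewrite mul1r addrC subrK /wt mulr_sumr.
rewrite exchange_big/= mulr_suml; apply: eq_big_nat => n /andP[_ nN].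
rewrite /node_coef nN mulrAC divfK// mulr_suml.
by apply: eq_bigr => j _; rewrite exprMn mulrAC mulrA.
Qed.

(** All arguments collapse to z, and summing the weights over the nodes kills every power of z
    except the zeroth. *)
Let G0 : G 0 = f z * N%:R.
Proof.
rewrite /G /pt; under eq_bigr do rewrite mul0r addr0.
rewrite -mulr_sumr; congr (_ * _); rewrite /wt exchange_big/=.
rewrite (big_ltn (ltn_trans _ N2))//.
have -> : \sum_(0 <= j < N) (z / node N j) ^+ 0 = N%:R.
  by under eq_bigr do rewrite expr0; rewrite big_mkord sumr_const card_ord.
rewrite big_nat big1 ?addr0// => n nN.
rewrite (_ : \sum_(0 <= i < N) _ = \sum_(0 <= i < N) (z / s%:C%C) ^+ n * ((uroot N ^+ n)^-1) ^+ i).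
  rewrite -mulr_sumr sum_powers_root ?mulr0//.
    by rewrite exprVn -exprM mulnC exprM urootX ?(ltn_trans _ N2)// expr1n invr1.
  by rewrite invr_eq1; exact: uroot_neq1.
apply: eq_bigr => i _; rewrite /node invfM mulrA exprMn; congr (_ * _).
by rewrite !exprVn -!exprM mulnC.
Qed.

Let C1 := 2 * K * s ^+ 2 * kp.

(* The increments [e (zeta_j - z)] (radial) and [lam (w - 1) zeta_j] (towards
   the next node) have comparable difference quotients, and the sum of the
   latter telescopes to zero around the circle. *)
Let G_step (lam e : R) : 0 < lam -> 0 < e -> lam + e <= 1 -> 2 * s * e <= K^-1 ->
  s * w1 <= K^-1 -> cabs (G (lam + e) - G lam) <= N%:R * (C1 * e * (2 * e + w1)).
Proof.
move=> l0 e0 le1 eK wK.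
pose h j := e%:C%C * (node N j - z); pose l j := lam%:C%C * (uroot N - 1) * node N j.
have lam1 : lam <= 1 by lra.
have lam01 : 0 <= lam <= 1 by rewrite ltW.
have zs : cabs z <= s by rewrite (le_trans zsg)// ltW.
have ch j : cabs (h j) <= 2 * s * e.
  rewrite cabsM cabsR gtr0_norm// mulrC; apply: ler_wpM2r; first exact: ltW.
  by apply: le_trans (cabsD _ _) _; rewrite cabsN cabs_node; lra.
have cl j : cabs (l j) = lam * w1 * s.
  by rewrite cabsM cabs_node cabsM cabsR gtr0_norm.
have clK j : cabs (l j) <= K^-1.
  rewrite cl; apply: (le_trans _ wK); rewrite -mulrA [w1 * s]mulrC.
  by rewrite ler_piMl// mulr_ge0// ltW.
(* The increment [l] leads to the contraction of the next node, whereas [h] moves the same point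
   radially. *)
have ptS j : pt lam j + l j = pt lam j.+1.
  by rewrite /pt /l /node exprS; ring.
have pth j : pt lam j + h j = pt (lam + e) j.
  by rewrite /pt /h rmorphD/=; ring.
have tel : \sum_(0 <= j < N) (f (pt lam j.+1) - f (pt lam j)) = 0.
  rewrite telescope_sumr//; have := nodeN 0; rewrite add0n /pt => ->.
  by rewrite subrr.
pose E j := (f (pt lam j + h j) - f (pt lam j)) * l j - (f (pt lam j + l j) - f (pt lam j)) * h j.
have hE j : cabs (E j * wt j / node N j) <= C1 * e * (2 * e + w1) * (lam * w1).
  rewrite cabsM cabsV cabs_node cabsM.
  have [_ hq] := hf (cabs_pt j lam01) (le_trans (ch j) eK) (clK j).
  have hlb : cabs (h j - l j) <= s * (2 * e + w1).
    apply: le_trans (cabsD _ _) _; rewrite cabsN cl.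
    have : lam * w1 * s <= 1 * w1 * s by rewrite -!mulrA ler_wpM2r// mulr_ge0// ltW.
    by have := ch j; rewrite mulrDr; lra.
  have b1 : cabs (E j) <= K * ((2 * s * e) * (lam * w1 * s) * (s * (2 * e + w1))).
    apply: le_trans hq _; rewrite ler_pM2l// cl.
    apply: ler_pM => //; rewrite ?mulr_ge0 ?cabs_ge0 ?(ltW l0) ?(ltW w10) ?(ltW s0)//.
    by rewrite ler_wpM2r// !mulr_ge0// ltW.
  have b2 : cabs (E j) * cabs (wt j) <=
      K * ((2 * s * e) * (lam * w1 * s) * (s * (2 * e + w1))) * kp.
    by apply: ler_pM; rewrite ?cabs_ge0.
  rewrite ler_pdivrMr//; apply: le_trans b2 _.
  by rewrite le_eqVlt; apply/orP; left; apply/eqP; rewrite /C1; ring.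
have lw0 : 0 < lam * w1 by rewrite mulr_gt0.
(* Multiplying by lam (w - 1), the ratio of [l j] to the node, turns the radial differences into the
   first half of [E]; the second half, after [wt_node], is the telescoping sum times the constant e
   q. *)
rewrite -(ler_pM2r lw0).
have -> : cabs (G (lam + e) - G lam) * (lam * w1) =
    cabs ((G (lam + e) - G lam) * (lam%:C%C * (uroot N - 1))).
  by rewrite !cabsM cabsR gtr0_norm.
have -> : (G (lam + e) - G lam) * (lam%:C%C * (uroot N - 1)) =
    \sum_(0 <= j < N) E j * wt j / node N j.
  transitivity (\sum_(0 <= j < N) E j * wt j / node N j +
     (\sum_(0 <= j < N) (f (pt lam j.+1) - f (pt lam j))) * (e%:C%C * q)); last first.
    by rewrite tel mul0r addr0.
  rewrite mulr_suml -big_split/= /G -sumrB mulr_suml; apply: eq_bigr => j _.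
  rewrite /E ptS pth.
  have hw : h j * wt j = e%:C%C * q * node N j.
    by rewrite /h -mulrA [_ * wt j]mulrC wt_node; ring.
  have -> (A B : R[i]) : (A * l j - B * h j) * wt j / node N j =
      (A * wt j * (lam%:C%C * (uroot N - 1)) * node N j - B * (h j * wt j)) / node N j.
    by congr (_ / _); rewrite /l; ring.
  rewrite hw; field; exact: node_neq0.
rewrite big_mkord; apply: le_trans (cabs_sum _) _.
apply: (@le_trans _ _ (\sum_(j < N) C1 * e * (2 * e + w1) * (lam * w1))).
  by apply: ler_sum => j _; exact: hE.
by rewrite sumr_const card_ord -[leLHS]mulr_natl mulrA.
Qed.

Let C2 := (2 * K ^+ 2 + 2) * (2 * s) * kp.

(** At lam = 0 the increment along the circle vanishes and [G_step] has nothing to compare with. The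
    plain Lipschitz bound suffices here, since it is used for one step only. *)
Let G_first (e : R) : 0 < e -> 2 * s * e <= K^-1 -> cabs (G e - G 0) <= N%:R * (C2 * e).
Proof.
move=> e0 eK; have zs : cabs z <= s by rewrite (le_trans zsg)// ltW.
rewrite /G -sumrB big_mkord; apply: le_trans (cabs_sum _) _.
apply: (@le_trans _ _ (\sum_(j < N) C2 * e)); last first.
  by rewrite sumr_const card_ord mulr_natl.
apply: ler_sum => j _; rewrite -mulrBl cabsM.
rewrite [pt 0 j]/pt mul0r addr0.
have ch : cabs (e%:C%C * (node N j - z)) <= 2 * s * e.
  rewrite cabsM cabsR gtr0_norm// mulrC; apply: ler_wpM2r; first exact: ltW.
  by apply: le_trans (cabsD _ _) _; rewrite cabsN cabs_node; lra.
have b := quotient_lipschitz_lipschitz K0 (hf zs) (le_trans ch eK).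
have c0 : 0 <= 2 * K ^+ 2 + 2 by rewrite addr_ge0// mulr_ge0// sqr_ge0.
apply: (@le_trans _ _ ((2 * K ^+ 2 + 2) * (2 * s * e) * kp)).
  apply: ler_pM; rewrite ?cabs_ge0//.
  by apply: le_trans b _; rewrite ler_wpM2l.
by rewrite le_eqVlt; apply/orP; left; apply/eqP; rewrite /C2; ring.
Qed.

(** Cut [0, 1] into M steps of length e = 1/M. One first step and at most M regular steps cost C2/M
    + C1 (2/M + w1) in total, and M is arbitrary while N is fixed. *)
Lemma node_poly_approx : s * cabs (uroot N - 1 : R[i]) <= K^-1 ->
  cabs (f z - node_poly N z) <= 2 * K * s ^+ 2 * kernel_bound * cabs (uroot N - 1 : R[i]).
Proof.
move=> wK; rewrite -/w1 -/kp -/C1; rewrite -/w1 in wK.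
have kp0 : 0 < kp := kernel_bound_gt0.
have C10 : 0 < C1 by rewrite !mulr_gt0// exprn_gt0.
have C20 : 0 < C2 by rewrite !mulr_gt0// ltr_wpDl// mulr_ge0// sqr_ge0.
have key M : (0 < M)%N -> 2 * s / M%:R <= K^-1 ->
    cabs (f z - node_poly N z) <= C1 * w1 + (C2 + 2 * C1) / M%:R.
  move=> M0 MK; have M0' : 0 < M%:R :> R by rewrite ltr0n.
  pose e : R := M%:R^-1; have e0 : 0 < e by rewrite invr_gt0.
  have steps m : (0 < m <= M)%N ->
      cabs (G (m%:R * e) - G 0) <= N%:R * (C2 * e + m%:R * (C1 * e * (2 * e + w1))).
    have D0 : 0 <= C1 * e * (2 * e + w1) by rewrite !mulr_ge0 ?addr_ge0 ?mulr_ge0 ?ltW.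
    elim: m => // m IH /andP[_ mM]; case: m => [|m] in IH mM *.
      rewrite mul1r; apply: le_trans (G_first e0 MK) _.
      by rewrite ler_pM2l// lerDl mul1r.
    apply: le_trans (cabs_dist_add _ _ (G (m.+1%:R * e))) _.
    have -> : m.+2%:R * e = m.+1%:R * e + e by rewrite -natr1; ring.
    have le1 : m.+1%:R * e + e <= 1.
      have -> : m.+1%:R * e + e = m.+2%:R / M%:R by rewrite -[in RHS]natr1 /e; ring.
      by rewrite ler_pdivrMr// mul1r ler_nat.
    have l0 : 0 < m.+1%:R * e by rewrite mulr_gt0.
    have IH' := IH (ltnW mM); have st := G_step l0 e0 le1 MK wK.
    apply: le_trans (lerD st IH') _.
    by rewrite -[in leRHS]natr1 le_eqVlt; apply/orP; left; apply/eqP; ring.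
  have := steps M; rewrite M0 leqnn => /(_ isT).
  rewrite /e divff ?gt_eqF// G1 G0 -mulrBl cabsM natrC cabsR gtr0_norm//.
  rewrite mulrC ler_pM2l// cabsB => h; apply: le_trans h _.
  by rewrite le_eqVlt; apply/orP; left; apply/eqP; field; rewrite gt_eqF.
apply/ler_addgt0Pr => d d0.
(* Taking M above [B] makes the error (C2 + 2 C1)/M smaller than [d] and the radial increments at
   most K^-1. *)
pose B := (C2 + 2 * C1) / d + 2 * s * K + 1.
have C120 : 0 < C2 + 2 * C1 by rewrite addr_gt0// mulr_gt0.
have B1 : 0 < (C2 + 2 * C1) / d by rewrite divr_gt0.
have B2 : 0 < 2 * s * K by rewrite !mulr_gt0.
have [M BM] : exists M : nat, B < M%:R.
  by exists (Num.truncn B).+1; apply: truncnS_gt.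
have M0 : 0 < M%:R :> R by apply: lt_trans BM; rewrite /B; lra.
have hM : (0 < M)%N by rewrite -(ltr0n R).
have MK : 2 * s / M%:R <= K^-1.
  by rewrite ler_pdivrMr// [K^-1 * _]mulrC ler_pdivlMr//; move: BM; rewrite /B; lra.
apply: le_trans (key M hM MK) _; rewrite lerD2l ler_pdivrMr//.
by rewrite [d * _]mulrC -ler_pdivrMr//; move: BM; rewrite /B; lra.
Qed.

End FixedPoint.
End NodeAverages.

(** * From node polynomials to Taylor series *)

Section Taylor.
Context {R : realType}.
Implicit Types (f : R[i] -> R[i]) (c z : R[i]).

Lemma real_cauchy_cvg (t : nat -> R) (d : nat -> R) : d n @[n --> \oo] --> 0 ->
  (\forall N0 \near \oo, forall m n, (N0 <= m)%N -> (N0 <= n)%N ->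
    `|t m - t n| <= d m + d n) -> cvgn t.
Proof.
move=> /cvgrPdist_lt hd [N0 _ /(_ N0 (leqnn _)) ht].
apply/cauchy_cvgP/cauchy_exP => e e0.
have e2 : 0 < e / 2 by rewrite divr_gt0.
have [N1 _ hN1] := hd _ e2.
pose M := maxn N0 N1.
have hM n : (M <= n)%N -> d n < e / 2.
  move=> Mn; have /= := hN1 n (leq_trans (leq_maxr _ _) Mn).
  by rewrite sub0r normrN; apply: le_lt_trans; exact: ler_norm.
exists (t M); exists M => // n /= Mn.
rewrite /ball_ /=; apply: le_lt_trans (ht _ _ _ _) _; rewrite ?leq_maxl//.
  exact: leq_trans (leq_maxl _ _) Mn.
by rewrite [ltRHS]splitr ltrD// hM.
Qed.

Lemma ccauchy_ccvg (u : nat -> R[i]) (d : nat -> R) : d n @[n --> \oo] --> 0 ->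
  (\forall N0 \near \oo, forall m n, (N0 <= m)%N -> (N0 <= n)%N ->
    cabs (u m - u n) <= d m + d n) -> exists l, ccvg u l.
Proof.
move=> hd hu.
have hRe : cvgn (fun n => complex.Re (u n)).
  apply: (real_cauchy_cvg hd); apply: filterS hu => N0 h m n hm hn.
  by rewrite -cReB; apply: le_trans (normRe_le_cabs _) _; exact: h.
have hIm : cvgn (fun n => complex.Im (u n)).
  apply: (real_cauchy_cvg hd); apply: filterS hu => N0 h m n hm hn.
  by rewrite -cImB; apply: le_trans (normIm_le_cabs _) _; exact: h.
by exists (limn (fun n => complex.Re (u n)) +i* limn (fun n => complex.Im (u n)))%C; exact: ccvg_ReIm.
Qed.

Lemma poly_power_series_on (r : R) (b : nat -> R[i]) m : (forall k, (m <= k)%N -> b k = 0) ->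
  power_series_on 0 r b (fun z => \sum_(0 <= k < m) b k * z ^+ k).
Proof.
move=> hb z _; apply: cvg_near_cst; exists m => // n /= mn.
have tail0 : \sum_(m <= k < n) b k * (z - 0) ^+ k = 0.
  by rewrite big_nat big1// => k /andP[mk _]; rewrite hb ?mul0r.
rewrite (big_cat_nat _ mn)//= tail0 addr0.
by under eq_bigr do rewrite subr0; rewrite subrr cabs0.
Qed.

Lemma ccvg_sum (m : nat) (u : nat -> nat -> R[i]) (l : nat -> R[i]) :
  (forall k, ccvg (u k) (l k)) ->
  ccvg (fun n => \sum_(0 <= k < m) u k n) (\sum_(0 <= k < m) l k).
Proof.
move=> h; elim: m => [|m IH].
  apply/ccvgP => e e0; apply: nearW => n.
  by rewrite !big_nil subrr cabs0.
rewrite big_nat_recr//=; have := ccvgD IH (h m).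
by congr (ccvg _ _); apply/funext => n; rewrite big_nat_recr.
Qed.

Lemma ccvg_squeeze (u : nat -> R[i]) l (d : nat -> R) : d n @[n --> \oo] --> 0 ->
  (\forall n \near \oo, cabs (u n - l) <= d n) -> ccvg u l.
Proof.
move=> /cvgrPdist_lt hd hu; apply/ccvgP => e /hd he; near=> n.
apply: le_lt_trans (_ : d n < e); first by near: n.
by apply: le_lt_trans (ler_norm _) _; rewrite -normrN -sub0r; near: n.
Unshelve. all: by end_near. Qed.

(** The node polynomials converge to f inside the disc. Their coefficients converge by Cauchy's
    estimate applied to differences of two of them, and the uniform bound K / s^n lets the limit be
    taken term by term. *)
Lemma taylor_closed_disc f (s : R) : 0 < s ->
  (forall z, cabs z <= s -> locally_quotient_lipschitz f z) ->
  exists a, power_series_on 0 s a f.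
Proof.
move=> s0 /uniform_quotient_lipschitz[K K0 hf].
pose w1 N := cabs (uroot N - 1 : R[i]).
have w1cvg : w1 N @[N --> \oo] --> 0 by exact: cvg_uroot.
have KV : 0 < K^-1 / s by rewrite divr_gt0 ?invr_gt0.
have wK : \forall N \near \oo, (1 < N)%N /\ s * w1 N <= K^-1.
  apply: filterI; first by exists 2%N.
  have /cvgrPdist_lt/(_ _ KV) := w1cvg; apply: filterS => N.
  rewrite sub0r normrN ger0_norm ?cabs_ge0// ltr_pdivlMr// mulrC => /ltW; exact.
have approx z sg N : cabs z <= sg -> sg < s -> (1 < N)%N -> s * w1 N <= K^-1 ->
    cabs (f z - node_poly f s N z) <= 2 * K * s ^+ 2 * (1 - sg / s)^-1 * w1 N.
  by move=> zsg sgs N1 wN; exact: node_poly_approx.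
(* Any fixed radius inside the disc would do: on this circle two node polynomials are both close to
   f, hence close to each other. *)
pose sg := s / 2; have sg0 : 0 < sg by rewrite divr_gt0.
have sgs : sg < s by rewrite /sg; lra.
pose C := 2 * K * s ^+ 2 * (1 - sg / s)^-1.
have lim_coef n : exists l, ccvg (fun N => node_coef f s N n) l.
  apply: (@ccauchy_ccvg _ (fun N => C * w1 N / sg ^+ n)).
    rewrite -(mul0r (sg ^+ n)^-1); apply: cvgMl; rewrite -(mulr0 C); exact: cvgMr.
  have [N0 _ hN0] := wK; exists N0 => // N1 /= N01 N N' hN hN'.
  have [N2 wN] := hN0 N (leq_trans N01 hN); have [N2' wN'] := hN0 N' (leq_trans N01 hN').
  rewrite -mulrDl ler_pdivlMr ?exprn_gt0//.
  pose b k := node_coef f s N k - node_coef f s N' k.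
  pose m := maxn N N'.
  have bm k : (m <= k)%N -> b k = 0.
    rewrite geq_max => /andP[k1 k2].
    by rewrite /b /node_coef !ltnNge k1 k2/= subrr.
  have ext M z : (M <= m)%N -> node_poly f s M z = \sum_(0 <= k < m) node_coef f s M k * z ^+ k.
    move=> Mm; rewrite (big_cat_nat _ Mm)//= [X in _ = _ + X]big_nat.
    rewrite [X in _ = _ + X]big1 ?addr0// => k /andP[Mk _].
    by rewrite /node_coef ltnNge Mk mul0r.
  have sg0s : 0 < sg < s by rewrite sg0.
  rewrite -/(b n); apply: (cauchy_estimate n (poly_power_series_on bm) sg0s) => z.
  rewrite subr0 => zsg.
  have -> : \sum_(0 <= k < m) b k * z ^+ k = node_poly f s N z - node_poly f s N' z.
    rewrite !ext ?leq_maxl ?leq_maxr// -sumrB.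
    by apply: eq_bigr => k _; rewrite mulrBl.
  apply: le_trans (cabs_dist_add _ _ (f z)) _; rewrite cabsB.
  by apply: lerD; apply: approx => //; rewrite zsg.
have [a ha] := choice lim_coef.
have aB n : cabs (a n) <= K / s ^+ n.
  by apply: (ccvg_le (ha n)); apply: nearW => N; exact: node_coef_bound.
exists a => z; rewrite in_disc subr0 => zs.
set q := cabs z / s.
have q0 : 0 <= q by rewrite divr_ge0 ?cabs_ge0// ltW.
have q1 : q < 1 by rewrite ltr_pdivrMr// mul1r.
have q1' : 0 < 1 - q by rewrite subr_gt0.
have Pf : ccvg (fun N => node_poly f s N z) (f z).
  apply: (@ccvg_squeeze _ _ (fun N => 2 * K * s ^+ 2 * (1 - cabs z / s)^-1 * w1 N)).
    by rewrite -[X in _ --> X](mulr0 (2 * K * s ^+ 2 * (1 - cabs z / s)^-1)); exact: cvgMr.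
  by apply: filterS wK => N [N2 wN]; rewrite cabsB; exact: approx.
(* With m fixed, subtract from the N-th node polynomial its own first m terms and let N grow: what
   remains is a tail bounded by a geometric series, uniformly in N. *)
apply: (@ccvg_squeeze _ _ (fun m => K * (q ^+ m / (1 - q)))).
  rewrite -[X in _ --> X](mulr0 K); apply: cvgMr.
  rewrite -[X in _ --> X](mul0r (1 - q)^-1); apply: cvgMl.
  by apply: cvg_expr; rewrite ger0_norm.
apply: nearW => m; rewrite cabsB.
have := ccvgB Pf (@ccvg_sum m _ _ (fun k => ccvgMl (z ^+ k) (ha k))).
under eq_bigr do rewrite mulrC.
move=> /ccvg_le; apply; exists m => // N /= mN.
rewrite /node_poly (big_cat_nat _ mN)//=.
under [X in _ + _ - X]eq_bigr do rewrite mulrC.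
rewrite addrAC subrr add0r.
have -> : \sum_(m <= i < N) node_coef f s N i * z ^+ i =
    \sum_(0 <= i < N - m) node_coef f s N (i + m) * z ^+ (i + m).
  by rewrite -{1}[m]add0n big_addn.
rewrite big_mkord; apply: le_trans (cabs_sum _) _.
apply: (@le_trans _ _ (K * q ^+ m * \sum_(0 <= i < N - m) q ^+ i)).
  rewrite big_mkord mulr_sumr; apply: ler_sum => i _.
  rewrite cabsM cabsX; apply: (@le_trans _ _ (K / s ^+ (i + m) * cabs z ^+ (i + m))).
    by rewrite ler_wpM2r ?exprn_ge0 ?cabs_ge0//; exact: node_coef_bound.
  by rewrite -[K * q ^+ m * _]mulrA -exprD /q expr_div_n [(m + i)%N]addnC mulrA mulrAC.
rewrite [leRHS]mulrA; apply: ler_wpM2l; last exact: geometric_sum_le.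
by rewrite mulr_ge0 ?exprn_ge0// ltW.
Qed.

(** Every smaller radius has an expansion; by uniqueness they all share the coefficients found at
    radius r/2. *)
Theorem taylor c (r : R) f :
  (forall z, cabs (z - c) < r -> locally_quotient_lipschitz f z) ->
  exists a, power_series_on c r a f.
Proof.
move=> hf; pose F z := f (c + z).
have hF z : cabs z < r -> locally_quotient_lipschitz F z.
  move=> zr; have [|K K0 hK] := hf (c + z); first by rewrite addrAC subrr add0r.
  exists K => // p pz h l hh hl; rewrite /F !addrA; apply: hK => //.
  by rewrite opprD addrACA subrr add0r.
have ex s : 0 < s < r -> exists a, power_series_on 0 s a F.
  by move=> /andP[s0 sr]; apply: taylor_closed_disc => // z zs; apply: hF; exact: le_lt_trans sr.
have [r0|r0] := leP r 0.
  exists (fun=> 0) => z; rewrite in_disc => /le_lt_trans -/(_ _ (cabs_ge0 _)).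
  by rewrite ltNge r0.
have [|a ha] := ex (r / 2); first by lra.
exists a => z; rewrite in_disc => zr.
pose s := (cabs (z - c) + r) / 2.
have zs : cabs (z - c) < s by rewrite /s; lra.
have s0 : 0 < s := le_lt_trans (cabs_ge0 _) zs.
have [|b hb] := ex s; first by rewrite s0 /= /s; lra.
have -> : a = b by apply/funext => n; apply: (ps_unique n _ s0 ha hb); lra.
have := @ps_ccvg _ _ _ _ _ (z - c) hb; rewrite subr0 => /(_ zs).
by rewrite (_ : F (z - c) = f z)// /F addrC subrK.
Qed.

(** Recentring a power series: the series at 0 gives the local increment bound at every point, and
    [taylor] converts it into a series there. *)
Lemma ps_analytic_on_disc a f : power_series_on 0 1 a f -> analytic_on_disc f.
Proof.
move=> hf z; rewrite in_unit_disc => z1.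
have [|b hb] := @taylor z (1 - cabs z) f.
  move=> u uz; apply: (ps_locally_quotient_lipschitz hf); rewrite subr0.
  have := cabsD (u - z) z; rewrite subrK; lra.
by exists (1 - cabs z), b; rewrite subr_gt0.
Qed.

Lemma analytic_taylor f c : analytic_on_disc f ->
  exists a, power_series_on c (1 - cabs c) a f.
Proof.
move=> hf; apply: taylor => z zc; apply: analytic_locally_quotient_lipschitz => //.
by rewrite in_unit_disc; have := cabsD (z - c) c; rewrite subrK; lra.
Qed.

End Taylor.

(** * Polar coordinates *)

Section ChangeOfVariable.
Context {R : realType}.
Local Notation mu := (@lebesgue_measure R).
Variables (phi psi : R -> R).
Hypotheses (mphi : measurable_fun setT phi) (mpsi : measurable_fun setT psi).
Hypothesis psi_ge0 : forall s, 0 <= psi s.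
Hypothesis psi_itv : forall a b : R, a < b ->
  (\int[mu]_(s in phi @^-1` `]a, b]%classic) (psi s)%:E = (b - a)%:E)%E.

(** The push-forward under [phi] of the measure with density [psi]. The hypothesis on half-open
    intervals says that it is Lebesgue measure. Since [phi] need not be injective, it can be the
    tangent on the whole line, with [psi] cut off to one period. *)
Definition image_density (A : set (measurableTypeR R)) : \bar R :=
  (\int[mu]_(s in phi @^-1` A) (psi s)%:E)%E.

Lemma measurable_preimageT (A : set R) : measurable A -> measurable (phi @^-1` A).
Proof. by move=> mA; rewrite -[X in measurable X]setTI; exact: mphi. Qed.

Lemma image_density0 : image_density set0 = 0%E.
Proof. by rewrite /image_density preimage_set0 integral_set0. Qed.

Lemma image_density_ge0 A : (0 <= image_density A)%E.
Proof. by apply: integral_ge0 => s _; rewrite lee_fin. Qed.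

Lemma image_density_sigma_additive : semi_sigma_additive image_density.
Proof.
move=> F mF tF mUF; rewrite /image_density preimage_bigcup.
rewrite ge0_integral_bigcup//.
- by apply: is_cvg_ereal_nneg_natsum_cond => n _ _; apply: integral_ge0 => s _; rewrite lee_fin.
- by move=> k; apply: measurable_preimageT; exact: mF.
- by apply/measurable_EFinP; exact: measurable_funTS.
- by move=> s _; rewrite lee_fin.
- apply/trivIsetP => i j _ _ ij; rewrite -preimage_setI.
  by move/trivIsetP : tF => /(_ i j Logic.I Logic.I ij) ->; rewrite preimage_set0.
Qed.

HB.instance Definition _ := isMeasure.Build _ _ _ image_density
  image_density0 image_density_ge0 image_density_sigma_additive.

Lemma image_densityE A : measurable A -> mu A = image_density A.
Proof.
apply: lebesgue_measure_unique => _ [[a b] _ <-] /=.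
rewrite lebesgue_measure_itv/= lte_fin /image_density.
case: ltP => ab; first by rewrite psi_itv// EFinB.
by rewrite set_itv_ge ?preimage_set0 ?integral_set0// bnd_simp -leNgt.
Qed.

Import HBNNSimple.

(** For indicators this is [image_densityE]; increasing simple functions and monotone convergence on
    both sides do the rest. *)
Lemma ge0_integral_change_of_variable (G : R -> \bar R) :
  measurable_fun setT G -> (forall x, (0 <= G x)%E) ->
  (\int[mu]_x G x = \int[mu]_s (G (phi s) * (psi s)%:E))%E.
Proof.
move=> mG' G0.
have mG : measurable_fun (setT : set (measurableTypeR R)) G by exact: mG'.
pose g := nnsfun_approx measurableT mG.
have gG x : (g n x)%:E @[n --> \oo] --> G x by exact: cvg_nnsfun_approx.
have g_nd x n m : (n <= m)%N -> g n x <= g m x.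
  by move=> nm; exact/lefP/nd_nnsfun_approx.
have mg n : measurable_fun setT (g n) by exact: measurable_funP.
have mgphi n : measurable_fun setT (g n \o phi) by exact: measurableT_comp.
transitivity (limn (fun n => \int[mu]_x (g n x)%:E))%E.
  rewrite -monotone_convergence//.
  - by apply: eq_integral => x _; apply/esym/cvg_lim => //; exact: gG.
  - by move=> n; apply/measurable_EFinP; exact: mg.
  - by move=> n x _; rewrite lee_fin.
  - by move=> x _ n m nm; rewrite lee_fin; exact: g_nd.
transitivity (limn (fun n => \int[mu]_s (g n (phi s) * psi s)%:E))%E; last first.
  rewrite -monotone_convergence//.
  - apply: eq_integral => s _; apply/cvg_lim => //.
    under eq_fun do rewrite EFinM.
    by apply: cvgeZr => //; exact: gG.
  - by move=> n; apply/measurable_EFinP; apply: measurable_funM => //; exact: mgphi.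
  - by move=> n s _; rewrite lee_fin mulr_ge0.
  - by move=> s _ n m nm; rewrite lee_fin ler_wpM2r//; exact: g_nd.
congr (limn _); apply/funext => n.
pose A k := g n @^-1` [set k].
have mA k : measurable (A k) by exact: measurable_sfunP.
rewrite (integral_nnsfun mu measurableT (g n)) patch_setT sintegralE.
transitivity (\sum_(k \in range (g n)) k%:E * \int[mu]_s (\1_(phi @^-1` A k) s * psi s)%:E)%E.
  apply: eq_fsbigr => k _; congr (_ * _)%E.
  rewrite [LHS]image_densityE// /image_density -/(A k) integral_mkcond.
  apply: eq_integral => s _; rewrite patchE indicE.
  by case: ifPn => _; rewrite ?mul1r ?mul0r.
rewrite [RHS](_ : _ = \int[mu]_s \sum_(k \in range (g n))
    (k%:E * (\1_(phi @^-1` A k) s * psi s)%:E))%E; last first.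
  apply: eq_integral => s _; rewrite fimfunE !fsbig_finite//= mulr_suml -sumEFin.
  by apply: eq_bigr => k _; rewrite -mulrA EFinM.
rewrite ge0_integral_fsum//.
- apply: eq_fsbigr => k /[!inE] -[x _ <-].
  rewrite ge0_integralZl//.
  + apply/measurable_EFinP; apply: measurable_funM => //.
    by apply: measurable_indic; apply: measurable_preimageT; exact: mA.
  + by move=> s _; rewrite lee_fin mulr_ge0.
  + by rewrite lee_fin.
- move=> k; apply: measurable_funeM; apply/measurable_EFinP.
  apply: measurable_funM => //.
  by apply: measurable_indic; apply: measurable_preimageT; exact: mA.
- move=> k s _; rewrite -EFinM lee_fin.
  have [k0|k0] := leP 0 k; first by rewrite !mulr_ge0.
  rewrite (_ : phi @^-1` A k = set0) ?indic0 ?mul0r ?mulr0//.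
  by apply/seteqP; split => // t /= gk; move: k0; rewrite -gk ltNge fun_ge0.
Qed.

End ChangeOfVariable.

Section Polar.
Context {R : realType}.
Local Notation RM := (measurableTypeR R).
Local Notation mu := (@lebesgue_measure R).

Lemma measurable_fun_inv : measurable_fun (setT : set RM) (fun x : RM => (x : R)^-1).
Proof.
(* Correct at 0 as well, where the inverse is 0 by convention. *)
rewrite (_ : (fun x => _) = (fun x : R => x * (x ^+ 2) `^ (-1))); last first.
  apply/funext => x; rewrite powR_inv1 ?sqr_ge0//.
  by have [->|x0] := eqVneq x 0; [rewrite invr0 mul0r|field].
apply: measurable_funM => //.
apply: (@measurableT_comp _ _ _ _ _ _ (@powR R ^~ (-1))); first exact: measurable_powR.
exact: measurable_funX.
Qed.

Lemma measurable_fun_cos : measurable_fun (setT : set RM) (@cos R).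
Proof. by apply: continuous_measurable_fun; exact: continuous_cos. Qed.

Lemma measurable_fun_sin : measurable_fun (setT : set RM) (@sin R).
Proof. by apply: continuous_measurable_fun; exact: continuous_sin. Qed.

Lemma measurable_fun_tan : measurable_fun (setT : set RM) (@tan R).
Proof.
apply: measurable_funM; first exact: measurable_fun_sin.
by apply: measurableT_comp; [exact: measurable_fun_inv|exact: measurable_fun_cos].
Qed.

Lemma ge0_integral_scale (c : R) (G : R -> \bar R) : 0 < c ->
  measurable_fun (setT : set RM) G -> (forall x, (0 <= G x)%E) ->
  (\int[mu]_x G x = \int[mu]_r (G (r * c)%R * c%:E))%E.
Proof.
move=> c0 mG G0; apply: (@ge0_integral_change_of_variable R (fun r => r * c) (cst c)) => //.
- by apply: measurable_funM.
- by move=> s; exact: ltW.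
- move=> a b ab.
  have -> : (fun r => r * c) @^-1` `]a, b]%classic = `](a / c), (b / c)]%classic.
    by apply/seteqP; split => r /=; rewrite !in_itv/= ltr_pdivrMr// ler_pdivlMr.
  rewrite (@integral_cst _ _ _ mu _ (measurable_itv _) c%:E) /= lebesgue_measure_itv/= lte_fin ltr_pM2r ?invr_gt0// ab.
  by rewrite -EFinB -EFinM; congr EFin; field; rewrite gt_eqF.
Qed.

Lemma ge0_integral_reflect (a : R) (G : R -> \bar R) :
  measurable_fun (setT : set RM) G -> (forall x, (0 <= G x)%E) ->
  (\int[mu]_x G x = \int[mu]_s G (a - s)%R)%E.
Proof.
move=> mG G0; rewrite (@ge0_integral_change_of_variable R (fun s => a - s) (cst 1))//.
- by apply: eq_integral => s _; rewrite mule1.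
- by apply: measurable_funB.
- move=> b c bc.
  have -> : (fun s => a - s) @^-1` `]b, c]%classic = `[(a - c), (a - b)[%classic.
    by apply/seteqP; split => r /=; rewrite !in_itv/=; lra.
  rewrite (@integral_cst _ _ _ mu _ (measurable_itv _) 1%:E) /= lebesgue_measure_itv/= lte_fin mul1e ltrD2l ltrN2 bc.
  by rewrite -EFinB; congr EFin; ring.
Qed.

Definition half_circle_itv : set R := `](- (pi / 2)), (pi / 2)[%classic.
Local Notation I := (\1_half_circle_itv : R -> R).

Lemma cos_half_gt0 s : half_circle_itv s -> 0 < cos s.
Proof. by rewrite /half_circle_itv /= in_itv/= => h; exact: cos_gt0_pihalf. Qed.

(** Parametrises the horizontal line at height y by the angle s from the vertical axis. The
    primitive of the density is the substitution itself. *)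
Lemma ge0_integral_tan (y : R) (G : R -> \bar R) : 0 < y ->
  measurable_fun (setT : set RM) G -> (forall x, (0 <= G x)%E) ->
  (\int[mu]_x G x = \int[mu]_s (G (y * tan s)%R * (y / cos s ^+ 2 * I s)%R%:E))%E.
Proof.
move=> y0 mG G0.
pose phi (s : R) := y * tan s; pose psi s := y / cos s ^+ 2 * I s.
apply: (@ge0_integral_change_of_variable R phi psi) => //.
- by apply: measurable_funM => //; exact: measurable_fun_tan.
- apply: measurable_funM; last by apply: measurable_indic; exact: measurable_itv.
  apply: measurable_funM => //; apply: measurableT_comp; first exact: measurable_fun_inv.
  by apply: measurable_funX; exact: measurable_fun_cos.
- by move=> s; rewrite mulr_ge0// divr_ge0 ?sqr_ge0// ltW.
move=> a b ab; set al := atan (a / y); set be := atan (b / y).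
have albe : al < be by rewrite lt_atan// ltr_pM2r// invr_gt0.
have sub s : `[al, be]%classic s -> half_circle_itv s.
  rewrite /half_circle_itv /= !in_itv/= => /andP[h1 h2].
  by rewrite (lt_le_trans (atan_gtNpi2 _) h1) (le_lt_trans h2 (atan_ltpi2 _)).
(* Off the half circle the density vanishes; on it, monotonicity of tan and atan turns the preimage
   into an interval. *)
have -> : (\int[mu]_(s in phi @^-1` `]a, b]%classic) (psi s)%:E =
    \int[mu]_(s in `]al, be]%classic) (y / cos s ^+ 2)%:E)%E.
  rewrite integral_mkcond [RHS]integral_mkcond; apply: eq_integral => s _.
  rewrite !patchE /psi indicE.
  have [sI|sI] := boolP (s \in half_circle_itv); last first.
    rewrite mulr0 if_same; case: ifPn => // /set_mem sab.
    case/negP: sI; rewrite inE; apply: sub.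
    by move: sab; rewrite /= !in_itv/= => /andP[/ltW -> ->].
  rewrite mulr1; congr (if _ then _ else _).
  have st : s = atan (tan s) by rewrite tanK//; move: sI; rewrite inE.
  apply/idP/idP => /set_mem /=; rewrite in_itv/= => /andP[h1 h2]; rewrite inE /= in_itv/=.
    apply/andP; split; rewrite st.
      by apply: lt_atan; rewrite ltr_pdivrMr// mulrC.
    by apply: le_atan; rewrite ler_pdivlMr// mulrC.
  have sI' : s \in `](- (pi / 2)), (pi / 2)[ by move: sI; rewrite inE.
  have aI (x : R) : atan x \in `](- (pi / 2)), (pi / 2)[ by rewrite in_itv/= atan_gtNpi2 atan_ltpi2.
  have t1 : a / y < tan s by rewrite -[a / y]atanK (ltr_tan (aI _) sI').
  have t2 : tan s <= b / y by rewrite leNgt -[b / y]atanK (ltr_tan (aI _) sI') -leNgt.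
  by move: t1 t2; rewrite ltr_pdivrMr// ler_pdivlMr// ![tan s * y]mulrC => -> ->.
have dtan s : `[al, be]%classic s -> is_derive s (1 : R) phi (y / cos s ^+ 2).
  move=> /sub/cos_half_gt0 c0.
  have h : is_derive s (1 : R) (@tan R) (cos s ^- 2) by apply: is_derive_tan; rewrite gt_eqF.
  by have := @is_deriveZ _ _ _ (@tan R) y s 1 _ h.
have ctan s : `[al, be]%classic s -> {for s, continuous phi}.
  by move=> /dtan d; apply/differentiable_continuous/derivable1_diffP; case: d.
have cpsi : {within `[al, be], continuous (fun s => y / cos s ^+ 2)}.
  apply: continuous_in_subspaceT => s /set_mem/sub/cos_half_gt0 c0.
  apply: cvgM; first exact: cvg_cst.
  apply: cvgV; first by rewrite expf_neq0// gt_eqF.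
  by apply: (cvg_comp (@cos R) (fun x => x ^+ 2)); [exact: continuous_cos|exact: exprn_continuous].
rewrite integral_itv_obnd_cbnd; last first.
  apply/measurable_EFinP; apply: measurable_funTS.
  apply: measurable_funM => //; apply: measurableT_comp; first exact: measurable_fun_inv.
  by apply: measurable_funX; exact: measurable_fun_cos.
have oc s : s \in `]al, be[ -> `[al, be]%classic s.
  by rewrite /= !in_itv/= => /andP[/ltW -> /ltW ->].
have [alin bein] : `[al, be]%classic al /\ `[al, be]%classic be.
  by rewrite /= !in_itv/= !lexx (ltW albe).
rewrite (@continuous_FTC2 _ _ phi)//.
- by rewrite -EFinB /phi /al /be !atanK; congr EFin; field; rewrite gt_eqF.
- split.
  + by move=> s /oc/dtan d; case: d.
  + by apply: cvg_at_right_filter; exact: ctan.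
  + by apply: cvg_at_left_filter; exact: ctan.
- by move=> s /oc/dtan d; rewrite derive1E; exact: (@derive_val _ _ _ _ _ _ _ d).
Qed.
End Polar.

Section PolarCoordinates.
Context {R : realType}.
Local Notation RM := (measurableTypeR R).
Local Notation mu := (@lebesgue_measure R).
Local Notation I := (\1_half_circle_itv : R -> R).
Local Notation P := (\1_(`]0%R, +oo[%classic) : R -> R).
Implicit Types (G : RM * RM -> \bar R).

Lemma pos_indicE (r : R) : P r = (0 < r)%R%:R.
Proof. by rewrite indicE mem_setE /= in_itv/= andbT. Qed.

Lemma pos_indic_ge0 (r : R) : 0 <= P r * r.
Proof. by rewrite pos_indicE; case: ltP => [/ltW|_]; rewrite ?mul1r ?mul0r. Qed.

Let mP : measurable_fun (setT : set RM) P.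
Proof. by apply: measurable_indic; exact: measurable_itv. Qed.

Let mI : measurable_fun (setT : set RM) I.
Proof. by apply: measurable_indic; exact: measurable_itv. Qed.

Let m1 (f : RM -> RM) : measurable_fun setT f ->
  measurable_fun (setT : set (RM * RM)) (fun z : RM * RM => f z.1).
Proof. by move=> mf; apply: (measurableT_comp mf); exact: measurable_fst. Qed.

Let m2 (f : RM -> RM) : measurable_fun setT f ->
  measurable_fun (setT : set (RM * RM)) (fun z : RM * RM => f z.2).
Proof. by move=> mf; apply: (measurableT_comp mf); exact: measurable_snd. Qed.

(** Two one-dimensional substitutions replace the planar one: x = y tan s on each line, then, after
    exchanging the integrals, y = r cos s. The factors y / cos^2 s and cos s multiply to r. *)
Lemma ge0_integral_upper_half G : measurable_fun setT G -> (forall z, (0 <= G z)%E) ->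
  (\int[mu]_y \int[mu]_x (G (x, y) * (P y)%:E) =
   \int[mu]_r \int[mu]_s (G (r * sin s, r * cos s)%R * (P r * r * I s)%R%:E))%E.
Proof.
move=> mG G0.
pose F1 (z : RM * RM) : \bar R := (G (z.1 * tan z.2, z.1)%R *
  (P z.1 * z.1 * (cos z.2 ^+ 2)^-1 * I z.2)%R%:E)%E.
pose F2 (z : RM * RM) : \bar R := (G (z.1 * sin z.2, z.1 * cos z.2)%R *
  (P z.1 * z.1 * I z.2)%R%:E)%E.
have mid : measurable_fun (setT : set RM) (@id RM) by exact: measurable_id.
have mF1 : measurable_fun setT F1.
  apply: emeasurable_funM.
    apply: (measurableT_comp mG); apply: measurable_fun_pair; last exact: m1 mid.
    by apply: measurable_funM; [exact: m1 mid|apply: m2; exact: measurable_fun_tan].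
  apply/measurable_EFinP; apply: measurable_funM; last exact: m2 mI.
  apply: measurable_funM; first by apply: measurable_funM; [exact: m1 mP|exact: m1 mid].
  apply: (@m2 (fun s => (cos s ^+ 2)^-1)).
  apply: measurableT_comp; first exact: measurable_fun_inv.
  by apply: measurable_funX; exact: measurable_fun_cos.
have mF2 : measurable_fun setT F2.
  apply: emeasurable_funM.
    apply: (measurableT_comp mG); apply: measurable_fun_pair.
      by apply: measurable_funM; [exact: m1 mid|apply: m2; exact: measurable_fun_sin].
    by apply: measurable_funM; [exact: m1 mid|apply: m2; exact: measurable_fun_cos].
  apply/measurable_EFinP; apply: measurable_funM; last exact: m2 mI.
  by apply: measurable_funM; [exact: m1 mP|exact: m1 mid].
have F10 z : (0 <= F1 z)%E.
  rewrite mule_ge0// lee_fin mulr_ge0// mulr_ge0 ?pos_indic_ge0//.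
  by rewrite invr_ge0 sqr_ge0.
have F20 z : (0 <= F2 z)%E.
  by rewrite mule_ge0// lee_fin mulr_ge0// pos_indic_ge0.
have mGy (y : RM) : measurable_fun setT (fun x : RM => G (x, y)).
  by apply: (measurableT_comp mG); apply: measurable_fun_pair => //; exact: measurable_cst.
transitivity (\int[mu]_y \int[mu]_s F1 (y, s))%E.
  apply: eq_integral => y _; rewrite /F1/= pos_indicE.
  have [y0|y0] := ltP 0 y; last first.
    by rewrite !integral0_eq// => x _; rewrite ?mulr0n ?mul0r mule0.
  under eq_integral do rewrite mule1.
  rewrite (ge0_integral_tan y0 (mGy y))//.
  by apply: eq_integral => s _; rewrite mul1r.
rewrite (_ : (\int[mu]_y \int[mu]_s F1 (y, s) = \int[mu]_s \int[mu]_y F1 (y, s))%E); last first.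
  exact: (fubini_tonelli F1).
rewrite [RHS](_ : _ = \int[mu]_s \int[mu]_r F2 (r, s))%E; last first.
  exact: (fubini_tonelli F2).
apply: eq_integral => s _.
have [sI|sI] := boolP (s \in half_circle_itv); last first.
  have Is : I s = 0 by rewrite indicE (negbTE sI).
  by rewrite !integral0_eq// => x _; rewrite /F1 /F2/= Is mulr0 mule0.
have Is : I s = 1 by rewrite indicE sI.
have c0 := cos_half_gt0 (set_mem sI).
rewrite (ge0_integral_scale c0)//; last first.
  by apply: (measurableT_comp mF1); apply: measurable_fun_pair => //; exact: measurable_cst.
apply: eq_integral => r _; rewrite /F1 /F2/= Is !mulr1 -muleA -EFinM.
have -> : r * cos s * tan s = r * sin s.
  by rewrite /tan; field; rewrite gt_eqF.
congr (_ * _%:E)%E; rewrite !pos_indicE pmulr_lgt0//.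
by field; rewrite gt_eqF.
Qed.

(** Discards the horizontal axis, which belongs to neither open half plane, and the boundary angles
    0, pi and 2 pi. *)
Lemma ge0_integral_eq_off_finite (f g : RM -> \bar R) (s : seq R) :
  measurable_fun setT f -> measurable_fun setT g ->
  (forall x, (0 <= f x)%E) -> (forall x, (0 <= g x)%E) ->
  (forall x, x \notin s -> f x = g x) -> (\int[mu]_x f x = \int[mu]_x g x)%E.
Proof.
move=> mf mg f0 g0 fg; apply: ge0_ae_eq_integral => //.
exists [set` s]; split.
- apply: countable_measurable; first exact: measurable_set1.
  by apply: finite_set_countable; exact: finite_seq.
- by apply: countable_lebesgue_measure0; apply: finite_set_countable; exact: finite_seq.
- move=> x /= nfg; apply: contra_notT nfg => xs _; exact: fg.
Qed.

Theorem polar_coordinates G : measurable_fun setT G -> (forall z, (0 <= G z)%E) ->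
  (\int[mu \x mu]_z G z =
   \int[mu]_(r in `]0%R, +oo[) \int[mu]_(t in `[0%R, (2 * pi)%R])
     (G (r * cos t, r * sin t)%R * r%:E))%E.
Proof.
move=> mG G0.
(* The lower half plane is handled as the upper one for the function turned by pi. *)
pose Gm (z : RM * RM) := G (- z.1, - z.2).
have mopp : measurable_fun (setT : set RM) (-%R : RM -> RM).
  exact: oppr_measurable.
have mGm : measurable_fun setT Gm.
  by apply: (measurableT_comp mG); apply: measurable_fun_pair; [exact: m1 mopp|exact: m2 mopp].
have mid : measurable_fun (setT : set RM) (@id RM) by exact: measurable_id.
have mPy : measurable_fun (setT : set (RM * RM)) (fun z => (P z.2)%:E).
  by apply/measurable_EFinP; exact: m2 mP.
have mNy : measurable_fun (setT : set (RM * RM)) (fun z => (P (- z.2)%R)%:E).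
  apply/measurable_EFinP; apply: (@m2 (fun y => P (- y))).
  exact: measurableT_comp mP mopp.
have mGP : measurable_fun setT (fun z => G z * (P z.2)%:E)%E by exact: emeasurable_funM.
have mGN : measurable_fun setT (fun z => G z * (P (- z.2)%R)%:E)%E by exact: emeasurable_funM.
have P0 (y : R) : (0 <= (P y)%:E)%E by rewrite lee_fin.
have GP0 z : (0 <= G z * (P z.2)%:E)%E by rewrite mule_ge0.
have GN0 z : (0 <= G z * (P (- z.2)%R)%:E)%E by rewrite mule_ge0.
have half H : measurable_fun setT H -> (forall z, (0 <= H z)%E) ->
    (forall b : R,
    \int[mu]_y \int[mu]_x (H (x, y) * (P y)%:E) =
    \int[mu]_r \int[mu]_t (H (r * sin (b - t), r * cos (b - t))%R * (P r * r * I (b - t))%R%:E))%E.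
  move=> mH H0 b; rewrite (ge0_integral_upper_half mH H0); apply: eq_integral => r _.
  pose L (s : RM) := (H (r * sin s, r * cos s)%R * (P r * r * I s)%R%:E)%E.
  have L0 s : (0 <= L s)%E by rewrite mule_ge0// lee_fin mulr_ge0// pos_indic_ge0.
  have mL : measurable_fun setT L.
    apply: emeasurable_funM; last first.
      by apply/measurable_EFinP; apply: measurable_funM; [exact: measurable_cst|exact: mI].
    apply: (measurableT_comp mH); apply: measurable_fun_pair.
      by apply: measurable_funM; [exact: measurable_cst|exact: measurable_fun_sin].
    by apply: measurable_funM; [exact: measurable_cst|exact: measurable_fun_cos].
  exact: (ge0_integral_reflect b mL L0).
transitivity (\int[mu]_y (\int[mu]_x (G (x, y) * (P y)%:E) + \int[mu]_x (G (x, y) * (P (- y)%R)%:E)))%E.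
  rewrite fubini_tonelli2//.
  apply: (@ge0_integral_eq_off_finite _ _ [:: 0]).
  - exact: measurable_fun_fubini_tonelli_G.
  - apply: emeasurable_funD.
      exact: (measurable_fun_fubini_tonelli_G _ mGP GP0).
    exact: (measurable_fun_fubini_tonelli_G _ mGN GN0).
  - by move=> y; apply: integral_ge0.
  - by move=> y; rewrite adde_ge0//; apply: integral_ge0 => x _; rewrite mule_ge0.
  - move=> y; rewrite inE => y0; rewrite !pos_indicE oppr_gt0.
    have [yp|yp|y00] := ltgtP 0 y; last by rewrite -y00 eqxx in y0.
      rewrite [X in (_ + X)%E]integral0_eq ?adde0; last by move=> x _; rewrite mule0.
      by apply: eq_integral => x _; rewrite mule1.
    rewrite [X in (X + _)%E]integral0_eq ?add0e; last by move=> x _; rewrite mule0.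
    by apply: eq_integral => x _; rewrite mule1.
rewrite ge0_integralD//; last 4 first.
- by move=> y _; apply: integral_ge0 => x _; rewrite mule_ge0.
- exact: (measurable_fun_fubini_tonelli_G _ mGP GP0).
- by move=> y _; apply: integral_ge0 => x _; rewrite mule_ge0.
- exact: (measurable_fun_fubini_tonelli_G _ mGN GN0).
rewrite [X in (_ + X)%E](_ : _ = \int[mu]_y \int[mu]_x (Gm (x, y) * (P y)%:E))%E; last first.
  pose N (y : RM) := (\int[mu]_x (G (x, y) * (P (- y)%R)%:E))%E.
  have mN : measurable_fun setT N by exact: (measurable_fun_fubini_tonelli_G _ mGN GN0).
  have N0 y : (0 <= N y)%E by apply: integral_ge0 => x _; rewrite mule_ge0.
  rewrite [LHS](ge0_integral_reflect 0 mN N0); apply: eq_integral => y _.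
  rewrite /N sub0r opprK.
  pose L (x : RM) := (G (x, (- y)%R) * (P y)%:E)%E.
  have mL : measurable_fun setT L.
    apply: emeasurable_funM; last exact: measurable_cst.
    by apply: (measurableT_comp mG); apply: measurable_fun_pair; [exact: mid|exact: measurable_cst].
  have L0 x : (0 <= L x)%E by rewrite mule_ge0.
  rewrite [LHS](ge0_integral_reflect 0 mL L0).
  by apply: eq_integral => x _; rewrite /L /Gm/= sub0r.
(* The half-plane formula measures angles from the vertical axis. Reflecting them in these constants
   gives the usual polar angle, on ]0, pi[ for the upper half and on ]pi, 2 pi[ for the lower. *)
rewrite (half _ mG G0 (pi / 2)) (half _ mGm (fun z => G0 _) (pi / 2 + pi)).
have sin1 t : sin (pi / 2 - t) = cos t :> R.
  by rewrite sinB sin_pihalf cos_pihalf mul1r mul0r subr0.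
have cos1 t : cos (pi / 2 - t) = sin t :> R.
  by rewrite cosB sin_pihalf cos_pihalf mul1r mul0r add0r.
pose J1 (t : RM) := I (pi / 2 - t); pose J2 (t : RM) := I (pi / 2 + pi - t).
have mJ1 : measurable_fun (setT : set RM) J1.
  by apply: (measurableT_comp mI); apply: measurable_funB.
have mJ2 : measurable_fun (setT : set RM) J2.
  by apply: (measurableT_comp mI); apply: measurable_funB.
pose g (z : RM * RM) := G (z.1 * cos z.2, z.1 * sin z.2).
have mg : measurable_fun setT g.
  apply: (measurableT_comp mG); apply: measurable_fun_pair; apply: measurable_funM;
    by [exact: m1 mid|apply: m2; exact: measurable_fun_cos|apply: m2; exact: measurable_fun_sin].
have mw (J : RM -> R) : measurable_fun (setT : set RM) J ->
    measurable_fun setT (fun z : RM * RM => g z * (P z.1 * z.1 * J z.2)%:E)%E.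
  move=> mJ; apply: emeasurable_funM => //; apply/measurable_EFinP.
  apply: measurable_funM; last exact: m2 mJ.
  by apply: measurable_funM; [exact: m1 mP|exact: m1 mid].
have w0 (J : RM -> R) (z : RM * RM) : (forall t, 0 <= J t) ->
    (0 <= g z * (P z.1 * z.1 * J z.2)%:E)%E.
  by move=> J0; rewrite mule_ge0 ?G0// lee_fin mulr_ge0// pos_indic_ge0.
have J10 t : 0 <= J1 t by [].
have J20 t : 0 <= J2 t by [].
rewrite [X in (X + _)%E](_ : _ = \int[mu]_r \int[mu]_t (g (r, t) * (P r * r * J1 t)%:E))%E; last first.
  by apply: eq_integral => r _; apply: eq_integral => t _; rewrite sin1 cos1.
rewrite [X in (_ + X)%E](_ : _ = \int[mu]_r \int[mu]_t (g (r, t) * (P r * r * J2 t)%:E))%E; last first.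
  apply: eq_integral => r _; apply: eq_integral => t _; rewrite /Gm /g /J2/=.
  by rewrite [_ + pi - t]addrAC sinDpi cosDpi sin1 cos1 !mulrN !opprK.
rewrite -ge0_integralD//; last 4 first.
- by move=> r _; apply: integral_ge0 => t _; exact: (w0 J1 (r, t) J10).
- exact: (measurable_fun_fubini_tonelli_F _ (mw _ mJ1) (fun z => w0 _ z J10)).
- by move=> r _; apply: integral_ge0 => t _; exact: (w0 J2 (r, t) J20).
- exact: (measurable_fun_fubini_tonelli_F _ (mw _ mJ2) (fun z => w0 _ z J20)).
rewrite [RHS]integral_mkcond; apply: eq_integral => r _.
rewrite patchE mem_setE /= in_itv/= andbT.
have [r0|r0] := ltP 0 r; last first.
  by rewrite !integral0_eq ?adde0// => t _; rewrite pos_indicE ltNge r0/= !mul0r mule0.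
have mr (H : RM * RM -> \bar R) : measurable_fun setT H -> measurable_fun setT (fun t : RM => H (r, t)).
  by move=> mH; apply: (measurableT_comp mH); apply: measurable_fun_pair => //; exact: measurable_cst.
rewrite -ge0_integralD//; last 4 first.
- by move=> t _; exact: (w0 J1 (r, t) J10).
- exact: (mr _ (mw _ mJ1)).
- by move=> t _; exact: (w0 J2 (r, t) J20).
- exact: (mr _ (mw _ mJ2)).
rewrite [RHS]integral_mkcond.
have m2pi : measurable_fun (setT : set RM) (fun t => g (r, t) * r%:E)%E.
  by apply: emeasurable_funM; [exact: (mr _ mg)|exact: measurable_cst].
apply: (@ge0_integral_eq_off_finite _ _ [:: 0; pi; 2 * pi]).
- by apply: emeasurable_funD; [exact: (mr _ (mw _ mJ1))|exact: (mr _ (mw _ mJ2))].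
- apply/(measurable_restrictT _ _).1 => //; exact: measurable_funTS m2pi.
- by move=> t; rewrite adde_ge0//; [exact: (w0 J1 (r, t) J10)|exact: (w0 J2 (r, t) J20)].
- by move=> t; rewrite patchE; case: ifP => // _; rewrite mule_ge0// lee_fin ltW.
move=> t; rewrite !inE !negb_or => /and3P[t0 tpi t2pi].
rewrite pos_indicE r0 mul1r patchE mem_setE /= in_itv/= /J1 /J2 !indicE !mem_setE /= !in_itv/=.
have pi0 := @pi_gt0 R.
have -> : (- (pi / 2) < pi / 2 - t < pi / 2) = (0 < t < pi).
  by apply/idP/idP => /andP[h1 h2]; apply/andP; split; lra.
have -> : (- (pi / 2) < pi / 2 + pi - t < pi / 2) = (pi < t < 2 * pi).
  by apply/idP/idP => /andP[h1 h2]; apply/andP; split; lra.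
have [tp|tp|tE] := ltgtP t pi; last by rewrite tE eqxx in tpi.
  rewrite /= mulr0 mule0 adde0 andbT.
  have -> : (0 <= t <= 2 * pi) = (0 < t).
    by rewrite lt_neqAle eq_sym t0/=; case: leP => //= _; lra.
  by case: ifP => _; rewrite ?mulr1// mulr0 mule0.
rewrite andbF /= mulr0 mule0 add0e.
have -> : (0 <= t <= 2 * pi) = (t < 2 * pi).
  by rewrite lt_neqAle t2pi/=; case: (leP t) => _; rewrite ?andbT ?andbF//; lra.
by case: ifP => _; rewrite ?mulr1// mulr0 mule0.
Qed.
End PolarCoordinates.

(** * Sub-mean value property over discs *)

Section MeasurabilityC.
Context {R : realType} d (T : measurableType d).
Implicit Types (h k : T -> R[i]).

Definition cmeasurable_fun h :=
  measurable_fun setT (fun x => complex.Re (h x)) /\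
  measurable_fun setT (fun x => complex.Im (h x)).

Lemma cmeasurable_cst (z : R[i]) : cmeasurable_fun (fun=> z).
Proof. by split; exact: measurable_cst. Qed.

Lemma cmeasurable_add h k : cmeasurable_fun h -> cmeasurable_fun k ->
  cmeasurable_fun (fun x => h x + k x).
Proof.
move=> [h1 h2] [k1 k2]; split.
  rewrite (_ : (fun x => _) = (fun x => complex.Re (h x) + complex.Re (k x))).
    exact: measurable_funD.
  by apply/funext => x; rewrite cReD.
rewrite (_ : (fun x => _) = (fun x => complex.Im (h x) + complex.Im (k x))).
  exact: measurable_funD.
by apply/funext => x; rewrite cImD.
Qed.

Lemma cmeasurable_mul h k : cmeasurable_fun h -> cmeasurable_fun k ->
  cmeasurable_fun (fun x => h x * k x).
Proof.
move=> [h1 h2] [k1 k2]; split.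
  rewrite (_ : (fun x => _) = (fun x => complex.Re (h x) * complex.Re (k x) -
      complex.Im (h x) * complex.Im (k x))).
    by apply: measurable_funB; exact: measurable_funM.
  by apply/funext => x; rewrite cReM.
rewrite (_ : (fun x => _) = (fun x => complex.Re (h x) * complex.Im (k x) +
    complex.Im (h x) * complex.Re (k x))).
  by apply: measurable_funD; exact: measurable_funM.
by apply/funext => x; rewrite cImM.
Qed.

Lemma cmeasurable_exp h n : cmeasurable_fun h -> cmeasurable_fun (fun x => h x ^+ n).
Proof.
move=> mh; elim: n => [|n IH]; first exact: cmeasurable_cst.
by under eq_fun do rewrite exprS; exact: cmeasurable_mul.
Qed.

Lemma cmeasurable_sum (F : nat -> T -> R[i]) n : (forall i, cmeasurable_fun (F i)) ->
  cmeasurable_fun (fun x => \sum_(0 <= i < n) F i x).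
Proof.
move=> mF; elim: n => [|n IH].
  by under eq_fun do rewrite big_nil; exact: cmeasurable_cst.
by under eq_fun do rewrite big_nat_recr//=; exact: cmeasurable_add.
Qed.

Lemma cmeasurable_cabs h : cmeasurable_fun h -> measurable_fun setT (fun x => cabs (h x)).
Proof. by move=> [? ?]; exact: measurable_cabs. Qed.

End MeasurabilityC.

Section PlaneMeasure.
Context {R : realType}.
Local Notation RM := (measurableTypeR R).
Local Notation mu := (@lebesgue_measure R).
Local Notation I2pi := (`[0%R, (2 * pi)%R]%classic : set R).
Implicit Types (c : R[i]) (r rho p : R) (a : nat -> R[i]) (f : R[i] -> R[i]).

Definition plane_disc c r : set (RM * RM) := [set xy | (xy.1 +i* xy.2)%C \in disc c r].

Lemma cmeasurable_plane : cmeasurable_fun (fun xy : RM * RM => (xy.1 +i* xy.2)%C : R[i]).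
Proof. by split => /=; [exact: measurable_fst|exact: measurable_snd]. Qed.

Lemma measurable_plane_disc c r : measurable (plane_disc c r).
Proof.
have m := cmeasurable_cabs (cmeasurable_add cmeasurable_plane (cmeasurable_cst _ (- c))).
have -> : plane_disc c r = setT `&` (fun xy : RM * RM => cabs ((xy.1 +i* xy.2)%C - c)) @^-1` `]-oo, r[%classic.
  by rewrite setTI; apply/seteqP; split => xy; rewrite /plane_disc/= in_disc in_itv.
by apply: m => //; exact: measurable_itv.
Qed.

(** A pointwise limit of moduli of polynomials; off the disc the values of f are arbitrary. *)
Lemma measurable_ps_cabs c r a f : power_series_on c r a f ->
  measurable_fun (plane_disc c r) (fun xy : RM * RM => cabs (f (xy.1 +i* xy.2)%C)).
Proof.
move=> hf; apply/measurable_EFinP.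
pose S n (xy : RM * RM) := cabs (\sum_(0 <= k < n) a k * ((xy.1 +i* xy.2)%C - c) ^+ k).
apply: (emeasurable_fun_cvg (fun n => EFin \o S n)).
  move=> n; apply/measurable_EFinP; apply: measurable_funTS; apply: cmeasurable_cabs.
  apply: cmeasurable_sum => k; apply: cmeasurable_mul; first exact: cmeasurable_cst.
  apply: cmeasurable_exp; apply: cmeasurable_add; [exact: cmeasurable_plane|exact: cmeasurable_cst].
move=> xy; rewrite /plane_disc/= in_disc => xyr.
by apply: cvg_EFin; [exact: nearW|exact: (ccvg_cabs (ps_ccvg hf xyr))].
Qed.

Lemma ge0_integral_translate (b : R) (G : RM -> \bar R) :
  measurable_fun setT G -> (forall x, (0 <= G x)%E) ->
  (\int[mu]_x G x = \int[mu]_x G (b + x)%R)%E.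
Proof.
move=> mG G0; rewrite (ge0_integral_reflect b mG G0).
rewrite (@ge0_integral_reflect _ 0 (fun s => G (b - s)%R)) => [|//|//].
- by apply: eq_integral => x _; rewrite sub0r opprK.
- apply: (measurableT_comp mG); apply: measurable_funB => //; exact: measurable_id.
Qed.

Lemma polar_coordinates_at c (G : RM * RM -> \bar R) :
  measurable_fun setT G -> (forall z, (0 <= G z)%E) ->
  (\int[mu \x mu]_z G z =
   \int[mu]_(r in `]0%R, +oo[) \int[mu]_(t in I2pi)
     (G (complex.Re c + r * cos t, complex.Im c + r * sin t)%R * r%:E))%E.
Proof.
move=> mG G0.
pose H (z : RM * RM) := G (complex.Re c + z.1, complex.Im c + z.2)%R.
have mH : measurable_fun setT H.
  apply: (measurableT_comp mG); apply: measurable_fun_pair; apply: measurable_funD;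
    by [exact: measurable_cst|exact: measurable_fst|exact: measurable_snd].
rewrite -(@polar_coordinates _ H mH (fun z => G0 _)).
rewrite (fubini_tonelli2 _ mG G0) (fubini_tonelli2 _ mH (fun z => G0 _)).
have mGG := measurable_fun_fubini_tonelli_G _ mG G0 (m1 := mu).
have G0' y : (0 <= fubini_G mu G y)%E by apply: integral_ge0.
rewrite (ge0_integral_translate (complex.Im c) mGG G0'); apply: eq_integral => y _.
have mGy : measurable_fun setT (fun x : RM => G (x, complex.Im c + y)).
  by apply: (measurableT_comp mG); apply: measurable_fun_pair => //; exact: measurable_cst.
exact: (ge0_integral_translate (complex.Re c) mGy (fun x => G0 _)).
Qed.

Lemma measurable_polar_inner (G : RM * RM -> \bar R) :
  measurable_fun setT G -> (forall z, (0 <= G z)%E) ->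
  measurable_fun (`]0%R, +oo[%classic : set RM)
    (fun r : RM => \int[mu]_(t in I2pi) (G (r, t) * r%:E))%E.
Proof.
move=> mG G0.
(* The absolute value makes [H] nonnegative everywhere, as Tonelli requires; it equals r on the set
   of interest. *)
pose H (z : RM * RM) := (G z * (`|z.1| * \1_I2pi z.2)%:E)%E.
have mH : measurable_fun setT H.
  apply: emeasurable_funM => //; apply/measurable_EFinP; apply: measurable_funM.
    by apply: measurableT_comp => //; exact: measurable_fst.
  by apply: measurableT_comp; [apply: measurable_indic; exact: measurable_itv|exact: measurable_snd].
have H0 z : (0 <= H z)%E by rewrite mule_ge0// lee_fin mulr_ge0.
have : measurable_fun (`]0%R, +oo[%classic : set RM) (fubini_F mu H).
  by apply: measurable_funTS; exact: measurable_fun_fubini_tonelli_F.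
apply: eq_measurable_fun => r; rewrite inE /= in_itv/= andbT => r0.
rewrite [RHS]integral_mkcond; apply: eq_integral => t _.
rewrite /H patchE indicE /=; case: (t \in I2pi); last by rewrite mulr0 mule0.
by rewrite mulr1 gtr0_norm.
Qed.

End PlaneMeasure.

Section SubMean.
Context {R : realType}.
Local Notation RM := (measurableTypeR R).
Local Notation mu := (@lebesgue_measure R).
Local Notation I2pi := (`[0%R, (2 * pi)%R]%classic : set R).
Implicit Types (c : R[i]) (r rho p : R) (a : nat -> R[i]) (f : R[i] -> R[i]).

(** The graph of y^p lies above its tangent at x. For p > 1 this is Young's inequality with
    exponents p and p / (p - 1). *)
Lemma powR_tangent (p x y : R) : 1 <= p -> 0 <= x -> 0 <= y ->
  p * (x `^ (p - 1) * y) <= (p - 1) * x `^ p + y `^ p.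
Proof.
move=> p1 x0 y0; have [->|pn1] := eqVneq p 1.
  by rewrite subrr powRr0 mul0r add0r !mul1r powRr1.
have pgt1 : 1 < p by rewrite lt_neqAle eq_sym pn1.
have p0 : 0 < p by rewrite (lt_trans _ pgt1).
have pm0 : 0 < p - 1 by rewrite subr_gt0.
pose q := p / (p - 1).
have q0 : 0 < q by rewrite divr_gt0.
have pq : p^-1 + q^-1 = 1 by rewrite /q; field; rewrite !gt_eqF.
have := conjugate_powR y0 (powR_ge0 x (p - 1)) p0 q0 pq.
rewrite -powRrM (_ : (p - 1) * q = p); last by rewrite /q; field; rewrite gt_eqF.
rewrite -(ler_pM2l p0) [y * _]mulrC => h; apply: le_trans h _.
by rewrite le_eqVlt; apply/orP; left; apply/eqP; rewrite /q; field; rewrite !gt_eqF.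
Qed.

Lemma I2pi_measure : mu I2pi = (2 * pi)%:E.
Proof. by rewrite lebesgue_measure_itv/= lte_fin twopi_gt0 -EFinB subr0. Qed.

Lemma circle_powR_measurable c r a f rho p : power_series_on c r a f -> 0 < rho < r ->
  measurable_fun (I2pi : set RM) (fun t : RM => cabs (f (c + circle_point rho t)) `^ p).
Proof.
move=> hf hrho; apply: (@measurableT_comp _ _ _ _ _ _ (@powR R ^~ p)); first exact: measurable_powR.
by apply/measurable_EFinP; exact: measurable_int (circle_cabs_integrable hf hrho).
Qed.

(** Integrate the tangent inequality at x = |f c| over the circle. The mean of |f| is at least x by
    the coefficient bound for index 0, so the linear side is at least p x^p, and (p - 1) x^p
    cancels. *)
Lemma circle_submean c r a f rho p : 1 <= p -> power_series_on c r a f -> 0 < rho < r ->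
  ((2 * pi * cabs (f c) `^ p)%:E <=
    \int[mu]_(t in I2pi) (cabs (f (c + circle_point rho t)) `^ p)%:E)%E.
Proof.
move=> p1 hf hrho; set x := cabs (f c); have x0 : 0 <= x by exact: cabs_ge0.
have p0 : 0 < p by rewrite (lt_le_trans _ p1).
pose y t := cabs (f (c + circle_point rho t)).
have r0 : 0 < r by move: hrho => /andP[h1 h2]; exact: lt_trans h2.
have iy := circle_cabs_integrable hf hrho.
have my : measurable_fun (I2pi : set RM) (fun t : RM => (y t)%:E) by exact: measurable_int iy.
have hy : ((2 * pi * x)%:E <= \int[mu]_(t in I2pi) (y t)%:E)%E.
  have := coef_le_circle_mean 0 hf hrho; rewrite expr0 mulr1 -(ps_at_center r0 hf) -/x.
  by rewrite -lee_fin /Rintegral fineK//; exact: integrable_fin_num iy.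
have myp := circle_powR_measurable p hf hrho.
set X := (\int[mu]_(t in I2pi) _)%E.
have X0 : (0 <= X)%E by apply: integral_ge0 => t _; rewrite lee_fin powR_ge0.
have pm : 0 <= p - 1 by rewrite subr_ge0.
have key : ((p * x `^ (p - 1))%:E * (2 * pi * x)%:E <= ((p - 1) * x `^ p * (2 * pi))%:E + X)%E.
  apply: (@le_trans _ _ ((p * x `^ (p - 1))%:E * \int[mu]_(t in I2pi) (y t)%:E)%E).
    by rewrite lee_wpmul2l// lee_fin mulr_ge0 ?powR_ge0// ltW.
  rewrite -ge0_integralZl//; last 2 first.
  - by move=> t _; rewrite lee_fin cabs_ge0.
  - by rewrite lee_fin mulr_ge0 ?powR_ge0// ltW.
  rewrite [((p - 1) * _ * _)%:E]EFinM -I2pi_measure -(@integral_cst _ _ _ mu _ (measurable_itv _)).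
  rewrite -ge0_integralD//; last 3 first.
  - by move=> t _; rewrite lee_fin mulr_ge0 ?powR_ge0.
  - by move=> t _; rewrite lee_fin powR_ge0.
  - by apply/measurable_EFinP; exact: myp.
  apply: ge0_le_integral => //.
  - by move=> t _; rewrite -EFinM lee_fin !mulr_ge0 ?powR_ge0 ?cabs_ge0// ltW.
  - exact: measurable_funeM.
  - by apply: emeasurable_funD => //; apply/measurable_EFinP; exact: myp.
  - move=> t _; rewrite -EFinM -EFinD lee_fin -mulrA.
    by apply: powR_tangent => //; exact: cabs_ge0.
have xp : x `^ (p - 1) * x = x `^ p.
  have [->|xn0] := eqVneq x 0; first by rewrite mulr0 powR0// gt_eqF.
  by rewrite -{2}[x]powRr1// -powRD ?subrK// xn0 implybT.
move: key X0; case: X => [X||]//=.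
- rewrite -EFinM -EFinD !lee_fin => + _.
  rewrite (_ : p * _ * _ = p * (2 * pi) * (x `^ (p - 1) * x)); last by ring.
  by rewrite xp; set z := x `^ p; lra.
- by move=> _ _; rewrite leey.
Qed.

Lemma plane_circle c r t : ((complex.Re c + r * cos t) +i* (complex.Im c + r * sin t))%C =
  c + circle_point r t.
Proof. by case: c. Qed.

Lemma plane_disc_circle c rho r t : 0 < r ->
  ((complex.Re c + r * cos t, complex.Im c + r * sin t) \in plane_disc c rho) = (r < rho).
Proof.
move=> r0; have E : (c + circle_point r t \in disc c rho) = (r < rho).
  by rewrite in_disc addrAC subrr add0r cabs_circle_point.
by apply/idP/idP; rewrite inE /plane_disc/= plane_circle E.
Qed.

Lemma integral_linear_disc (b rho : R) : 0 < rho ->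
  (\int[mu]_(r in `]0%R, rho[) (b * r)%:E = (b * rho ^+ 2 / 2)%:E)%E.
Proof.
move=> rho0.
have mlin (D : set RM) : measurable_fun D (fun r : RM => (b * r)%:E).
  by apply/measurable_EFinP; apply: measurable_funM => //; exact: measurable_id.
rewrite (integral_itv_bndo_bndc (mlin _)) (integral_itv_obnd_cbnd (mlin _)).
pose F (r : R) := b * r ^+ 2 / 2.
have dF (r : R) : is_derive r (1 : R) F (b * r).
  by rewrite /F; apply: is_derive_eq; rewrite /GRing.scale/=; field.
have cF : continuous F.
  by move=> r; apply/differentiable_continuous/derivable1_diffP; case: (dF r).
rewrite (@continuous_FTC2 _ _ F)//.
- by rewrite -EFinB /F expr0n/= mulr0 mul0r subr0.
- apply: continuous_subspaceT => r; apply: cvgM; [exact: cvg_cst|exact: cvg_id].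
- split => [r _| |]; first by case: (dF r).
    by apply: cvg_at_right_filter; exact: cF.
  by apply: cvg_at_left_filter; exact: cF.
- by move=> r _; rewrite derive1E; exact: (@derive_val _ _ _ _ _ _ _ (dF r)).
Qed.

(** The circle inequality is integrated against r dr in polar coordinates centred at c. *)
Lemma area_submean c r a f rho p : 1 <= p -> power_series_on c r a f -> 0 < rho < r ->
  ((pi * rho ^+ 2 * cabs (f c) `^ p)%:E <=
    \int[mu \x mu]_(xy in plane_disc c rho) (cabs (f (xy.1 +i* xy.2)%C) `^ p)%:E)%E.
Proof.
move=> p1 hf /[dup] hrho /andP[rho0 rhor].
have mD : measurable (plane_disc c rho) by exact: measurable_plane_disc.
pose g (xy : RM * RM) := (cabs (f (xy.1 +i* xy.2)%C) `^ p)%:E.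
have mg : measurable_fun (plane_disc c rho) g.
  apply/measurable_EFinP; apply: (@measurableT_comp _ _ _ _ _ _ (@powR R ^~ p)); first exact: measurable_powR.
  apply: measurable_funS (measurable_ps_cabs hf); first exact: measurable_plane_disc.
  by move=> xy; rewrite /plane_disc/= !in_disc => /lt_trans; apply.
rewrite integral_mkcond -/g.
pose G := g \_ (plane_disc c rho).
have mG : measurable_fun setT G by apply/(measurable_restrictT _ _).1.
have G0 z : (0 <= G z)%E.
  by rewrite /G patchE; case: ifP => // _; rewrite lee_fin powR_ge0.
rewrite (polar_coordinates_at c mG G0).
set b := 2 * pi * cabs (f c) `^ p.
have -> : (pi * rho ^+ 2 * cabs (f c) `^ p)%:E = (b * rho ^+ 2 / 2)%:E.
  by congr EFin; rewrite /b; field.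
rewrite -integral_linear_disc//.
have -> : (`]0%R, rho[%classic : set RM) = `]0%R, +oo[%classic `&` `]0%R, rho[%classic.
  by apply/seteqP; split => [s|s []] /=; rewrite !in_itv/= ?andbT// => /andP[-> ->].
rewrite integral_mkcondr.
pose G' (z : RM * RM) := G (complex.Re c + z.1 * cos z.2, complex.Im c + z.1 * sin z.2).
have mG' : measurable_fun setT G'.
  have mtrig (h : RM -> RM) (b' : R) : measurable_fun setT h ->
      measurable_fun (setT : set (RM * RM)) (fun z : RM * RM => b' + z.1 * h z.2).
    move=> mh; apply: measurable_funD; first exact: measurable_cst.
    apply: measurable_funM; first exact: measurable_fst.
    by apply: (measurableT_comp mh); exact: measurable_snd.
  apply: (measurableT_comp mG); apply: measurable_fun_pair.
    exact: (mtrig _ _ measurable_fun_cos).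
  exact: (mtrig _ _ measurable_fun_sin).
have b0 : 0 <= b by rewrite mulr_ge0 ?powR_ge0// ltW// twopi_gt0.
apply: ge0_le_integral => //.
- move=> s _; rewrite patchE; case: ifPn => // /set_mem; rewrite /= in_itv/= => /andP[s0 _].
  by rewrite lee_fin mulr_ge0// ltW.
- apply: measurable_funTS; apply/(measurable_restrictT _ _).1 => //.
  by apply/measurable_EFinP; apply: measurable_funM => //; exact: measurable_id.
- exact: (measurable_polar_inner mG' (fun z => G0 _)).
move=> s /=; rewrite in_itv/= andbT => s0.
rewrite patchE mem_setE /= in_itv/= s0/=.
have inner0 t : (0 <= G (complex.Re c + s * cos t, complex.Im c + s * sin t)%R * s%:E)%E.
  by rewrite mule_ge0// lee_fin ltW.
case: ltP => srho; last by apply: integral_ge0 => t _.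
have hs : 0 < s < r by rewrite s0 (lt_trans srho).
rewrite [leRHS](_ : _ =
    (\int[mu]_(t in I2pi) ((cabs (f (c + circle_point s t)) `^ p)%:E * s%:E))%E); last first.
  by apply: eq_integral => t _; rewrite /G patchE plane_disc_circle// srho /g/= plane_circle.
rewrite ge0_integralZr//; last 3 first.
- by apply/measurable_EFinP; exact: circle_powR_measurable hf hs.
- by move=> t _; rewrite lee_fin powR_ge0.
- by rewrite lee_fin ltW.
by rewrite EFinM lee_wpmul2r ?lee_fin ?(ltW s0)//; exact: circle_submean hf hs.
Qed.

End SubMean.

(** * Multipliers from coefficient bounds *)

Section Multiplier.
Context {R : realType}.
Local Notation RM := (measurableTypeR R).
Local Notation mu := (@lebesgue_measure R).
Local Notation D := (@plane_disc R 0 1).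
Variables (p : R) (w : nat -> R[i]) (phi : R[i] -> R).
Implicit Types (f F : R[i] -> R[i]) (lam : nat -> R[i]).

Lemma area_integralE (F : R[i] -> \bar R) : area_integral F =
  ((pi^-1)%:E * \int[mu \x mu]_(xy in D) F (xy.1 +i* xy.2)%C)%E.
Proof. by []. Qed.

Let area f := area_integral (fun z => (cabs (f z) `^ p * phi z)%:E).

Hypothesis p1 : 1 <= p.
Hypothesis phi_ge0 : forall z, cabs z < 1 -> 0 <= phi z.
Hypothesis mphi : measurable_fun D (fun xy : RM * RM => phi (xy.1 +i* xy.2)%C).

Lemma plane_disc01 (xy : RM * RM) : D xy -> cabs (xy.1 +i* xy.2)%C < 1.
Proof. by rewrite /plane_disc/= in_disc subr0. Qed.

Lemma weighted_area_ge0 f : (0 <= area f)%E.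
Proof.
rewrite /area area_integralE mule_ge0//; first by rewrite lee_fin invr_ge0 pi_ge0.
apply: integral_ge0 => xy /plane_disc01 xy1.
by rewrite lee_fin mulr_ge0 ?powR_ge0// phi_ge0.
Qed.

Lemma bergman_area f : f \in bergman p phi ->
  analytic_on_disc f /\ exists2 Q, 0 <= Q & area f = Q%:E.
Proof.
rewrite inE => -[af foo]; split => //.
have f0 := weighted_area_ge0 f; exists (fine (area f)); first exact: fine_ge0.
by rewrite fineK// ge0_fin_numE.
Qed.

Lemma bergman_ps f : analytic_on_disc f -> exists lam, power_series_on 0 1 lam f.
Proof. by move=> /(analytic_taylor 0)[lam]; rewrite cabs0 subr0 => h; exists lam. Qed.

Lemma measurable_weighted f lam : power_series_on 0 1 lam f ->
  measurable_fun D (fun xy : RM * RM => (cabs (f (xy.1 +i* xy.2)%C) `^ p * phi (xy.1 +i* xy.2)%C)%:E).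
Proof.
move=> hf; apply/measurable_EFinP; apply: measurable_funM => //.
apply: (@measurableT_comp _ _ _ _ _ _ (@powR R ^~ p)); first exact: measurable_powR.
exact: measurable_ps_cabs hf.
Qed.

(** [b] takes extended values because for the weight |g|^gamma it is a multiple of an infimum of
    integrals. Coefficient bounds are asked only for n > 0, as [w0] removes the constant term. *)
Variables (b : nat -> \bar R) (M : R -> R).
Hypothesis w0 : w 0%N = 0.
Hypothesis b_ge0 : forall n, (0 <= b n)%E.
Hypothesis coef_bound : forall f lam Q n, 0 <= Q -> area f = Q%:E ->
  power_series_on 0 1 lam f -> (0 < n)%N -> ((cabs (lam n))%:E <= b n * (Q `^ p^-1)%:E)%E.
Hypothesis M_ge0 : forall r, 0 <= r < 1 -> 0 <= M r.
Hypothesis series_bound : forall r, 0 < r -> r < 1 ->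
  (\sum_(1 <= n <oo) (b n * (cabs (w n) * r ^+ n)%:E) <= (M r)%:E)%E.
Hypothesis mM : measurable_fun D (fun xy : RM * RM => M (cabs (xy.1 +i* xy.2)%C)).
Hypothesis M_int : (area_integral (fun z => (M (cabs z) `^ p * phi z)%:E) < +oo)%E.

Lemma multiplied_series_bound f lam Q r n : 0 <= Q -> area f = Q%:E ->
  power_series_on 0 1 lam f -> 0 <= r < 1 ->
  \sum_(0 <= k < n) cabs (w k * lam k) * r ^+ k <= Q `^ p^-1 * M r.
Proof.
move=> Q0 fQ hf /andP[r0 r1]; set N := Q `^ p^-1.
have N0 : 0 <= N by exact: powR_ge0.
have NM : 0 <= N * M r by rewrite mulr_ge0// M_ge0// r0.
case: n => [|n]; first by rewrite big_nil.
rewrite big_nat_recl//= w0 mul0r cabs0 mul0r add0r.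
(* [series_bound] concerns r > 0 only; at r = 0 every remaining term vanishes. *)
have [r00|rn0] := eqVneq r 0.
  by rewrite big1// => k _; rewrite r00 exprS mul0r mulr0.
have rgt0 : 0 < r by rewrite lt_neqAle eq_sym rn0.
rewrite -lee_fin -sumEFin [leRHS]EFinM.
apply: (@le_trans _ _ (N%:E * \sum_(1 <= k < n.+1) (b k * (cabs (w k) * r ^+ k)%:E))%E).
  rewrite big_add1/= ge0_sume_distrr; last first.
    by move=> k _; rewrite mule_ge0// lee_fin mulr_ge0 ?cabs_ge0 ?exprn_ge0.
  apply: lee_sum => k _; rewrite muleA [(N%:E * _)%E]muleC.
  rewrite cabsM [cabs (w _) * _]mulrC -mulrA EFinM.
  apply: lee_wpmul2r; first by rewrite lee_fin mulr_ge0 ?cabs_ge0 ?exprn_ge0.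
  exact: coef_bound fQ hf _.
rewrite lee_wpmul2l ?lee_fin//; apply: le_trans (series_bound rgt0 r1).
apply: nneseries_lim_ge => k _ _.
by rewrite mule_ge0// lee_fin mulr_ge0 ?cabs_ge0 ?exprn_ge0.
Qed.

Lemma multiplied_pointwise f F lam Q z : 0 <= Q -> area f = Q%:E ->
  power_series_on 0 1 lam f -> power_series_on 0 1 (fun n => w n * lam n) F ->
  cabs z < 1 -> cabs (F z) <= Q `^ p^-1 * M (cabs z).
Proof.
move=> Q0 fQ hf hF z1; have := @ps_ccvg _ _ _ _ _ z hF; rewrite subr0 => /(_ z1) h.
apply: (ccvg_le h); apply: nearW => n.
apply: le_trans (multiplied_series_bound n Q0 fQ hf _); last by rewrite cabs_ge0.
rewrite !big_mkord; apply: le_trans (cabs_sum _) _.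
by apply: ler_sum => k _; rewrite cabsM cabsX.
Qed.

Lemma multiplier_exists f : f \in bergman p phi -> exists F, is_multiplier w f F.
Proof.
move=> /bergman_area[/bergman_ps[lam hf] [Q Q0 fQ]].
have [|F hF] := @ps_sum_exists R 0 1 (fun n => w n * lam n); last by exists F, lam.
move=> s s01; exists (Q `^ p^-1 * M s) => n; exact: (multiplied_series_bound n Q0 fQ hf s01).
Qed.

Let J := area_integral (fun z => (M (cabs z) `^ p * phi z)%:E).

(** Raise the pointwise bound to the power p, where the norm Q^(1/p) becomes Q, and integrate
    against the weight. *)
Lemma multiplied_area f F Q : 0 <= Q -> area f = Q%:E -> is_multiplier w f F ->
  (area F <= Q%:E * J)%E.
Proof.
move=> Q0 fQ [lam [hf hF]].
have p0 : p != 0 by rewrite gt_eqF// (lt_le_trans _ p1).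
have pge0 : 0 <= p by rewrite (le_trans _ p1).
rewrite /area /J !area_integralE muleCA lee_wpmul2l//; first by rewrite lee_fin invr_ge0 pi_ge0.
have mD : measurable D by exact: measurable_plane_disc.
rewrite -ge0_integralZl//; last 2 first.
- apply/measurable_EFinP; apply: measurable_funM => //.
  by apply: (@measurableT_comp _ _ _ _ _ _ (@powR R ^~ p)); [exact: measurable_powR|exact: mM].
- by move=> xy /plane_disc01 xy1; rewrite lee_fin mulr_ge0 ?powR_ge0// phi_ge0.
apply: ge0_le_integral => //.
- by move=> xy /plane_disc01 xy1; rewrite lee_fin mulr_ge0 ?powR_ge0// phi_ge0.
- exact: measurable_weighted hF.
- apply: measurable_funeM; apply/measurable_EFinP; apply: measurable_funM => //.
  by apply: (@measurableT_comp _ _ _ _ _ _ (@powR R ^~ p)); [exact: measurable_powR|exact: mM].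
move=> xy /plane_disc01 xy1; rewrite -EFinM lee_fin mulrA ler_wpM2r ?phi_ge0//.
have := multiplied_pointwise Q0 fQ hf hF xy1.
move=> /(ge0_ler_powR pge0); rewrite !nnegrE cabs_ge0 => /(_ isT).
rewrite mulr_ge0 ?powR_ge0 ?M_ge0 ?cabs_ge0// => /(_ isT) h; apply: le_trans h _.
by rewrite powRM ?powR_ge0 ?M_ge0 ?cabs_ge0// -powRrM mulVf// powRr1.
Qed.

Theorem multiplier_bounded_of_coef_bound : multiplier_bounded w p phi.
Proof.
(* The multiplier is determined only on the disc, so [T] selects one representative; functions
   without a multiplier are sent to themselves. *)
have /choice[T hT] : forall f, exists F, (exists F', is_multiplier w f F') -> is_multiplier w f F.
  move=> f; have [[F hF]|h] := pselect (exists F', is_multiplier w f F'); first by exists F.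
  by exists f.
have hTb f : f \in bergman p phi -> is_multiplier w f (T f).
  by move=> /multiplier_exists hf; exact: hT.
have pV0 : 0 <= p^-1 by rewrite invr_ge0 (le_trans _ p1).
have J0 : (0 <= J)%E.
  rewrite /J area_integralE mule_ge0//; first by rewrite lee_fin invr_ge0 pi_ge0.
  by apply: integral_ge0 => xy /plane_disc01 xy1; rewrite lee_fin mulr_ge0 ?powR_ge0// phi_ge0.
have Jfin : J = (fine J)%:E by rewrite fineK// ge0_fin_numE.
exists T; split; last exact: hTb.
split.
- move=> f fb; have [_ [Q Q0 fQ]] := bergman_area fb.
  have hm := hTb _ fb; have [lam [_ hF]] := hm.
  rewrite inE; split; first exact: ps_analytic_on_disc hF.
  apply: le_lt_trans (multiplied_area Q0 fQ hm) _.
  by rewrite Jfin -EFinM ltry.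
(* [T] is chosen separately for each function, so linearity rests on uniqueness of Taylor
   coefficients and of limits. *)
- move=> a f h fb hb z; rewrite in_unit_disc => z1.
  have [lf [hf hTf]] := hTb _ fb; have [lh [hh hTh]] := hTb _ hb.
  have lin u (c1 c2 : nat -> R[i]) F1 F2 : cabs u < 1 -> power_series_on 0 1 c1 F1 ->
      power_series_on 0 1 c2 F2 ->
      ccvg (fun n => \sum_(0 <= k < n) (a * c1 k + c2 k) * u ^+ k) (a * F1 u + F2 u).
    move=> u1 h1 h2.
    have := ccvgD (ccvgMl a (@ps_ccvg _ _ _ _ _ u h1 _)) (@ps_ccvg _ _ _ _ _ u h2 _).
    rewrite subr0 => /(_ u1 u1); congr (ccvg _ _); apply/funext => n.
    rewrite mulr_sumr -big_split/=; apply: eq_bigr => k _.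
    by rewrite mulrDl mulrA.
  have hl : power_series_on 0 1 (fun n => a * lf n + lh n) (fun u => a * f u + h u).
    by move=> u; rewrite in_unit_disc => u1; rewrite subr0; exact: lin.
  have hm : is_multiplier w (fun u => a * f u + h u) (T (fun u => a * f u + h u)).
    apply: hT; exists (fun u => a * T f u + T h u), (fun n => a * lf n + lh n); split => //.
    move=> u; rewrite in_unit_disc => u1; rewrite subr0.
    have := lin u _ _ _ _ u1 hTf hTh; congr (ccvg _ _); apply/funext => n.
    by apply: eq_bigr => k _; ring.
  have [l [hl' hTl]] := hm.
  have ll : l = (fun n => a * lf n + lh n).
    by apply/funext => n; exact: (ps_unique n ltr01 ltr01 hl' hl).
  have h1 := lin z _ _ _ _ z1 hTf hTh.
  have := @ps_ccvg _ _ _ _ _ z hTl; rewrite subr0 => /(_ z1) h2.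
  apply: (ccvg_unique h2); move: h1; congr (ccvg _ _); apply/funext => n.
  by apply: eq_bigr => k _; rewrite ll; ring.
- exists (fine J `^ p^-1) => f fb; have [_ [Q Q0 fQ]] := bergman_area fb.
  have hm := multiplied_area Q0 fQ (hTb _ fb).
  rewrite /bergman_norm -/(area f) -/(area (T f)) fQ.
  rewrite -!poweR_EFin -poweRM ?lee_fin ?fine_ge0// -Jfin.
  apply: gt0_ler_poweR => //; rewrite ?in_itv/= ?andbT ?leey ?weighted_area_ge0//.
    by rewrite mule_ge0// lee_fin.
  by rewrite muleC.
Qed.

End Multiplier.

(** * Pointwise bounds by the weighted norm, and radial integrals *)

Section PointwiseBounds.
Context {R : realType}.
Local Notation RM := (measurableTypeR R).
Local Notation mu := (@lebesgue_measure R).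
Local Notation D := (@plane_disc R 0 1).
Local Notation I2pi := (`[0%R, (2 * pi)%R]%classic : set R).
Implicit Types (f F : R[i] -> R[i]) (lam : nat -> R[i]) (phi : R[i] -> R) (p : R).

(** The lower bound [m] for the weight is inserted in the area sub-mean inequality; the pi in the
    area of the disc cancels the normalisation of dA. *)
Lemma weighted_point_bound p phi f (c : R[i]) (rho m Q : R) : 1 <= p ->
  (forall z, cabs z < 1 -> 0 <= phi z) ->
  measurable_fun D (fun xy : RM * RM => phi (xy.1 +i* xy.2)%C) ->
  analytic_on_disc f -> area_integral (fun z => (cabs (f z) `^ p * phi z)%:E) = Q%:E ->
  0 < rho < 1 - cabs c -> 0 <= m -> (forall z, cabs (z - c) < rho -> m <= phi z) ->
  rho ^+ 2 * m * cabs (f c) `^ p <= Q.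
Proof.
move=> p1 phi0 mphi af fQ hrho m0 hm.
have [rho0 rho1] := andP hrho.
have [a ha] := analytic_taylor c af.
have [lam hlam] := bergman_ps af.
have mf := measurable_weighted p mphi hlam.
have sub : plane_disc c rho `<=` D.
  move=> xy; rewrite /plane_disc/= !in_disc subr0 => h.
  by have := cabsD ((xy.1 +i* xy.2)%C - c) c; rewrite subrK; lra.
have mDc : measurable (plane_disc c rho) by exact: measurable_plane_disc.
have mD : measurable D by exact: measurable_plane_disc.
have mfc : measurable_fun (plane_disc c rho) (fun xy : RM * RM => (cabs (f (xy.1 +i* xy.2)%C) `^ p)%:E).
  apply/measurable_EFinP; apply: (@measurableT_comp _ _ _ _ _ _ (@powR R ^~ p)).
    exact: measurable_powR.
  by apply: measurable_funS (measurable_ps_cabs hlam).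
have h1 := area_submean p1 ha hrho.
have h2 : (m%:E * \int[mu \x mu]_(xy in plane_disc c rho) (cabs (f (xy.1 +i* xy.2)%C) `^ p)%:E <=
    \int[mu \x mu]_(xy in D) (cabs (f (xy.1 +i* xy.2)%C) `^ p * phi (xy.1 +i* xy.2)%C)%:E)%E.
  rewrite -ge0_integralZl//; last by move=> xy _; rewrite lee_fin powR_ge0.
  apply: (@le_trans _ _ (\int[mu \x mu]_(xy in plane_disc c rho)
      (cabs (f (xy.1 +i* xy.2)%C) `^ p * phi (xy.1 +i* xy.2)%C)%:E)%E).
    apply: ge0_le_integral => //.
    - by move=> xy _; rewrite -EFinM lee_fin mulr_ge0 ?powR_ge0.
    - exact: measurable_funeM.
    - exact: measurable_funS mf.
    - move=> xy; rewrite /plane_disc/= in_disc => xyc.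
      by rewrite -EFinM lee_fin mulrC ler_wpM2l ?powR_ge0// hm.
  apply: ge0_subset_integral => //.
  by move=> xy /plane_disc01 xy1; rewrite lee_fin mulr_ge0 ?powR_ge0// phi0.
move: fQ; rewrite area_integralE => fQ.
have pi0 := @pi_gt0 R.
have E : (\int[mu \x mu]_(xy in D) (cabs (f (xy.1 +i* xy.2)%C) `^ p * phi (xy.1 +i* xy.2)%C)%:E = (pi * Q)%:E)%E.
  rewrite EFinM -fQ muleA -EFinM divff ?gt_eqF// mul1e.
  by [].
rewrite E in h2.
have h3 : ((m * (pi * rho ^+ 2 * cabs (f c) `^ p))%:E <= (pi * Q)%:E)%E.
  by apply: le_trans h2; rewrite EFinM lee_wpmul2l ?lee_fin.
move: h3; rewrite lee_fin -(ler_pM2l pi0).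
suff -> : m * (pi * rho ^+ 2 * cabs (f c) `^ p) = pi * (rho ^+ 2 * m * cabs (f c) `^ p).
  by rewrite !ler_pM2l.
by ring.
Qed.

Lemma measurable_cabs_comp (h : R -> R) : measurable_fun (setT : set RM) h ->
  measurable_fun D (fun xy : RM * RM => h (cabs (xy.1 +i* xy.2)%C)).
Proof.
move=> mh; apply: measurable_funTS; apply: (measurableT_comp mh).
by apply: cmeasurable_cabs; exact: cmeasurable_plane.
Qed.

Lemma disc_polar (F : R[i] -> R) :
  measurable_fun D (fun xy : RM * RM => F (xy.1 +i* xy.2)%C) ->
  (forall z, cabs z < 1 -> 0 <= F z) ->
  (\int[mu \x mu]_(xy in D) (F (xy.1 +i* xy.2)%C)%:E =
   \int[mu]_(r in `]0%R, 1%R[) \int[mu]_(t in I2pi) (r * F (circle_point r t))%:E)%E.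
Proof.
move=> mF F0.
have mD : measurable D by exact: measurable_plane_disc.
rewrite integral_mkcond.
pose G := (fun xy : RM * RM => (F (xy.1 +i* xy.2)%C)%:E) \_ D.
have mG : measurable_fun setT G.
  by apply/(measurable_restrictT _ _).1 => //; apply/measurable_EFinP.
have G0 z : (0 <= G z)%E.
  rewrite /G patchE; case: ifPn => // /set_mem/plane_disc01 z1.
  by rewrite lee_fin F0.
rewrite -/G (polar_coordinates_at 0 mG G0).
have -> : (`]0%R, 1%R[%classic : set RM) = `]0%R, +oo[%classic `&` `]0%R, 1%R[%classic.
  by apply/seteqP; split => [s|s []] /=; rewrite !in_itv/= ?andbT// => /andP[-> ->].
rewrite [RHS]integral_mkcondr; apply: eq_integral => r.
rewrite inE/= in_itv/= andbT => r0.
rewrite patchE mem_setE /= in_itv/= r0/=.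
have inD t := @plane_disc_circle R 0 1 r t r0; rewrite /= in inD.
case: ifP => r1; last first.
  by rewrite integral0_eq// => t _; rewrite /G patchE inD r1 mul0e.
apply: eq_integral => t _; rewrite /G patchE inD r1/= -EFinM mulrC.
by rewrite !add0r.
Qed.

(** The integrand may be singular at 1, so the interval is exhausted by [0, 1 - 1/(i+1)], where the
    explicit primitive bounds the integral by 1 / (1 - al). *)
Lemma integral_one_minus_powR (al : R) : al < 1 ->
  (\int[mu]_(r in `]0%R, 1%R[) ((1 - r) `^ (- al))%:E < +oo)%E.
Proof.
move=> al1.
pose F (i : nat) : set RM := `[0%R, (1 - i.+1%:R^-1)%R]%classic.
have be0 : 0 < 1 - al by rewrite subr_gt0.
pose g (r : RM) := ((1 - r) `^ (- al))%:E.
have mg : measurable_fun (setT : set RM) g.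
  apply/measurable_EFinP; apply: (@measurableT_comp _ _ _ _ _ _ (@powR R ^~ (- al))).
    exact: measurable_powR.
  by apply: measurable_funB; [exact: measurable_cst|exact: measurable_id].
have iV (i : nat) : 0 < i.+1%:R^-1 :> R by rewrite invr_gt0.
have ndF : nondecreasing_seq F.
  move=> m n mn; apply/subsetPset => r; rewrite /F /= !in_itv/= => /andP[-> /=] h.
  by apply: le_trans h _; rewrite lerD2l lerN2 lef_pV2 ?posrE// ler_nat ltnS.
have cvF := @ge0_nondecreasing_set_cvg_integral _ _ _ F g mu ndF
  (fun i => measurable_itv _) (fun i => measurable_funTS mg)
  (fun i x _ => powR_ge0 _ _).
have bF i : (\int[mu]_(x in F i) g x <= ((1 - al)^-1)%:E)%E.
  (* The first interval degenerates to {0}, where the fundamental theorem does not apply. *)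
  have [i0|] := posnP i.
    have -> : F i = [set 0%R].
      by rewrite /F i0 invr1 subrr set_itv1.
    by rewrite integral_set1 lee_fin invr_ge0 ltW.
  move=> i0; pose b : R := 1 - i.+1%:R^-1.
  have b0 : 0 < b by rewrite subr_gt0 invf_lt1// ltr1n.
  have b1 : b < 1 by rewrite ltrBlDr ltrDl.
  pose P (r : R) : R := - (1 - al)^-1 * (1 - r) `^ (1 - al).
  have dP (r : R) : r < 1 -> is_derive r (1 : R) P ((1 - r) `^ (- al)).
    move=> r1; have r1' : 0 < 1 - r by rewrite subr_gt0.
    have d1 : is_derive r (1 : R) (fun r : R => 1 - r) (- 1).
      by apply: is_derive_eq; rewrite add0r mul1r.
    have d2 := is_derive1_powR (1 - al) r1'.
    have d3 := @is_derive1_comp _ (@powR R ^~ (1 - al)) (fun r : R => 1 - r) r _ _ d2 d1.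
    have d4 := @is_deriveZ _ _ _ ((@powR R ^~ (1 - al)) \o (fun r : R => 1 - r)) (- (1 - al)^-1) r 1 _ d3.
    apply: (is_derive_eq d4); rewrite /GRing.scale/= (_ : 1 - al - 1 = - al); last by ring.
    by field; rewrite gt_eqF.
  have cP (r : R) : r < 1 -> {for r, continuous P}.
    by move=> /dP d; apply/differentiable_continuous/derivable1_diffP; case: d.
  rewrite /F -/b (@continuous_FTC2 _ _ P)//.
  - rewrite -EFinB lee_fin /P subr0 powR1 mulr1 opprK -[leRHS]add0r lerD2r.
    by rewrite mulNr oppr_le0 mulr_ge0 ?powR_ge0// invr_ge0 ltW.
  - apply: continuous_in_subspaceT => r /set_mem; rewrite /= in_itv/= => /andP[_ rb].
    have r1 : 0 < 1 - r by rewrite subr_gt0 (le_lt_trans rb).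
    have d1 : {for r, continuous (fun r : R => 1 - r)}.
      by apply: cvgB; [exact: cvg_cst|exact: cvg_id].
    apply: (@continuous_comp _ _ _ (fun r : R => 1 - r) (@powR R ^~ (- al)) r d1).
    apply/differentiable_continuous/derivable1_diffP.
    by case: (is_derive1_powR (- al) r1).
  - split.
    + by move=> r; rewrite in_itv/= => /andP[_ rb]; case: (dP r (lt_trans rb b1)).
    + by apply: cvg_at_right_filter; exact: cP.
    + by apply: cvg_at_left_filter; exact: cP.
  - move=> r; rewrite in_itv/= => /andP[_ rb]; rewrite derive1E.
    exact: (@derive_val _ _ _ _ _ _ _ (dP r (lt_trans rb b1))).
have sub : (`]0%R, 1%R[%classic : set RM) `<=` \bigcup_i F i.
  move=> r /=; rewrite in_itv/= => /andP[r0 r1].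
  have r1' : 0 < 1 - r by rewrite subr_gt0.
  exists (Num.truncn (1 - r)^-1) => //; rewrite /F /= in_itv/= (ltW r0)/=.
  rewrite lerBrDr addrC -lerBrDr invf_ple ?posrE//.
  by apply: ltW; exact: truncnS_gt.
apply: (@le_lt_trans _ _ (\int[mu]_(r in \bigcup_i F i) g r)%E).
  apply: ge0_subset_integral => //.
  - by apply: bigcup_measurable => i _; exact: measurable_itv.
  - exact: measurable_funTS mg.
  - by move=> r _; rewrite lee_fin powR_ge0.
apply: (@le_lt_trans _ _ ((1 - al)^-1)%:E); last by rewrite ltry.
by apply: (cvge_to_le cvF); exact: nearW.
Qed.

End PointwiseBounds.

(** * The weight 1 - |Re z| *)

Section RealPartWeight.
Context {R : realType}.
Local Notation RM := (measurableTypeR R).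
Local Notation mu := (@lebesgue_measure R).
Local Notation D := (@plane_disc R 0 1).
Local Notation I2pi := (`[0%R, (2 * pi)%R]%classic : set R).
Implicit Types (f F : R[i] -> R[i]) (lam : nat -> R[i]) (p : R).

Lemma powR_root_le p (x y : R) : 1 <= p -> 0 <= x -> x `^ p <= y -> x <= y `^ p^-1.
Proof.
move=> p1 x0 xy; have p0 : p != 0 by rewrite gt_eqF// (lt_le_trans _ p1).
rewrite -[x in x <= _]powRr1// -(mulfV p0) powRrM ge0_ler_powR//.
- by rewrite invr_ge0 (le_trans _ p1).
- by rewrite nnegrE powR_ge0.
- by rewrite nnegrE (le_trans _ xy)// powR_ge0.
Qed.

Lemma measurable_one_minus_powR (a : R) :
  measurable_fun (setT : set RM) (fun r : RM => (1 - (r : R)) `^ a).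
Proof.
apply: (@measurableT_comp _ _ _ _ _ _ (@powR R ^~ a)); first exact: measurable_powR.
by apply: measurable_funB; [exact: measurable_cst|exact: measurable_id].
Qed.

(** In both parts the majorant of M_w f is K (1 - |z|)^a, with a = -v or a = -k. *)
Lemma area_scaled_majorant_lty p (K a : R) (phi : R[i] -> R) : 0 <= K ->
  (forall z, cabs z < 1 -> 0 <= phi z) ->
  measurable_fun D (fun xy : RM * RM => phi (xy.1 +i* xy.2)%C) ->
  (\int[mu \x mu]_(xy in D) ((1 - cabs (xy.1 +i* xy.2)%C) `^ (a * p) * phi (xy.1 +i* xy.2)%C)%:E < +oo)%E ->
  (area_integral (fun z => ((K * (1 - cabs z) `^ a) `^ p * phi z)%:E) < +oo)%E.
Proof.
move=> K0 phi0 mphi hfin; rewrite area_integralE.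
pose X (z : R[i]) := (1 - cabs z) `^ (a * p) * phi z.
have mX : measurable_fun D (fun xy : RM * RM => (X (xy.1 +i* xy.2)%C)%:E).
  apply/measurable_EFinP; apply: measurable_funM => //.
  exact: (measurable_cabs_comp (measurable_one_minus_powR (a * p))).
have -> : (\int[mu \x mu]_(xy in D)
    ((K * (1 - cabs (xy.1 +i* xy.2)%C) `^ a) `^ p * phi (xy.1 +i* xy.2)%C)%:E =
    (K `^ p)%:E * \int[mu \x mu]_(xy in D) (X (xy.1 +i* xy.2)%C)%:E)%E.
  rewrite -ge0_integralZl//.
  - by apply: eq_integral => xy _; rewrite /X -EFinM powRM ?powR_ge0// -powRrM mulrA.
  - exact: measurable_plane_disc.
  - by move=> xy /plane_disc01 h; rewrite lee_fin mulr_ge0 ?powR_ge0// phi0.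
  - by rewrite lee_fin powR_ge0.
rewrite muleA -EFinM; apply: lte_mul_pinfty => //.
by rewrite lee_fin mulr_ge0 ?powR_ge0// invr_ge0 pi_ge0.
Qed.

Lemma radial_power_integral_lty (al : R) : al < 1 ->
  (\int[mu \x mu]_(xy in D) ((1 - cabs (xy.1 +i* xy.2)%C) `^ (- al))%:E < +oo)%E.
Proof.
move=> al1.
have mh := measurable_one_minus_powR (- al).
rewrite (@disc_polar _ (fun z => (1 - cabs z) `^ (- al))); last 2 first.
- exact: (measurable_cabs_comp mh).
- by move=> z _; exact: powR_ge0.
apply: (@le_lt_trans _ _ (\int[mu]_(r in `]0%R, 1%R[) ((2 * pi)%:E * ((1 - r) `^ (- al))%:E))%E).
  have E (r : R) : 0 < r -> (\int[mu]_(t in I2pi) (r * (1 - cabs (circle_point r t)) `^ (- al))%:E =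
      ((r * (1 - r) `^ (- al)) * (2 * pi))%:E)%E.
    move=> r0; under eq_integral do rewrite cabs_circle_point//.
    by rewrite (@integral_cst _ _ _ mu _ (measurable_itv _)) /= lebesgue_measure_itv/= lte_fin twopi_gt0 -EFinB subr0.
  rewrite (_ : (\int[mu]_(r in `]0%R, 1%R[) _)%E =
      (\int[mu]_(r in `]0%R, 1%R[) ((r * (1 - r) `^ (- al)) * (2 * pi))%:E)%E); last first.
    by apply: eq_integral => r; rewrite inE /= in_itv/= => /andP[r0 _]; rewrite E.
  have tp : 0 <= 2 * pi :> R by rewrite ltW// twopi_gt0.
  apply: ge0_le_integral => //.
  - move=> r; rewrite /= in_itv/= => /andP[r0 _].
    by rewrite lee_fin mulr_ge0// mulr_ge0 ?powR_ge0// ltW.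
  - apply: measurable_funTS; apply/measurable_EFinP.
    apply: measurable_funM; last exact: measurable_cst.
    by apply: measurable_funM; [exact: measurable_id|exact: mh].
  - apply: measurable_funTS; apply: measurable_funeM; apply/measurable_EFinP; exact: mh.
  - move=> r; rewrite /= in_itv/= => /andP[r0 r1].
    by rewrite -EFinM lee_fin mulrC ler_wpM2l// ler_piMl ?powR_ge0// ltW.
rewrite ge0_integralZl//.
- apply: lte_mul_pinfty; [|by []|exact: integral_one_minus_powR].
  by rewrite lee_fin ltW// twopi_gt0.
- by apply: measurable_funTS; apply/measurable_EFinP; exact: mh.
- by move=> r _; rewrite lee_fin powR_ge0.
- by rewrite lee_fin ltW// twopi_gt0.
Qed.

(** This is (1 + 1/n)^n <= e: on the circle of radius n/(n+1), dividing by the n-th power of the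
    radius costs at most a factor e. *)
Lemma expR1_ratio n : (0 < n)%N -> 1 <= expR 1 * (n%:R / n.+1%:R) ^+ n :> R.
Proof.
move=> n0; have n0' : 0 < n%:R :> R by rewrite ltr0n.
have nS0 : 0 < n.+1%:R :> R by rewrite ltr0n.
have h : n.+1%:R / n%:R <= expR (n%:R^-1) :> R.
  by rewrite -natr1 mulrDl divff ?gt_eqF// mul1r; exact: expR_ge1Dx.
have -> : expR 1 = expR (n%:R^-1) ^+ n :> R.
  by rewrite -expRM_natl mulfV// gt_eqF.
rewrite -exprMn -[leLHS](expr1n _ n) lerXn2r ?nnegrE ?mulr_ge0 ?expR_ge0 ?divr_ge0//.
rewrite -[leLHS](_ : n.+1%:R / n%:R * (n%:R / n.+1%:R) = 1); last by field; rewrite !gt_eqF.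
by rewrite ler_wpM2r// divr_ge0.
Qed.

Theorem real_part_weight_multiplier p (w : nat -> R[i]) (C4 v : R) :
  1 <= p -> w 0%N = 0 -> 0 < C4 -> v < p^-1 ->
  (forall r : R, 0 < r -> r < 1 ->
    (\sum_(1 <= n <oo) (cabs (w n) * (n.+1%:R `^ (3 / p)) * r ^+ n)%:E
      <= (C4 / (1 - r) `^ v)%:E)%E) ->
  multiplier_bounded w p (fun z => 1 - `|complex.Re z|).
Proof.
move=> p1 w0 C40 vp hser.
have p0 : 0 < p by rewrite (lt_le_trans _ p1).
pose phi (z : R[i]) := 1 - `|complex.Re z|.
have phi_lb (z : R[i]) : 1 - cabs z <= phi z by rewrite lerD2l lerN2 normRe_le_cabs.
have phi0 z : cabs z < 1 -> 0 <= phi z.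
  by move=> z1; apply: le_trans (phi_lb z); rewrite subr_ge0 ltW.
have mphi : measurable_fun D (fun xy : RM * RM => phi (xy.1 +i* xy.2)%C).
  apply: measurable_funTS; apply: measurable_funB; first exact: measurable_cst.
  by apply: measurableT_comp => //; exact: measurable_fst.
(* The factor e comes from [expR1_ratio], and 8 from the cube of rho = 1 / (2 (n+1)). *)
pose E : R := expR 1 * 8 `^ p^-1.
have E0 : 0 < E by rewrite mulr_gt0 ?expR_gt0 ?powR_gt0.
pose b n : \bar R := (E * n.+1%:R `^ (3 / p))%:E.
pose M (r : R) := E * C4 * (1 - r) `^ (- v).
apply: (@multiplier_bounded_of_coef_bound R p w phi p1 phi0 mphi b M w0).
- by move=> n; rewrite lee_fin mulr_ge0 ?powR_ge0// ltW.
- move=> f lam Q n Q0 fQ hf n0.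
  have n0' : 0 < n%:R :> R by rewrite ltr0n.
  have nS0 : 0 < n.+1%:R :> R by rewrite ltr0n.
  pose s : R := n%:R / n.+1%:R.
  have s0 : 0 < s by rewrite divr_gt0.
  have s1 : 1 - s = n.+1%:R^-1 by rewrite /s -natr1; field; rewrite natr1 gt_eqF.
  have sV : 0 < n.+1%:R^-1 :> R by rewrite invr_gt0.
  have fb z : cabs (z - 0) = s -> cabs (f z) <= Q `^ p^-1 * (8 `^ p^-1 * n.+1%:R `^ (3 / p)).
    (* Half the distance 1/(n+1) to the boundary. The weight is at least [rho] on this disc, so area
       and weight together give rho^3, whence the exponent 3/p. *)
    rewrite subr0 => zs; pose rho : R := n.+1%:R^-1 / 2.
    have rho0 : 0 < rho by rewrite divr_gt0.
    have hrho : 0 < rho < 1 - cabs z by rewrite rho0 zs s1 /= /rho; move: (n.+1%:R^-1) sV => x; lra.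
    have af := ps_analytic_on_disc hf.
    have := weighted_point_bound p1 phi0 mphi af fQ hrho (ltW rho0).
    have hm u : cabs (u - z) < rho -> rho <= phi u.
      move=> uz; apply: le_trans (phi_lb u); have := cabsD (u - z) z; rewrite subrK zs.
      by move: s1 uz; rewrite /rho; move: (n.+1%:R^-1) => x; lra.
    move=> /(_ hm) h.
    have h2 : cabs (f z) `^ p <= Q * (8 * n.+1%:R ^+ 3).
      rewrite -(ler_pM2l (exprn_gt0 3 rho0)).
      rewrite (_ : rho ^+ 3 * (Q * _) = Q); first by rewrite exprSr.
      by rewrite /rho; field; rewrite gt_eqF.
    have := powR_root_le p1 (cabs_ge0 _) h2.
    rewrite powRM ?mulr_ge0 ?exprn_ge0 ?ler0n// powRM ?exprn_ge0 ?ler0n//.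
    by rewrite -[n.+1%:R ^+ 3]powR_mulrn// -powRrM.
  have s01 : 0 < s < 1 by rewrite s0 -subr_gt0 s1.
  have hc := cauchy_estimate n hf s01 fb.
  have he := expR1_ratio n0; rewrite -/s in he.
  rewrite -EFinM lee_fin.
  apply: (@le_trans _ _ (cabs (lam n) * (expR 1 * s ^+ n))).
    by rewrite ler_peMr ?cabs_ge0.
  rewrite mulrCA /E -!mulrA ler_pM2l ?expR_gt0//.
  by apply: le_trans hc _; rewrite mulrC mulrA.
- by move=> r _; rewrite !mulr_ge0 ?powR_ge0// ltW.
- move=> r r0 r1.
  have -> : (\sum_(1 <= n <oo) (b n * (cabs (w n) * r ^+ n)%:E))%E =
      (\sum_(1 <= n <oo) (E%:E * (cabs (w n) * (n.+1%:R `^ (3 / p)) * r ^+ n)%:E))%E.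
    by apply: eq_eseriesr => n _; rewrite /b -!EFinM; congr EFin; ring.
  rewrite nneseriesZl; last first.
    by move=> n _; rewrite lee_fin !mulr_ge0 ?powR_ge0 ?cabs_ge0 ?exprn_ge0// ltW.
  rewrite /M powRN -[E * C4 * _]mulrA [leRHS]EFinM.
  by rewrite lee_wpmul2l ?lee_fin ?(ltW E0)//; exact: hser.
- apply: (@measurable_cabs_comp _ M); apply: measurable_funM; first exact: measurable_cst.
  exact: measurable_one_minus_powR.
apply: area_scaled_majorant_lty => //; first by rewrite mulr_ge0 ?ltW.
(* The weight is at most 1 and is dropped; v < 1/p makes the remaining exponent admissible. *)
apply: le_lt_trans (@radial_power_integral_lty (v * p) _); last first.
  by rewrite -ltr_pdivlMr// mul1r.
apply: ge0_le_integral => //.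
- exact: measurable_plane_disc.
- by move=> xy /plane_disc01 h; rewrite lee_fin mulr_ge0 ?powR_ge0// phi0.
- apply/measurable_EFinP; apply: measurable_funM => //.
  exact: (measurable_cabs_comp (measurable_one_minus_powR (- v * p))).
- apply/measurable_EFinP.
  exact: (measurable_cabs_comp (measurable_one_minus_powR (- (v * p)))).
move=> xy _; rewrite lee_fin mulNr ler_piMr ?powR_ge0//.
by rewrite gerBl.
Qed.

End RealPartWeight.

(** * The weight |g|^gamma *)

Section UnivalentWeight.
Context {R : realType}.
Local Notation RM := (measurableTypeR R).
Local Notation mu := (@lebesgue_measure R).
Local Notation D := (@plane_disc R 0 1).
Local Notation I2pi := (`[0%R, (2 * pi)%R]%classic : set R).
Implicit Types (f F g : R[i] -> R[i]) (lam : nat -> R[i]) (p : R).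

(** With rho = (1 - |c|)/2 and |z - c| <= rho/5, the bound |a_n| <= 2 |g c| / rho^n gives |g z - g
    c| <= 2 |g c| (1/5) / (1 - 1/5) = |g c| / 2. This fixes the constant 10. *)
Lemma right_half_plane_harnack g (c z : R[i]) : analytic_on_disc g ->
  (forall u, cabs u < 1 -> 0 < complex.Re (g u)) -> cabs c < 1 ->
  cabs (z - c) <= (1 - cabs c) / 10 -> cabs (g c) / 2 <= cabs (g z).
Proof.
move=> ag gpos c1 zc; set de := 1 - cabs c in zc.
have de0 : 0 < de by rewrite subr_gt0.
have [a ha] := analytic_taylor c ag; rewrite -/de in ha.
have a0 : g c = a 0%N := ps_at_center de0 ha.
pose rho := de / 2; have rho0 : 0 < rho by rewrite divr_gt0.
have hrho : 0 < rho < de by rewrite rho0 /= /rho; lra.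
have an n : (0 < n)%N -> cabs (a n) <= 2 * cabs (g c) / rho ^+ n.
  move=> n0; rewrite ler_pdivlMr ?exprn_gt0//.
  apply: le_trans (caratheodory_coef ha hrho _ n0) _; last first.
    by rewrite ler_pM2l// -a0 Re_le_cabs.
  move=> u uc; apply/ltW/gpos; have := cabsD (u - c) c; rewrite subrK uc.
  by move: de0; rewrite /rho /de; lra.
have zd : cabs (z - c) < de by apply: le_lt_trans zc _; lra.
have cv := ps_ccvg ha zd.
have dist : cabs (g z - g c) <= cabs (g c) / 2.
  have h0 : ccvg (fun n => \sum_(0 <= k < n) a k * (z - c) ^+ k - g c) (g z - g c).
    apply: ccvgB cv _; apply/ccvgP => e e0; apply: nearW => n.
    by rewrite subrr cabs0.
  have r5 : 0 <= rho / 5 by lra.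
  have zr : cabs (z - c) <= rho / 5 by apply: le_trans zc _; rewrite /rho; lra.
  apply: (ccvg_le h0); exists 1%N => // -[//|n] _ /=.
  rewrite big_nat_recl//= expr0 mulr1 -a0 addrAC subrr add0r big_mkord.
  apply: le_trans (cabs_sum _) _.
  apply: (@le_trans _ _ (2 * cabs (g c) * 5^-1 * \sum_(0 <= k < n) (5^-1 : R) ^+ k)).
    rewrite big_mkord mulr_sumr; apply: ler_sum => k _; rewrite cabsM cabsX.
    apply: (@le_trans _ _ (2 * cabs (g c) / rho ^+ k.+1 * (rho / 5) ^+ k.+1)).
      apply: ler_pM; rewrite ?cabs_ge0 ?exprn_ge0 ?cabs_ge0//; first exact: an.
      by rewrite lerXn2r ?nnegrE ?cabs_ge0.
    rewrite le_eqVlt; apply/orP; left; apply/eqP.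
    rewrite [(rho / 5) ^+ _]exprMn mulrA divfK; first by rewrite exprS !mulrA.
    by rewrite expf_neq0// gt_eqF.
  have h5 : \sum_(0 <= k < n) (5^-1 : R) ^+ k <= (1 - 5^-1)^-1.
    by apply: geometric_sum_le; lra.
  apply: (@le_trans _ _ (2 * cabs (g c) * 5^-1 * (1 - 5^-1)^-1)).
    by rewrite ler_wpM2l// !mulr_ge0 ?cabs_ge0// invr_ge0.
  by rewrite le_eqVlt; apply/orP; left; apply/eqP; field.
have := cabs_dist_add (g c) 0 (g z); rewrite !subr0 cabsB; lra.
Qed.

Theorem univalent_weight_multiplier p (w : nat -> R[i]) (gamma C5 k : R) g :
  1 <= p -> w 0%N = 0 -> 0 < gamma -> analytic_on_disc g ->
  (forall z, cabs z < 1 -> 0 < complex.Re (g z)) -> 0 < C5 ->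
  (forall r : R, 0 < r -> r < 1 ->
    (\sum_(1 <= n <oo)
       ereal_inf [set ((\int[lebesgue_measure]_(t in `[0%R, (2 * pi)%R])
                          (cabs (g (circle_point s t)) `^ (- gamma / p))%:E)
                       * ((s ^+ n * (1 - s) `^ (2 / p))^-1)%:E)%E
                 | s in `]0%R, 1%R[]
       * (cabs (w n) * r ^+ n)%:E
     <= (C5 / (1 - r) `^ k)%:E)%E) ->
  (\int[lebesgue_measure]_(r in `]0%R, 1%R[)
      \int[lebesgue_measure]_(t in `[0%R, (2 * pi)%R])
        (r * cabs (g (circle_point r t)) `^ gamma
         / (1 - r) `^ (p * k))%:E < +oo)%E ->
  multiplier_bounded w p (fun z => cabs (g z) `^ gamma).
Proof.
move=> p1 w0 gamma0 ag gpos C50 hser hint.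
have p0 : 0 < p by rewrite (lt_le_trans _ p1).
have pn0 : p != 0 by rewrite gt_eqF.
have gn0 z : cabs z < 1 -> 0 < cabs (g z).
  by move=> /gpos h; exact: lt_le_trans h (Re_le_cabs _).
have [a0 hg0] := bergman_ps ag.
pose phi (z : R[i]) := cabs (g z) `^ gamma.
have phi0 z : cabs z < 1 -> 0 <= phi z by move=> _; exact: powR_ge0.
have mphi : measurable_fun D (fun xy : RM * RM => phi (xy.1 +i* xy.2)%C).
  apply: (@measurableT_comp _ _ _ _ _ _ (@powR R ^~ gamma)); first exact: measurable_powR.
  exact: measurable_ps_cabs hg0.
pose S n := [set ((\int[lebesgue_measure]_(t in `[0%R, (2 * pi)%R])
                    (cabs (g (circle_point s t)) `^ (- gamma / p))%:E)
                 * ((s ^+ n * (1 - s) `^ (2 / p))^-1)%:E)%E | s in `]0%R, 1%R[%classic].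
(* The square of the 20 in rho = (1 - |z|)/20, a radius inside the range of Harnack's inequality; it
   is kept opaque so that the numeral is not computed. *)
have [A A0 AE] : exists2 A : R, 0 < A & A = 20 ^+ 2.
  by exists (20 ^+ 2); rewrite ?exprn_gt0.
pose L : R := (A * 2 `^ gamma) `^ p^-1.
have L0 : 0 < L by apply: powR_gt0; apply: mulr_gt0 => //; exact: powR_gt0.
have tp := @twopi_gt0 R.
pose K := L / (2 * pi); have K0 : 0 < K by rewrite divr_gt0.
pose b n : \bar R := (K%:E * ereal_inf (S n))%E.
have S0 n : (0 <= ereal_inf (S n))%E.
  apply/ereal_infP => y [s /=]; rewrite in_itv/= => /andP[s0 s1] <-.
  rewrite mule_ge0//; last by rewrite lee_fin invr_ge0 mulr_ge0 ?powR_ge0// exprn_ge0// ltW.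
  by apply: integral_ge0 => t _; rewrite lee_fin powR_ge0.
pose M (r : R) := K * C5 * (1 - r) `^ (- k).
have fbound f lam Q : 0 <= Q ->
    area_integral (fun z => (cabs (f z) `^ p * phi z)%:E) = Q%:E ->
    power_series_on 0 1 lam f -> forall z, cabs z < 1 ->
    cabs (f z) <= Q `^ p^-1 * L / (1 - cabs z) `^ (2 / p) * cabs (g z) `^ (- gamma / p).
  move=> Q0 fQ hf z z1; set de := 1 - cabs z.
  have de0 : 0 < de by rewrite subr_gt0.
  have gz := gn0 _ z1.
  pose rho := de / 20; have hrho : 0 < rho < 1 - cabs z by rewrite -/de /rho; lra.
  pose m := (cabs (g z) / 2) `^ gamma.
  have hm u : cabs (u - z) < rho -> m <= phi u.
    move=> uz; rewrite ge0_ler_powR ?nnegrE ?divr_ge0 ?cabs_ge0 ?(ltW gamma0)//.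
    by apply: right_half_plane_harnack => //; rewrite -/de; move: uz; rewrite /rho; lra.
  have h := weighted_point_bound p1 phi0 mphi (ps_analytic_on_disc hf) fQ hrho (powR_ge0 _ _) hm.
  (* All factors depending on z are gathered with f, so that a single p-th root yields the bound
     with constant [L]. *)
  pose x := cabs (f z) * (de `^ (2 / p) * cabs (g z) `^ (gamma / p)).
  have x0 : 0 <= x by rewrite !mulr_ge0 ?powR_ge0 ?cabs_ge0.
  have xp : x `^ p <= Q * (A * 2 `^ gamma).
    rewrite powRM ?cabs_ge0 ?mulr_ge0 ?powR_ge0// powRM ?powR_ge0// -!powRrM.
    rewrite !divfK// (powR_mulrn 2 (ltW de0)).
    have -> : cabs (g z) `^ gamma = m * 2 `^ gamma.
      by rewrite /m -powRM ?divr_ge0 ?cabs_ge0// divfK.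
    have -> : cabs (f z) `^ p * (de ^+ 2 * (m * 2 `^ gamma)) =
        A * 2 `^ gamma * (rho ^+ 2 * m * cabs (f z) `^ p) by rewrite AE /rho; field.
    by rewrite [Q * _]mulrC ler_wpM2l// mulr_ge0 ?powR_ge0// ltW.
  have := powR_root_le p1 x0 xp; rewrite powRM ?mulr_ge0 ?powR_ge0 ?(ltW A0)// -/L => hx.
  have d0 : 0 < de `^ (2 / p) by rewrite powR_gt0.
  have g0 : 0 < cabs (g z) `^ (gamma / p) by rewrite powR_gt0.
  rewrite mulNr powRN -mulrA -invfM ler_pdivlMr ?mulr_gt0//.
apply: (@multiplier_bounded_of_coef_bound R p w phi p1 phi0 mphi b M w0).
- by move=> n; rewrite mule_ge0// lee_fin ltW.
- move=> f lam Q n Q0 fQ hf n0.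
  set N := Q `^ p^-1; have N0 : 0 <= N by exact: powR_ge0.
  (* Valid for every radius s; the infimum over s is taken only afterwards. *)
  have lb s : 0 < s < 1 -> ((cabs (lam n))%:E <= (K * N)%:E *
      (\int[mu]_(t in I2pi) (cabs (g (circle_point s t)) `^ (- gamma / p))%:E
        * ((s ^+ n * (1 - s) `^ (2 / p))^-1)%:E))%E.
    move=> s01; have [s0 s1] := andP s01.
    set Y := (\int[mu]_(t in I2pi) _)%E.
    have d0 : 0 < (1 - s) `^ (2 / p) by rewrite powR_gt0// subr_gt0.
    have sn0 : 0 < s ^+ n by rewrite exprn_gt0.
    have mgY : measurable_fun (I2pi : set RM) (fun t : RM => cabs (g (circle_point s t)) `^ (- gamma / p)).
      have := circle_powR_measurable (- gamma / p) hg0 s01.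
      by apply: eq_measurable_fun => t _; rewrite add0r.
    have h1 : ((2 * pi * cabs (lam n) * s ^+ n)%:E <= (N * L / (1 - s) `^ (2 / p))%:E * Y)%E.
      have := coef_le_circle_mean n hf s01; rewrite -lee_fin => /le_trans; apply.
      have ifc := circle_cabs_integrable hf s01.
      rewrite /Rintegral fineK; last exact: integrable_fin_num ifc.
      have c0 : 0 <= N * L / (1 - s) `^ (2 / p) by rewrite divr_ge0 ?mulr_ge0 ?(ltW L0) ?(ltW d0).
      rewrite /Y -ge0_integralZl//; last 2 first.
      - by apply/measurable_EFinP; exact: mgY.
      - by move=> t _; rewrite lee_fin powR_ge0.
      apply: ge0_le_integral => //.
      - by move=> t _; rewrite lee_fin cabs_ge0.
      - exact: measurable_int ifc.
      - by apply: measurable_funeM; apply/measurable_EFinP; exact: mgY.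
      move=> t _; rewrite -EFinM lee_fin add0r.
      have cps : cabs (circle_point s t) = s by rewrite cabs_circle_point.
      have := fbound _ _ _ Q0 fQ hf (circle_point s t); rewrite cps => /(_ s1).
      by [].
    have q0 : 0 < 2 * pi * s ^+ n by rewrite mulr_gt0.
    rewrite -(@lee_pmul2l _ (2 * pi * s ^+ n)%:E) ?lte_fin//.
    rewrite -EFinM (_ : 2 * pi * s ^+ n * cabs (lam n) = 2 * pi * cabs (lam n) * s ^+ n); last by ring.
    apply: le_trans h1 _.
    rewrite [(Y * _)%E]muleC !muleA -!EFinM le_eqVlt; apply/orP; left; apply/eqP.
    congr (_%:E * _)%E; rewrite /K.
    have P0 : 2 * pi != 0 :> R by rewrite gt_eqF.
    by move: (2 * pi) P0 => P P0; field; rewrite P0 !gt_eqF.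
  (* Dividing by K N requires N nonzero. For N = 0, any radius, here 1/2, shows that the coefficient
     vanishes, since 0 times an infinite integral is 0. *)
  have [N00|Nn0] := eqVneq N 0.
    have h12 : 0 < (2^-1 : R) < 1 by lra.
    by rewrite N00 mule0; have := lb _ h12; rewrite N00 mulr0 mul0e.
  have Np : 0 < N by rewrite lt_neqAle eq_sym Nn0.
  have KN : 0 < K * N by rewrite mulr_gt0.
  rewrite /b muleAC -EFinM.
  have : ((cabs (lam n) / (K * N))%:E <= ereal_inf (S n))%E.
    apply/ereal_infP => y [s /=]; rewrite in_itv/= => s01 <-.
    have := lb _ s01; rewrite -(@lee_pmul2l _ ((K * N)^-1)%:E) ?lte_fin ?invr_gt0//.
    by rewrite muleA -!EFinM mulVf ?gt_eqF// mul1e mulrC.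
  rewrite -(@lee_pmul2l _ (K * N)%:E) ?lte_fin// -EFinM mulrC divfK ?gt_eqF//.
- by move=> r _; rewrite mulr_ge0 ?powR_ge0// ltW// mulr_gt0.
- move=> r r0 r1.
  have -> : (\sum_(1 <= n <oo) (b n * (cabs (w n) * r ^+ n)%:E))%E =
      (\sum_(1 <= n <oo) (K%:E * (ereal_inf (S n) * (cabs (w n) * r ^+ n)%:E)))%E.
    by apply: eq_eseriesr => n _; rewrite /b muleA.
  rewrite nneseriesZl; last first.
    by move=> n _; rewrite mule_ge0// lee_fin !mulr_ge0 ?cabs_ge0 ?exprn_ge0// ltW.
  rewrite /M powRN -[K * C5 * _]mulrA [leRHS]EFinM.
  by rewrite lee_wpmul2l ?lee_fin ?(ltW K0)//; exact: hser.
- apply: (@measurable_cabs_comp _ M); apply: measurable_funM; first exact: measurable_cst.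
  exact: measurable_one_minus_powR.
apply: area_scaled_majorant_lty => //; first by rewrite mulr_ge0 ?ltW.
rewrite (@disc_polar _ (fun z => (1 - cabs z) `^ (- k * p) * phi z)); last 2 first.
- apply: measurable_funM => //.
  exact: (measurable_cabs_comp (measurable_one_minus_powR (- k * p))).
- by move=> z z1; rewrite mulr_ge0 ?powR_ge0// phi0.
(* In polar coordinates the area integral is the iterated integral of the hypothesis. *)
apply: le_lt_trans hint; rewrite le_eqVlt; apply/orP; left; apply/eqP.
apply: eq_integral => r /set_mem; rewrite /= in_itv/= => /andP[r0 r1].
apply: eq_integral => t _; congr EFin.
by rewrite cabs_circle_point// mulNr powRN [p * k]mulrC /phi mulrA mulrAC.
Qed.

End UnivalentWeight.

Theorem theorem3p3 (R : realType) (p : R) (w : nat -> R[i]) :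
  1 <= p -> w 0%N = 0 ->
  ((exists C4 v : R,
      [/\ 0 < C4, v < p^-1 &
          forall r : R, 0 < r -> r < 1 ->
            (\sum_(1 <= n <oo)
               (cabs (w n) * (n.+1%:R `^ (3 / p)) * r ^+ n)%:E
             <= (C4 / (1 - r) `^ v)%:E)%E]) ->
   multiplier_bounded w p (fun z => 1 - `|complex.Re z|))
  /\
  (forall (gamma : R) (g : R[i] -> R[i]),
     0 < gamma -> gamma < 1 ->
     univalent g ->
     (forall z, z \in @unit_disc R -> 0 < complex.Re (g z)) ->
     (exists C5 k : R,
       [/\ 0 < C5,
           (forall r : R, 0 < r -> r < 1 ->
            (\sum_(1 <= n <oo)
               ereal_inf [set ((\int[lebesgue_measure]_(t in `[0%R, (2 * pi)%R])
                                  (cabs (g (circle_point s t)) `^ (- gamma / p))%:E)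
                               * ((s ^+ n * (1 - s) `^ (2 / p))^-1)%:E)%E
                         | s in `]0%R, 1%R[]
               * (cabs (w n) * r ^+ n)%:E
             <= (C5 / (1 - r) `^ k)%:E)%E)
         & (\int[lebesgue_measure]_(r in `]0%R, 1%R[)
              \int[lebesgue_measure]_(t in `[0%R, (2 * pi)%R])
                (r * cabs (g (circle_point r t)) `^ gamma
                 / (1 - r) `^ (p * k))%:E < +oo)%E]) ->
     multiplier_bounded w p (fun z => cabs (g z) `^ gamma)).
Proof.
move=> p1 w0; split=> [[C4 [v [C40 vp hser]]]|gamma g gamma0 _ [ag _] gpos [C5 [k [C50 hser hint]]]].
  exact: real_part_weight_multiplier p1 w0 C40 vp hser.
apply: (univalent_weight_multiplier p1 w0 gamma0 ag _ C50 hser hint) => z z1.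
by apply: gpos; rewrite in_unit_disc.
Qed.
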